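(* Let $r,s\in[1,2]$ and $p,q\in[1,+\infty)$ with $s\le q$. Then $E(L_r,p)\le_B E(L_s,q)$ if and only if $p\le q$ and $\frac{r}{p}\ge\frac{s}{q}$.
   Context: $L_r=L_r[0,1]$. For a separable Banach space $X$ and $p\in[1,\infty)$, $E(X,p)$ is the equivalence relation on the Polish space $X^{\mathbb N}$ given by $(x,y)\in E(X,p)\iff\sum_{n}\|x(n)-y(n)\|_X^p<+\infty$. $E\le_B F$ means there is a Borel map $\theta$ between the underlying Polish spaces with $(x,y)\in E\iff(\theta(x),\theta(y))\in F$. *)

(* Defs.v *)
From HB Require Import structures.
From mathcomp Require Import all_boot all_order all_algebra.
From mathcomp Require Import all_classical all_reals all_analysis.
From mathcomp Require Import measurable_realfun ess_sup_inf.

Set Implicit Arguments.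
Unset Strict Implicit.
Unset Printing Implicit Defensive.

Import Order.TTheory GRing.Theory Num.Theory.
Import numFieldNormedType.Exports.

Local Open Scope classical_set_scope.
Local Open Scope ring_scope.

(* The library defines [LspaceType mu p1] as a bare type.  Below it gets the
   operations of a normed module, by descent from [LfunType mu p1]. *)
Section Lspace_normedModType.
Context d (T : measurableType d) (R : realType).
Variables (mu : {measure set T -> \bar R}) (p : \bar R) (p1 : (1 <= p)%E).
Local Notation Lp := (LspaceType mu p1).
Local Notation Lf := (LfunType mu p1).
Local Open Scope quotient_scope.

HB.instance Definition _ := gen_eqMixin Lp.
HB.instance Definition _ := gen_choiceMixin Lp.

Lemma ae_eq_Lnorm (f g : T -> R) :
  measurable_fun setT f -> measurable_fun setT g -> f = g %[ae mu] ->
  ('N[mu]_p[EFin \o f] = 'N[mu]_p[EFin \o g])%E.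
Proof.
move=> mf mg fg; rewrite unlock /Lnorm; case: p p1 => [r r1| |//].
- have mpow (h : T -> R) : measurable_fun setT h ->
      measurable_fun setT (fun x => `|(EFin \o h) x| `^ r)%E.
    move=> mh; apply: (@measurableT_comp _ _ _ _ _ _ (fun x => x `^ r)%E).
      exact: measurable_poweR.
    by apply: measurableT_comp => //; exact/measurable_EFinP.
  congr (_ `^ _)%E; apply: ae_eq_integral; [by []|exact: mpow|exact: mpow|].
  by apply: filterS fg => x /= /[apply] ->.
- move=> _; case: ifPn => // _; apply: eq_ess_sup.
  by apply: filterS fg => x /= /(_ I) ->.
Qed.

(* [LspaceType] consists of classes of functions into [measurableTypeR R],
   which has the same sigma-algebra as [R] but another display. *)
Let cls (f : {mfun T >-> R}) : {mfun_ mu, T >-> measurableTypeR R} :=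
  \pi_({mfun_ mu, T >-> measurableTypeR R})
    (HB.pack_for {mfun T >-> measurableTypeR R} (f : T -> measurableTypeR R)
      (@isMeasurableFun.Build _ _ T (measurableTypeR R) f
        (@measurable_funPT _ _ _ _ f))).

Let repr_cls (f : {mfun T >-> R}) :
  (repr (cls f) : T -> R) = f %[ae mu].
Proof. by have /eqmodP/asboolP := reprK (cls f). Qed.

Let cls_finite (f : Lf) : finite_norm mu p (cls f : T -> R).
Proof.
rewrite /finite_norm (@ae_eq_Lnorm _ f); first exact: Lfunction_finite.
- exact: (@measurable_funPT _ _ _ _ (repr (cls f))).
- exact: measurable_funPT.
- exact: repr_cls.
Qed.

Let cls_eq (f g : {mfun T >-> R}) :
  (f : T -> R) = g %[ae mu] -> cls f = cls g.
Proof. by move=> fg; apply/eqmodP/asboolP. Qed.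

Let Lsp_measurable (f : Lp) : measurable_fun setT (f : T -> R).
Proof.
exact: (@measurable_funPT _ _ _ _
  (repr (f : {mfun_ mu, T >-> measurableTypeR R}))).
Qed.

Let Lsp_Lfun (f : Lp) : (f : T -> R) \in Lfun mu p.
Proof.
apply/andP; split; rewrite inE /=; first exact: Lsp_measurable.
exact: Lebesgue_finite.
Qed.

Definition Lclass (f : Lf) : Lp :=
  HB.pack_for Lp (cls f)
    (@isFinLebesgue.Build _ _ _ mu p p1 (cls f) (cls_finite f)).

Definition Lrepr (f : Lp) : Lf := Lfun_Sub p1 (Lsp_Lfun f).

Let Lsp_inj (f g : Lp) : (f : {mfun_ mu, T >-> measurableTypeR R}) = g -> f = g.
Proof.
case: f g => [f [[fp]]] [g [[gp]]] /= fg.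
by subst g; rewrite (Prop_irrelevance fp gp).
Qed.

Lemma Lclass_eq (f g : Lf) : (f : T -> R) = g %[ae mu] -> Lclass f = Lclass g.
Proof. by move=> fg; apply: Lsp_inj; exact: cls_eq. Qed.

Lemma LclassK (f : Lf) : (Lrepr (Lclass f) : T -> R) = f %[ae mu].
Proof. exact: repr_cls. Qed.

Lemma LreprK (f : Lp) : Lclass (Lrepr f) = f.
Proof.
apply: Lsp_inj; rewrite /= /cls -[RHS]reprK; congr (\pi _).
exact/val_inj.
Qed.

Definition Lspace_zero : Lp := Lclass 0.
Definition Lspace_opp (f : Lp) : Lp := Lclass (- Lrepr f).
Definition Lspace_add (f g : Lp) : Lp := Lclass (Lrepr f + Lrepr g).
Definition Lspace_scale (a : R) (f : Lp) : Lp := Lclass (a *: Lrepr f).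
Definition Lspace_norm (f : Lp) : R := fine ('N[mu]_p[EFin \o f])%E.

Let oppE (f : Lf) : Lspace_opp (Lclass f) = Lclass (- f).
Proof.
apply: Lclass_eq; apply: filterS (LclassK f) => x /(_ I) fx _.
have E (h : Lf) : (- h) x = - h x by [].
by rewrite !E fx.
Qed.

Let addE (f g : Lf) : Lspace_add (Lclass f) (Lclass g) = Lclass (f + g).
Proof.
apply: Lclass_eq; apply: filterS2 (LclassK f) (LclassK g).
move=> x /(_ I) fx /(_ I) gx _.
have E (h k : Lf) : (h + k) x = h x + k x by [].
by rewrite !E fx gx.
Qed.

Let scaleE a (f : Lf) : Lspace_scale a (Lclass f) = Lclass (a *: f).
Proof.
apply: Lclass_eq; apply: filterS (LclassK f) => x /(_ I) fx _.
have E (h : Lf) : (a *: h) x = a * h x by [].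
by rewrite !E fx.
Qed.

Let normE (f : Lf) : Lspace_norm (Lclass f) = fine ('N[mu]_p[EFin \o f])%E.
Proof.
congr fine; apply: ae_eq_Lnorm; last exact: repr_cls.
- exact: Lsp_measurable.
- exact: measurable_funPT.
Qed.

Let addA : associative Lspace_add.
Proof.
move=> f g h; rewrite -[f]LreprK -[g]LreprK -[h]LreprK !addE.
by rewrite GRing.addrA.
Qed.

Let addC : commutative Lspace_add.
Proof. by move=> f g; rewrite -[f]LreprK -[g]LreprK !addE GRing.addrC. Qed.

Let add0 : left_id Lspace_zero Lspace_add.
Proof. by move=> f; rewrite -[f]LreprK addE GRing.add0r. Qed.

Let addN : left_inverse Lspace_zero Lspace_opp Lspace_add.
Proof. by move=> f; rewrite -[f]LreprK oppE addE GRing.addNr. Qed.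

HB.instance Definition _ := GRing.isZmodule.Build Lp addA addC add0 addN.

Let scaleA a b (f : Lp) :
  Lspace_scale a (Lspace_scale b f) = Lspace_scale (a * b) f.
Proof. by rewrite -[f]LreprK !scaleE scalerA. Qed.

Let scale1 : left_id 1 Lspace_scale.
Proof. by move=> f; rewrite -[f]LreprK scaleE scale1r. Qed.

Let scaleDr : right_distributive Lspace_scale +%R.
Proof.
move=> a f g; rewrite -[f]LreprK -[g]LreprK [X in Lspace_scale a X]addE.
by rewrite !scaleE [RHS]addE scalerDr.
Qed.

Let scaleDl (f : Lp) : {morph Lspace_scale^~ f : a b / a + b}.
Proof.
by move=> a b; rewrite -[f]LreprK !scaleE [RHS]addE scalerDl.
Qed.

HB.instance Definition _ :=
  GRing.Zmodule_isLmodule.Build R Lp scaleA scale1 scaleDr scaleDl.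

Let normD (f g : Lp) : Lspace_norm (f + g) <= Lspace_norm f + Lspace_norm g.
Proof.
rewrite -[f]LreprK -[g]LreprK [X in Lspace_norm X]addE !normE.
exact: ler_LnormD.
Qed.

Let normZ (a : R) (f : Lp) : Lspace_norm (a *: f) = `|a| * Lspace_norm f.
Proof.
rewrite -[f]LreprK [X in Lspace_norm X]scaleE !normE; apply: EFin_inj.
by rewrite EFinM !finite_norm_fine LnormZ.
Qed.

Let norm0 (f : Lp) : Lspace_norm f = 0 -> f = 0.
Proof.
rewrite -[f]LreprK normE => /fine_Lnormr_eq0 f0.
exact: Lclass_eq.
Qed.

HB.instance Definition _ := Lmodule_isNormed.Build R Lp normD normZ norm0.

End Lspace_normedModType.

Section borel_reducibility.
Context {S T : topologicalType}.

Definition borel_map (f : S -> T) : Prop :=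
  forall B : set T, <<s [set U : set T | open U] >> B ->
    <<s [set U : set S | open U] >> (f @^-1` B).

Definition borel_reducible (E : S -> S -> Prop) (F : T -> T -> Prop) : Prop :=
  exists2 theta : S -> T, borel_map theta &
    forall x y, E x y <-> F (theta x) (theta y).

End borel_reducibility.

(* The underlying space is the power of [X] with the product topology. *)
Definition E_rel {R : realType} (X : normedModType R) (p : R)
    (x y : {ptws nat -> X}) : Prop :=
  (\sum_(0 <= n <oo) (`|x n - y n| `^ p)%:E < +oo)%E.
Arguments E_rel {R} X p x y.

(* Functions on the line up to equality almost everywhere in [0, 1]. *)
Definition lebesgue01 (R : realType) :
    {measure set (measurableTypeR R) -> \bar R} :=
  mrestr lebesgue_measure (measurable_itv `[0, 1]).

Definition L01 (R : realType) (r : R) (r1 : 1 <= r) : normedModType R :=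
  LspaceType (lebesgue01 R) (r1 : (1 <= r%:E)%E).

(* Main.v *)
(** Negative direction: read through a countable set of codes, a reduction is a
    Borel map on the Baire space, and a category argument makes it depend on
    disjoint blocks of coordinates separately, up to summable errors.  Hence
    finite subsets of L_r embed uniformly into finite sums of copies of L_s, with
    d^p comparable to the sum of the q-th powers of the distances.  Points on a
    segment then force p <= q.  Indicator functions 1_A, carried by the Mazur map
    u |-> |u|^(q/s-1) u to an l_s-sum of copies of L_s, contradict Enflo type s
    of L_s unless s/q <= r/p.

    Positive direction: it suffices to map the dyadic step functions with
    rational values so that the p-th power of the distance is comparable to a
    sum of q-th powers of distances in L_s.  Step functions F are sent linearly
    to random variables X_F on [0, 1] with 1 - E cos(u X_F) comparable to
    (u |F|_r)^r at the relevant scales: a LePage series for r < 2, a Rademacher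
    series for r = 2.  For 0 < b < t, |x|^b is comparable to the sum over k in Z
    of 2^(kb) |exp(i x/2^k) - 1|^t, which turns this into moments and into
    snowflakes.  When r/p = s/q and p < q the same comparison with t = s is applied
    pointwise to F and packed into a single function of L_s. *)

Require Import Defs.
From HB Require Import structures.
From mathcomp Require Import all_boot all_order all_algebra.
From mathcomp Require Import all_classical all_reals all_analysis.
From mathcomp Require Import measurable_realfun ess_sup_inf.
From mathcomp Require Import complex lra ring zify.

Set Implicit Arguments.
Unset Strict Implicit.
Unset Printing Implicit Defensive.

Import Order.TTheory GRing.Theory Num.Theory.
Import numFieldNormedType.Exports.

Local Open Scope classical_set_scope.
Local Open Scope ring_scope.

(** * Functions in L_r[0,1] and binary digits *)

Section L01_functions.
Context {R : realType}.
Implicit Types (r : R).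

Definition fn r (r1 : 1 <= r) (f : L01 r1) : measurableTypeR R -> R :=
  Lrepr (f : LspaceType (lebesgue01 R) (r1 : (1 <= r%:E)%E)).

Lemma fn_measurable r (r1 : 1 <= r) (f : L01 r1) : measurable_fun setT (fn f).
Proof. exact: (@measurable_funPT _ _ _ _ (Lrepr (f : LspaceType (lebesgue01 R) (r1 : (1 <= r%:E)%E)))). Qed.

Lemma L01_normE r (r1 : 1 <= r) (f : L01 r1) :
  (`|f| `^ r)%:E = (\int[lebesgue01 R]_x (`|fn f x| `^ r)%:E)%E.
Proof.
have r0 : r != 0 by rewrite gt_eqF // (lt_le_trans _ r1).
have := poweR_Lnorm (lebesgue01 R) (EFin \o fn f) r0.
have -> : ('N[lebesgue01 R]_(r%:E)[EFin \o fn f] = `|f|%:E)%E.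
  by rewrite -[in LHS]finite_norm_fine //; exact: Lfunction_finite.
by [].
Qed.

Lemma fn_sub r (r1 : 1 <= r) (f g : L01 r1) :
  {ae lebesgue01 R, forall x, fn (f - g) x = fn f x - fn g x}.
Proof.
pose mg := Lclass (- Lrepr (g : LspaceType (lebesgue01 R) (r1 : (1 <= r%:E)%E))).
have h1 := LclassK (- Lrepr (g : LspaceType (lebesgue01 R) (r1 : (1 <= r%:E)%E))).
have h2 := LclassK (Lrepr (f : LspaceType (lebesgue01 R) (r1 : (1 <= r%:E)%E)) + Lrepr mg).
apply: filterS2 h1 h2 => x /(_ I) h1 /(_ I) h2.
transitivity ((Lrepr (f : LspaceType (lebesgue01 R) (r1 : (1 <= r%:E)%E)) + Lrepr mg) x); first exact: h2.
have E (h k : LfunType (lebesgue01 R) (r1 : (1 <= r%:E)%E)) : (h + k) x = h x + k x by [].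
by rewrite E /mg h1.
Qed.

Lemma measurable_powR_dist (a : R) (f g : measurableTypeR R -> R) :
  measurable_fun setT f -> measurable_fun setT g ->
  measurable_fun setT (fun x => (`|f x - g x| `^ a)%:E).
Proof.
move=> mf mg; apply/measurable_EFinP.
apply: (@measurableT_comp _ _ _ _ _ _ (fun x : R => x `^ a)) => //.
by apply: measurableT_comp => //; exact: measurable_funB.
Qed.

Lemma ae_integral_powR (a : R) (f g f' g' : measurableTypeR R -> R) :
  measurable_fun setT f -> measurable_fun setT g ->
  measurable_fun setT f' -> measurable_fun setT g' ->
  {ae lebesgue01 R, forall x, f x = f' x} ->
  {ae lebesgue01 R, forall x, g x = g' x} ->
  (\int[lebesgue01 R]_x (`|f x - g x| `^ a)%:E =
   \int[lebesgue01 R]_x (`|f' x - g' x| `^ a)%:E)%E.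
Proof.
move=> mf mg mf' mg' ff' gg'; apply: ae_eq_integral => //; try exact: measurable_powR_dist.
by apply: filterS2 ff' gg' => x -> ->.
Qed.

Lemma L01_distE r (r1 : 1 <= r) (f g : L01 r1) :
  (`|f - g| `^ r)%:E = (\int[lebesgue01 R]_x (`|fn f x - fn g x| `^ r)%:E)%E.
Proof.
rewrite L01_normE; apply: ae_eq_integral => //.
- have := measurable_powR_dist r (fn_measurable (f - g)) (@measurable_cst _ _ (measurableTypeR R) R setT 0).
  by apply: eq_measurable_fun => x _; rewrite subr0.
- by apply: measurable_powR_dist; exact: fn_measurable.
- by apply: filterS (fn_sub f g) => x ->.
Qed.

Lemma L01_dist_aeE r (r1 : 1 <= r) (f g : L01 r1) (F G : measurableTypeR R -> R) :
  measurable_fun setT F -> measurable_fun setT G ->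
  {ae lebesgue01 R, forall x, fn f x = F x} ->
  {ae lebesgue01 R, forall x, fn g x = G x} ->
  (`|f - g| `^ r)%:E = (\int[lebesgue01 R]_x (`|F x - G x| `^ r)%:E)%E.
Proof.
move=> mF mG fF gG; rewrite L01_distE.
exact: (ae_integral_powR r (fn_measurable f) (fn_measurable g) mF mG fF gG).
Qed.

Lemma fn_ae_refl r (r1 : 1 <= r) (f : L01 r1) : {ae lebesgue01 R, forall x, fn f x = fn f x}.
Proof. exact: aeW. Qed.

Lemma L01_mk r (r1 : 1 <= r) (F : measurableTypeR R -> R) :
  measurable_fun setT F ->
  (\int[lebesgue01 R]_x (`|F x| `^ r)%:E < +oo)%E ->
  exists f : L01 r1, {ae lebesgue01 R, forall x, fn f x = F x}.
Proof.
move=> mF finF.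
have r0 : r != 0 by rewrite gt_eqF // (lt_le_trans _ r1).
have FL : F \in Lfun (lebesgue01 R) r%:E.
  apply/andP; split; rewrite inE //=.
  rewrite /finite_norm ltNge leye_eq; apply/negP => /eqP NF.
  have := poweR_Lnorm (lebesgue01 R) (EFin \o F) r0.
  by rewrite NF poweRyr // => e; move: finF; rewrite -e.
exists (Lclass (Lfun_Sub (r1 : (1 <= r%:E)%E) FL)).
by apply: filterS (LclassK (Lfun_Sub (r1 : (1 <= r%:E)%E) FL)) => x /(_ I).
Qed.

Lemma mu01_setT : lebesgue01 R setT = 1%E.
Proof.
have -> : lebesgue01 R setT = lebesgue_measure (setT `&` `[0, 1]%classic : set R) by [].
rewrite setTI (lebesgue_measure_itv `[0, 1]) /=.
by rewrite lte_fin ltr01 sube0.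
Qed.

End L01_functions.

Section binary_digits.
Context {R : realType}.

Fixpoint brem (n : nat) (x : R) : R :=
  if n is m.+1 then 2 * brem m x - ((2^-1 : R) <= brem m x)%R%:R else x.

Definition dig (n : nat) (x : R) : bool := 2^-1 <= brem n x.

Fixpoint pnum (s : nat -> bool) (n : nat) : R :=
  if n is m.+1 then 2 * pnum s m + (s m)%:R else 0.

Lemma brem_itv n x : 0 <= x < 1 -> 0 <= brem n x < 1.
Proof.
move=> x01; elim: n => //= n /andP[IH0 IH1].
by case: (lerP 2^-1 (brem n x)) => h /=; lra.
Qed.

Lemma brem_pnum s n x : (forall i, (i < n)%N -> dig i x = s i) ->
  brem n x = 2 ^+ n * x - pnum s n.
Proof.
elim: n => [|n IH] h /=; first by rewrite expr0 mul1r subr0.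
have -> : (2^-1 <= brem n x) = s n by apply: h.
by rewrite IH; [rewrite exprS; ring|move=> i ni; apply: h; exact: ltnW].
Qed.

Lemma dig_prefix s n x : 0 <= x < 1 ->
  (forall i, (i < n)%N -> dig i x = s i) <-> pnum s n <= 2 ^+ n * x < pnum s n + 1.
Proof.
move=> x01; split=> [h|].
  by have := brem_itv n x01; rewrite (brem_pnum h); lra.
elim: n => [//|n IH] h i /=; rewrite ltnS leq_eqVlt.
have h' : pnum s n <= 2 ^+ n * x < pnum s n + 1.
  by move: h; rewrite exprS /=; case: (s n) => /=; lra.
case/orP => [/eqP ->|]; last exact: IH h' i.
move: h; rewrite /dig (brem_pnum (IH h')) exprS /=.
by case: (s n) => /= h; apply/idP; lra.
Qed.

Lemma measurable_brem n : measurable_fun setT (brem n : measurableTypeR R -> R).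
Proof.
elim: n => [|n IH]; first exact: measurable_id.
apply: measurable_funB; first exact: measurable_funM.
have -> : (fun x : measurableTypeR R => ((2^-1 : R) <= brem n x)%R%:R) =
    (\1_[set x : measurableTypeR R | 2^-1 <= brem n x] : _ -> R).
  by apply/funext => x; rewrite indicE; congr (_%:R); congr nat_of_bool; apply/idP/idP; rewrite inE.
apply: measurable_indic.
rewrite -[X in measurable X]setTI.
by apply: measurable_fun_le => //.
Qed.

Lemma measurable_dig n b : measurable [set x : measurableTypeR R | dig n x = b].
Proof.
have h : measurable [set x : measurableTypeR R | 2^-1 <= brem n x].
  rewrite -[X in measurable X]setTI; apply: measurable_fun_le => //; exact: measurable_brem.
case: b; first exact: h.
have -> : [set x : measurableTypeR R | dig n x = false] = ~` [set x | 2^-1 <= brem n x].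
  by apply/seteqP; split=> x /=; rewrite /dig; [move=> -> | move/negP/negbTE].
exact: measurableC.
Qed.

Definition prefix_set (s : nat -> bool) n : set (measurableTypeR R) :=
  [set x | forall i, (i < n)%N -> dig i x = s i].

Lemma measurable_prefix_set s n : measurable (prefix_set s n).
Proof.
have -> : prefix_set s n = \bigcap_(i in `I_n) [set x | dig i x = s i].
  by apply/seteqP; split=> x h i; exact: h.
by apply: bigcap_measurableType => // i _; exact: measurable_dig.
Qed.

Lemma pnum_ge0 s n : 0 <= pnum s n.
Proof. by elim: n => //= n IH; apply: addr_ge0 => //; apply: mulr_ge0. Qed.

Lemma pnum_lt s n : pnum s n + 1 <= 2 ^+ n.
Proof. by elim: n => [|n IH] /=; rewrite ?expr0 ?add0r // exprS; case: (s n) => /=; lra. Qed.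

Lemma mu01_prefix s n : lebesgue01 R (prefix_set s n) = ((2 ^+ n)^-1)%:E.
Proof.
have e2 : 0 < 2 ^+ n :> R by rewrite exprn_gt0.
set I := `[pnum s n / 2 ^+ n, (pnum s n + 1) / 2 ^+ n[%classic : set R.
have -> : lebesgue01 R (prefix_set s n) =
    lebesgue_measure (I `|` (prefix_set s n `&` [set 1])).
  have -> : I `|` (prefix_set s n `&` [set 1]) = prefix_set s n `&` `[0, 1]%classic => //.
  apply/seteqP; split => [x [|[h x1]]|x [h] /=]; rewrite ?in_itv /=.
  - rewrite /I /= in_itv /= ler_pdivrMr // ltr_pdivlMr // mulrC => h.
    have x01 : 0 <= x < 1.
      have := pnum_ge0 s n; have := pnum_lt s n.
      by move=> ? ?; apply/andP; split; rewrite -(ler_pM2l e2, ltr_pM2l e2) ?mulr0 ?mulr1; lra.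
    split; first by apply/(dig_prefix s n x01).
    by rewrite in_itv /=; lra.
  - by move: h; rewrite x1 => h; split => //; rewrite /= in_itv /=; lra.
  - case: (ltrP x 1) => x1; last by move=> ?; right; split => //=; lra.
    move=> x01; left; rewrite /I /= in_itv /= ler_pdivrMr // ltr_pdivlMr // mulrC.
    by apply/dig_prefix => //; lra.
rewrite measureU0 //=; last first.
- apply/eqP; rewrite -measure_le0 -(lebesgue_measure_set1 (1 : R)); apply: le_measure => //.
  - by rewrite inE; apply: measurableI => //; exact: measurable_prefix_set.
  - by rewrite inE.
- by apply: measurableI => //; exact: measurable_prefix_set.
- exact: measurable_itv.
rewrite lebesgue_measure_itv /= lte_fin ltr_pM2r ?invr_gt0 // ltrDl ltr01.
by rewrite -EFinD; congr EFin; field; rewrite gt_eqF.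
Qed.


Definition digs (x : R) : nat -> bool := fun i => dig i x.
Definition pre n (s : nat -> bool) : {ffun 'I_n -> bool} := [ffun i : 'I_n => s i].

Definition lift_seq n (w : {ffun 'I_n -> bool}) : nat -> bool :=
  fun i => if insub i is Some j then w j else false.

Lemma lift_seqE n (w : {ffun 'I_n -> bool}) (i : 'I_n) : lift_seq w i = w i.
Proof. by rewrite /lift_seq valK. Qed.

Lemma pre_digsP n (w : {ffun 'I_n -> bool}) :
  [set x : measurableTypeR R | pre n (digs x) = w] = prefix_set (lift_seq w) n.
Proof.
apply/seteqP; split => x /= h.
  move=> i ni; rewrite -h /lift_seq; case: insubP => [j _ <-|]; last by rewrite ni.
  by rewrite ffunE.
by apply/ffunP => i; rewrite ffunE /digs h // lift_seqE.
Qed.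

Lemma measurable_pre_digs n (w : {ffun 'I_n -> bool}) :
  measurable [set x : measurableTypeR R | pre n (digs x) = w].
Proof. by rewrite pre_digsP; exact: measurable_prefix_set. Qed.

Lemma pre_digs_indic n (G : {ffun 'I_n -> bool} -> R) (x : measurableTypeR R) :
  G (pre n (digs x)) = \sum_w G w * \1_[set x : measurableTypeR R | pre n (digs x) = w] x.
Proof.
rewrite (bigD1 (pre n (digs x))) //= indicE mem_set // mulr1 big1 ?addr0 // => w wx.
by rewrite indicE memNset ?mulr0 //= => e; rewrite e eqxx in wx.
Qed.

Lemma measurable_cylinder n (G : {ffun 'I_n -> bool} -> R) :
  measurable_fun setT (fun x : measurableTypeR R => G (pre n (digs x))).
Proof.
under [X in measurable_fun _ X]eq_fun => x do rewrite pre_digs_indic.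
apply: measurable_sum => w; apply: measurable_funM => //.
by apply: measurable_indic; exact: measurable_pre_digs.
Qed.

Lemma digs_law n (G : {ffun 'I_n -> bool} -> R) : (forall w, 0 <= G w) ->
  (\int[lebesgue01 R]_x (G (pre n (digs x)))%:E = ((\sum_w G w) / 2 ^+ n)%:E)%E.
Proof.
move=> G0.
under eq_integral => x _ do rewrite pre_digs_indic -sumEFin.
rewrite ge0_integral_sum //=; first last.
- by move=> w x _; rewrite lee_fin mulr_ge0.
- move=> w; apply/measurable_EFinP; apply: measurable_funM => //.
  by apply: measurable_indic; exact: measurable_pre_digs.
rewrite mulr_suml -sumEFin; apply: eq_bigr => w _.
under eq_integral => x _ do rewrite EFinM.
rewrite ge0_integralZl_EFin //; last first.
  by apply/measurable_EFinP; apply: measurable_indic; exact: measurable_pre_digs.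
rewrite integral_indic //; last exact: measurable_pre_digs.
by rewrite setIT pre_digsP [X in (_ * X)%E](mu01_prefix (lift_seq w) n) EFinM.
Qed.

End binary_digits.

Section injection_law.
Variables (I : finType) (N : nat) (f : I -> 'I_N).
Hypothesis f_inj : injective f.

Definition restr (w : {ffun 'I_N -> bool}) : {ffun I -> bool} := [ffun i => w (f i)].

Lemma card_restr (t : {ffun I -> bool}) :
  #|[pred w | restr w == t]| = #|[pred w | restr w == [ffun=> false]]|.
Proof.
pose ext : {ffun 'I_N -> bool} := [ffun k => if [pick i | f i == k] is Some i then t i else false].
have extE i : ext (f i) = t i.
  rewrite ffunE; case: pickP => [j /eqP/f_inj -> //|/(_ i)]; by rewrite eqxx.
pose xr (w : {ffun 'I_N -> bool}) : {ffun 'I_N -> bool} := [ffun k => w k (+) ext k].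
have xrE w k : xr w k = w k (+) ext k by rewrite ffunE.
have restrE w i : restr w i = w (f i) by rewrite ffunE.
have xrK : involutive xr by move=> w; apply/ffunP => k; rewrite !xrE addbK.
rewrite -(fintype.card_image (inv_inj xrK) [pred w | restr w == t]); apply: eq_card => w.
rewrite [RHS]inE; apply/fintype.imageP/eqP => [[w' ]|h].
  rewrite inE => /eqP h ->; apply/ffunP => i; move/ffunP: h => /(_ i).
  by rewrite !restrE xrE extE ffunE => ->; rewrite addbb.
exists (xr w); last by rewrite xrK.
rewrite inE; apply/eqP/ffunP => i; move/ffunP: h => /(_ i).
by rewrite !restrE xrE extE ffunE => ->.
Qed.

Lemma sum_restr (R : realType) (G : {ffun I -> bool} -> R) :
  (\sum_w G (restr w)) / 2 ^+ N = (\sum_t G t) / 2 ^+ #|I|.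
Proof.
set c := #|[pred w | restr w == [ffun=> false]]|.
have E (H : {ffun I -> bool} -> R) : \sum_w H (restr w) = (\sum_t H t) * c%:R.
  rewrite (partition_big restr predT) //= mulr_suml; apply: eq_bigr => t _.
  rewrite (eq_bigr (fun=> H t)); last by move=> w /eqP ->.
  by rewrite /c -(card_restr t) -sum1_card natr_sum mulr_sumr; apply: eq_bigr => w _; rewrite mulr1.
have := E (fun=> 1); rewrite !sumr_const !card_ffun !card_bool card_ord !natrX => E1.
have c0 : c%:R != 0 :> R.
  by apply/eqP => h; move: E1; rewrite h mulr0 => /eqP; rewrite expf_eq0 pnatr_eq0 andbF.
by rewrite E E1; field; rewrite c0 andbT expf_neq0 // pnatr_eq0.
Qed.

End injection_law.

Section iid.
Context {R : realType}.

(* The digits of rank [pickle (i, _)]: for distinct [i] these are independent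
   sequences of fair bits. *)
Definition stream (i : nat) (x : R) : nat -> bool :=
  fun j => dig (pickle (i, j)) x.

Definition grid n m (x : R) : {ffun 'I_n * 'I_m -> bool} :=
  [ffun k : 'I_n * 'I_m => stream k.1 x k.2].

Let bnd n m := (\max_(k : 'I_n * 'I_m) pickle (k.1 : nat, k.2 : nat)).+1.

Let emb n m (k : 'I_n * 'I_m) : 'I_(bnd n m) := inord (pickle (k.1 : nat, k.2 : nat)).

Let embE n m (k : 'I_n * 'I_m) : emb k = pickle (k.1 : nat, k.2 : nat) :> nat.
Proof. by rewrite inordK // ltnS (leq_bigmax k). Qed.

Let emb_inj n m : injective (@emb n m).
Proof.
move=> [i j] [i' j'] /(congr1 val); rewrite /= !embE => /(pcan_inj pickleK) [].
by move=> /ord_inj -> /ord_inj ->.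
Qed.

Let gridE n m (x : R) : grid n m x = restr (@emb n m) (pre (bnd n m) (digs x)).
Proof. by apply/ffunP => k; rewrite !ffunE embE. Qed.

Lemma measurable_grid n m (G : {ffun 'I_n * 'I_m -> bool} -> R) :
  measurable_fun setT (fun x : measurableTypeR R => G (grid n m x)).
Proof.
have := @measurable_cylinder R (bnd n m) (G \o restr (@emb n m)).
by apply: eq_measurable_fun => x _; rewrite gridE.
Qed.

Lemma grid_law n m (G : {ffun 'I_n * 'I_m -> bool} -> R) : (forall w, 0 <= G w) ->
  (\int[lebesgue01 R]_x (G (grid n m x))%:E = ((\sum_w G w) / 2 ^+ (n * m))%:E)%E.
Proof.
move=> G0; under eq_integral => x _ do rewrite gridE.
have := @digs_law R (bnd n m) (G \o restr (@emb n m)) (fun=> G0 _) => /= ->.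
by rewrite sum_restr; [rewrite card_prod !card_ord|exact: emb_inj].
Qed.

End iid.

Section density.
Context {R : realType}.

Lemma powR_le_id (a x : R) : 0 <= x <= 1 -> 1 <= a -> x `^ a <= x.
Proof.
move=> /andP[x0 x1] a1; have [->|xn0] := eqVneq x 0; first by rewrite powR0 // gt_eqF // (lt_le_trans _ a1).
by rewrite -[leRHS]powRr1 //; apply: ger_powR => //; rewrite x1 andbT lt_def xn0.
Qed.

Lemma dominated_powR (a : R) (F : measurableTypeR R -> R) (Fn : nat -> measurableTypeR R -> R) (B : measurableTypeR R -> R) :
  1 <= a -> measurable_fun setT F -> (forall n, measurable_fun setT (Fn n)) ->
  measurable_fun setT B ->
  (\int[lebesgue01 R]_x (`|B x| `^ a)%:E < +oo)%E ->
  (forall n x, `|Fn n x - F x| <= `|B x|) ->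
  {ae lebesgue01 R, forall x, forall e, 0 < e -> \forall n \near \oo, `|Fn n x - F x| < e} ->
  forall e, 0 < e -> exists n, (\int[lebesgue01 R]_x (`|Fn n x - F x| `^ a)%:E < e%:E)%E.
Proof.
move=> a1 mF mFn mB finB FB FnF e e0.
have mG n : measurable_fun setT (fun x => (`|Fn n x - F x| `^ a)%:E).
  exact: measurable_powR_dist.
have iB : (lebesgue01 R).-integrable setT (fun x => (`|B x| `^ a)%:E).
  apply/integrableP; split.
    have := measurable_powR_dist a mB (@measurable_cst _ _ (measurableTypeR R) R setT 0).
    by apply: eq_measurable_fun => x _; rewrite subr0.
  by under eq_integral => x _ do rewrite gee0_abs ?lee_fin ?powR_ge0 //.
have a0 : 0 <= a by rewrite (le_trans _ a1).
have [] := @dominated_convergence _ _ _ (lebesgue01 R) setT measurableT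
  (fun n x => (`|Fn n x - F x| `^ a)%:E) (cst 0%E) (fun x => (`|B x| `^ a)%:E) mG (measurable_cst _) _ iB.
- apply: filterS FnF => x FnF _; apply: cvg_EFin; first by near=> n.
  apply/cvgrPdist_lt => d d0.
  have : 0 < Num.min d 1 by rewrite lt_min d0 ltr01.
  move=> /FnF; apply: filterS => n; rewrite lt_min => /andP[h1 h2] /=.
  rewrite sub0r normrN ger0_norm ?powR_ge0 //; apply: le_lt_trans h1.
  by apply: powR_le_id => //; rewrite normr_ge0 ltW.
- apply: aeW => x n _; rewrite gee0_abs ?lee_fin ?powR_ge0 //.
  by rewrite ge0_ler_powR // nnegrE.
move=> _ _; rewrite integral_cst //= mul0e => /fine_cvgP[] fin /cvgrPdist_lt /(_ _ e0) near.
have [n [h1 h2]] : exists n, (\int[lebesgue01 R]_x (`|Fn n x - F x| `^ a)%:E)%E \is a fin_num /\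
   `|0 - fine (\int[lebesgue01 R]_x (`|Fn n x - F x| `^ a)%:E)%E| < e.
  have [n _ nP] := filterI fin near; exists n; exact: (nP n (leqnn n)).
exists n; rewrite -(fineK h1) lte_fin; apply: le_lt_trans h2.
by rewrite sub0r normrN ler_norm.
Unshelve. all: by end_near. Qed.

Definition I01 : set (measurableTypeR R) := `[0, 1]%classic.

Lemma measurable_I01 : measurable I01. Proof. exact: measurable_itv. Qed.

Lemma I01_measure : lebesgue_measure I01 = 1%E.
Proof. by rewrite [X in lebesgue_measure X](_ : _ = [set` `[0, 1]%R]) // lebesgue_measure_itv /= lte_fin ltr01 sube0. Qed.

Lemma mu01_ae_itv : {ae lebesgue01 R, forall x : measurableTypeR R, (0 : R) <= (x : R) < 1}.
Proof.
exists (~` I01 `|` [set 1]); split.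
- by apply: measurableU => //; apply: measurableC; exact: measurable_I01.
- have -> : lebesgue01 R (~` I01 `|` [set 1]) = lebesgue_measure ((~` I01 `|` [set 1]) `&` I01) by [].
  apply/eqP; rewrite -measure_le0 -(lebesgue_measure_set1 (1 : R)); apply: le_measure.
  + rewrite inE; apply: measurableI; last exact: measurable_I01.
    by apply: measurableU => //; apply: measurableC; exact: measurable_I01.
  + by rewrite inE.
  + by move=> x [[]].
- move=> x /= h; have [x1|/eqP x1] := eqVneq x 1; [by right|left].
  rewrite /I01 /= in_itv /= => x01; apply: h; have /eqP := x1; lra.
Qed.

Lemma integral_mu01 (f : measurableTypeR R -> \bar R) :
  measurable_fun setT f ->
  (\int[lebesgue01 R]_x f x = \int[lebesgue_measure]_(x in I01) f x)%E.
Proof.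
move=> mf; have m01 := measurable_I01.
transitivity (\int[lebesgue01 R]_(x in I01) f x)%E.
  rewrite [RHS]integral_mkcond; apply: ae_eq_integral => //.
    by apply/(measurable_restrictT _ m01); exact: measurable_funTS.
  case: mu01_ae_itv => A [mA A0 AP]; exists A; split => // x /= h; apply: AP => /= x01; apply: h => _.
  by rewrite patchE mem_set // /I01 /= in_itv /=; lra.
apply: eq_measure_integral => A mA A01.
have -> : lebesgue01 R A = lebesgue_measure (A `&` I01) by [].
by rewrite setIidl.
Qed.

Lemma finite_mu01 (F : measurableTypeR R -> R) (M a : R) : 0 <= a ->
  measurable_fun setT F -> (forall x, `|F x| <= M) ->
  (\int[lebesgue01 R]_x (`|F x| `^ a)%:E < +oo)%E.
Proof.
move=> a0 mF FM.
apply: (@le_lt_trans _ _ (\int[lebesgue01 R]_x (M `^ a)%:E)%E).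
  apply: ge0_le_integral => //.
  - have := measurable_powR_dist a mF (@measurable_cst _ _ (measurableTypeR R) R setT 0).
    by apply: eq_measurable_fun => x _; rewrite subr0.
  - by move=> x _; rewrite lee_fin ge0_ler_powR // nnegrE // (le_trans _ (FM x)).
by rewrite integral_cst // mu01_setT mule1 ltry.
Qed.

Definition clip (M x : R) : R := Num.max (- M) (Num.min M x).

Lemma clip_norm M x : 0 <= M -> `|clip M x| <= M.
Proof.
move=> M0; rewrite /clip ler_norml le_max lexx /= ge_max ge_min lexx /=.
by rewrite andbT; lra.
Qed.

Lemma clip_id M x : `|x| <= M -> clip M x = x.
Proof. by rewrite ler_norml /clip => /andP[h1 h2]; rewrite min_r // max_r. Qed.

Lemma clip_dist M x : 0 <= M -> `|clip M x - x| <= `|x|.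
Proof.
rewrite /clip /Num.max /Num.min => M0; case: ifP; case: ifP => ? ?; have := ler_norm x; have := ler_norm (- x);
  rewrite normrN ler_norml; case: (lerP 0 x) => ?; lra.
Qed.

Lemma clip_lip M x y : `|clip M x - clip M y| <= `|x - y|.
Proof.
wlog xy : x y / y <= x.
  by case: (leP y x) => [|/ltW] h H; [exact: H|rewrite distrC [leRHS]distrC; exact: H].
rewrite [leRHS]ger0_norm ?subr_ge0 // /clip /Num.max /Num.min ler_norml.
by case: ifP; case: ifP; case: ifP; case: ifP => *; lra.
Qed.

Lemma measurable_clip M (F : measurableTypeR R -> R) : measurable_fun setT F ->
  measurable_fun setT (fun x => clip M (F x)).
Proof. by move=> mF; apply: measurable_maxr => //; exact: measurable_minr. Qed.


Definition scode := {m : nat & {ffun {ffun 'I_m -> bool} -> rat}}.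

Definition sfun (c : scode) (s : nat -> bool) : R := ratr (tagged c (pre (tag c) s)).

Lemma measurable_sfun c : measurable_fun setT (fun x : measurableTypeR R => sfun c (digs x)).
Proof. exact: (measurable_cylinder (fun w => ratr (tagged c w))). Qed.

Lemma sfun_bounded c : exists2 M, 0 <= M & forall s, `|sfun c s| <= M.
Proof.
exists (\sum_w `|ratr (tagged c w) : R|); first exact: sumr_ge0.
by move=> s; rewrite /sfun (bigD1 (pre (tag c) s)) //= lerDl sumr_ge0.
Qed.

Lemma step_subproof (r : R) (r1 : 1 <= r) c :
  exists f : L01 r1, {ae lebesgue01 R, forall x, fn f x = sfun c (digs x)}.
Proof.
apply: L01_mk; first exact: measurable_sfun.
have [M M0 cM] := sfun_bounded c; apply: (@finite_mu01 _ M) => //; last exact: measurable_sfun.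
exact: le_trans r1.
Qed.

Definition step (r : R) (r1 : 1 <= r) c : L01 r1 := projT1 (cid (step_subproof r1 c)).

Lemma stepE (r : R) (r1 : 1 <= r) c :
  {ae lebesgue01 R, forall x, fn (step r1 c) x = sfun c (digs x)}.
Proof. exact: (projT2 (cid (step_subproof r1 c))). Qed.

Lemma rat_approx (x e : R) : 0 < e -> exists q : rat, `|ratr q - x| < e.
Proof.
move=> e0; have [q] := @rat_in_itvoo _ (x - e) (x + e) ltac:(lra).
by rewrite in_itv /= => h; exists q; rewrite ltr_distl; lra.
Qed.

Lemma digs_cvg (x : R) : 0 <= x < 1 -> forall n,
  `|pnum (digs x) n / 2 ^+ n - x| <= (2 ^+ n)^-1.
Proof.
move=> x01 n; have /(dig_prefix (digs x) n x01) h : forall i, (i < n)%N -> dig i x = digs x i by [].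
have e2 : 0 < 2 ^+ n :> R by rewrite exprn_gt0.
rewrite -(ler_pM2l e2) divff ?gt_eqF // -[X in X * _](gtr0_norm e2) -normrM mulrBr.
by rewrite mulrCA divff ?gt_eqF // mulr1 ler_norml; lra.
Qed.

Lemma pnum_pre (n : nat) (s t : nat -> bool) : (forall i, (i < n)%N -> s i = t i) -> pnum s n = pnum t n :> R.
Proof. by elim: n => //= n IH h; rewrite h ?IH // => i ni; apply: h; exact: ltnW. Qed.

Lemma L01_dist_lt (r : R) (r1 : 1 <= r) (f g : L01 r1) (F G : measurableTypeR R -> R) (e : R) :
  measurable_fun setT F -> measurable_fun setT G ->
  {ae lebesgue01 R, forall x, fn f x = F x} ->
  {ae lebesgue01 R, forall x, fn g x = G x} ->
  0 < e -> (\int[lebesgue01 R]_x (`|F x - G x| `^ r)%:E < (e `^ r)%:E)%E ->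
  `|f - g| < e.
Proof.
move=> mF mG fF gG e0; rewrite -(L01_dist_aeE mF mG fF gG) lte_fin.
have r0 : 0 <= r by rewrite (le_trans _ r1).
move=> h; rewrite ltNge; apply/negP => eh; move: h; rewrite ltNge ge0_ler_powR ?nnegrE //; exact: ltW.
Qed.

Lemma powR_le_mul (a u v K : R) : 1 <= a -> 0 <= u -> u <= v -> u <= K ->
  u `^ a <= K `^ (a - 1) * v.
Proof.
move=> a1 u0 uv uK; have [->|un0] := eqVneq u 0.
  rewrite powR0 ?gt_eqF // ?(lt_le_trans _ a1) // mulr_ge0 ?powR_ge0 //; exact: le_trans uv.
have {1}-> : a = (a - 1) + 1 by rewrite subrK.
rewrite powRD ?un0 ?implybT // powRr1 //; apply: ler_pM => //; first exact: powR_ge0.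
by apply: ge0_ler_powR; rewrite ?nnegrE ?subr_ge0 // (le_trans u0).
Qed.

Lemma step_dense (r : R) (r1 : 1 <= r) (f : L01 r1) (e : R) : 0 < e ->
  exists c, `|f - step r1 c| < e.
Proof.
move=> e0; have r0 : 0 <= r by rewrite (le_trans _ r1).
have e3 : 0 < e / 3 by lra.
have mf := fn_measurable f.
have e3r : 0 < (e / 3) `^ r by rewrite powR_gt0.
have [n hn] : exists n, (\int[lebesgue01 R]_x (`|clip n%:R (fn f x) - fn f x| `^ r)%:E < ((e / 3) `^ r)%:E)%E.
  apply: (@dominated_powR r (fn f) (fun n x => clip n%:R (fn f x)) (fn f)) => //.
  - by move=> n; exact: measurable_clip.
  - by rewrite -L01_normE ltry.
  - by move=> n x; exact: clip_dist.
  - apply: aeW => x d d0; near=> n; rewrite clip_id ?subrr ?normr0 //.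
    by near: n; exact: nbhs_infty_ger.
pose M : R := n%:R.
have M0 : 0 <= M by [].
have mfM := measurable_clip M mf.
have finM F : measurable_fun setT F -> (\int[lebesgue01 R]_x (`|clip M (F x)| `^ r)%:E < +oo)%E.
  by move=> mF; apply: (@finite_mu01 _ M) => //; [exact: measurable_clip|move=> x; exact: clip_norm].
have [f1 f1E] := L01_mk r1 mfM (finM _ mf).
have [||g_ [cg _ /fine_cvgP[gfin /cvgrPdist_lt gcvg]]] := @approximation_continuous_integrable R I01 (fun x => clip M (fn f x)) measurable_I01.
- by rewrite [X in (X < _)%E]I01_measure ltry.
- apply/integrableP; split; first by apply/measurable_EFinP; exact: measurable_funTS.
  apply: (@le_lt_trans _ _ (\int[lebesgue_measure]_(x in I01) M%:E)%E).
    apply: ge0_le_integral => //.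
    + exact: measurable_I01.
    + by apply: measurableT_comp => //; apply/measurable_EFinP; exact: measurable_funTS.
    + by move=> x _; rewrite lee_fin clip_norm.
  by rewrite integral_cst ?[X in (_ * X)%E]I01_measure ?mule1 ?ltry //; exact: measurable_I01.
have K0 : 0 < (2 * M + 1) `^ (r - 1) by rewrite powR_gt0 //; lra.
have d0 : 0 < (e / 3) `^ r / (2 * M + 1) `^ (r - 1) by rewrite divr_gt0.
have [k _ /(_ k (leqnn k)) [gk gk']] := filterI (gcvg _ d0) gfin.
pose g := g_ k; have mg : measurable_fun setT (g : measurableTypeR R -> R).
  exact: (continuous_measurable_fun (cg k)).
have mgM := measurable_clip M mg.
have [f2 f2E] := L01_mk r1 mgM (finM _ mg).
have [c hc] : exists c, (\int[lebesgue01 R]_x (`|sfun c (digs x) - clip M (g x)| `^ r)%:E < ((e / 3) `^ r)%:E)%E.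
  have ap m (w : {ffun 'I_m -> bool}) : exists q : rat,
      `|ratr q - clip M (g (pnum (lift_seq w) m / 2 ^+ m))| < m.+1%:R^-1.
    by apply: rat_approx; rewrite invr_gt0.
  pose c m : scode := existT _ m [ffun w => projT1 (cid (ap m w))].
  have cE m (x : R) : `|sfun (c m) (digs x) - clip M (g (pnum (digs x) m / 2 ^+ m))| < m.+1%:R^-1.
    rewrite /sfun /= ffunE; case: cid => q /=.
    rewrite (@pnum_pre m (lift_seq (pre m (digs x))) (digs x)) // => i im.
    by rewrite (lift_seqE _ (Ordinal im)) ffunE.
  have cM m (x : R) : `|sfun (c m) (digs x)| <= M + 1.
    have := cE m x; have := clip_norm (g (pnum (digs x) m / 2 ^+ m)) M0.
    have : m.+1%:R^-1 <= 1 :> R by rewrite invf_le1 // ler1n.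
    move: (sfun _ _) (clip _ _) (m.+1%:R^-1) => a b d *.
    by have := ler_distD b a 0; rewrite !subr0; lra.
  have [] := @dominated_powR r (fun x => clip M (g x)) (fun m x => sfun (c m) (digs x)) (cst (2 * M + 1)) r1 mgM
     (fun m => measurable_sfun (c m)) (measurable_cst _) _ _ _ _ e3r.
  - by apply: (@finite_mu01 _ `|2 * M + 1|).
  - move=> m x; rewrite [leRHS]ger0_norm; last by rewrite /=; lra.
    have := cM m x; have := clip_norm (g x) M0; have := ler_normB (sfun (c m) (digs x)) (clip M (g x)).
    by rewrite /=; lra.
  - apply: filterS mu01_ae_itv => x x01 d dgt0.
    have d2 : 0 < d / 2 by lra.
    have /cvgrPdist_lt /(_ _ d2) := cg k x; case/nbhs_ballP => /= t t0 tg.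
    near=> m.
    have h1 := cE m x.
    have h2 : `|clip M (g (pnum (digs x) m / 2 ^+ m)) - clip M (g x)| < d / 2.
      apply: le_lt_trans (clip_lip _ _ _) _; rewrite distrC; apply: tg.
      rewrite -ball_normE /= distrC; apply: le_lt_trans (digs_cvg x01 m) _.
      rewrite invf_plt ?posrE ?exprn_gt0 // -natrX.
      apply: (@lt_le_trans _ _ m%:R); last by rewrite ler_nat ltnW // ltn_expl.
      by near: m; exact: nbhs_infty_gtr.
    have h3 : m.+1%:R^-1 < d / 2.
      rewrite invf_plt ?posrE //.
      apply: (@lt_le_trans _ _ m%:R); last by rewrite ler_nat.
      by near: m; exact: nbhs_infty_gtr.
    have := ler_distD (clip M (g (pnum (digs x) m / 2 ^+ m))) (sfun (c m) (digs x)) (clip M (g x)).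
    move=> /le_lt_trans; apply; rewrite [ltRHS]splitr; apply: ltrD => //; exact: lt_trans h1 h3.
  by move=> m hm; exists (c m).
exists c.
have fE1 : `|f - f1| < e / 3.
  rewrite distrC; exact: (L01_dist_lt mfM mf f1E (fn_ae_refl f) e3 hn).
have fE2 : `|f1 - f2| < e / 3.
  apply: (L01_dist_lt mfM mgM f1E f2E e3).
  apply: (@le_lt_trans _ _ (\int[lebesgue01 R]_x (((2 * M + 1) `^ (r - 1))%:E * `|clip M (fn f x) - g x|%:E))%E).
    apply: ge0_le_integral => //.
    - exact: measurable_powR_dist.
    - apply/measurable_EFinP; apply: measurable_funM => //; apply: measurableT_comp => //; exact: measurable_funB.
    - move=> x _; rewrite -EFinM lee_fin; apply: powR_le_mul => //.
        by have := clip_lip M (clip M (fn f x)) (g x); rewrite (@clip_id M (clip M (fn f x))) // clip_norm.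
      by have := ler_normB (clip M (fn f x)) (clip M (g x)); have := clip_norm (g x) M0; have := clip_norm (fn f x) M0; lra.
  have mfg : measurable_fun setT (fun x : measurableTypeR R => `|clip M (fn f x) - g x|%:E).
    by apply/measurable_EFinP; apply: measurableT_comp => //; exact: measurable_funB.
  rewrite ge0_integralZl_EFin //; last exact: ltW.
  rewrite integral_mu01 // -(fineK gk') -EFinM lte_fin mulrC -ltr_pdivlMr //.
  by apply: le_lt_trans gk; rewrite sub0r normrN ler_norm.
have fE3 : `|f2 - step r1 c| < e / 3.
  rewrite distrC; exact: (L01_dist_lt (measurable_sfun c) mgM (stepE r1 c) f2E e3 hc).
have := ler_distD f1 f (step r1 c); have := ler_distD f2 f1 (step r1 c).
move: fE1 fE2 fE3; move: `|f - f1| `|f1 - f2| `|f2 - step r1 c| `|f1 - step r1 c| `|f - step r1 c| => *; lra.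
Unshelve. all: by end_near. Qed.
End density.

(** * Reductions from nets *)

Section sigma_algebra_tools.

Lemma salg_bigcup_countable (T : Type) (G : set (set T)) (I : countType) (A : I -> set T) :
  (forall i, <<s G >> (A i)) -> <<s G >> (\bigcup_i A i).
Proof.
move=> GA; have -> : \bigcup_i A i = \bigcup_n (oapp A set0 (unpickle n)).
  apply/seteqP; split=> x [n _ h]; first by exists (pickle n) => //; rewrite pickleK.
  by move: h; case: unpickle => //= i h; exists i.
apply: sigma_algebra_bigcup => n; case: unpickle => //=; exact: sigma_algebra0.
Qed.

Lemma salgC (T : Type) (G : set (set T)) (A : set T) : <<s G >> A -> <<s G >> (~` A).
Proof. by move=> h; rewrite -setTD; exact: sigma_algebraCD. Qed.

Lemma salgT (T : Type) (G : set (set T)) : <<s G >> setT.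
Proof. by have := salgC (@sigma_algebra0 _ setT G); rewrite setC0. Qed.

Lemma salgI (T : Type) (G : set (set T)) (A B : set T) :
  <<s G >> A -> <<s G >> B -> <<s G >> (A `&` B).
Proof.
move=> GA GB; rewrite -[A]setCK -[B]setCK -setCU; apply: salgC.
have -> : ~` A `|` ~` B = \bigcup_(b : bool) (if b then ~` A else ~` B).
  apply/seteqP; split=> x; first by case=> h; [exists true|exists false].
  by case=> -[] _ /= h; [left|right].
by apply: salg_bigcup_countable => -[]; exact: salgC.
Qed.

Lemma salg_fin_bigcap (T : Type) (G : set (set T)) n (A : nat -> set T) :
  (forall i, <<s G >> (A i)) -> <<s G >> [set x | forall i, (i < n)%N -> A i x].
Proof.
move=> GA; elim: n => [|n IH].
  by rewrite (_ : [set x | _] = setT); [exact: salgT|apply/seteqP; split].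
rewrite (_ : [set x | _] = [set x | forall i, (i < n)%N -> A i x] `&` A n); first exact: salgI.
apply/seteqP; split=> x /=.
  by move=> h; split=> [i ni|]; apply: h => //; exact: ltnW.
by case=> h hn i; rewrite ltnS leq_eqVlt => /orP[/eqP -> //|]; exact: h.
Qed.

Lemma salg_preimage (S T : Type) (G : set (set T)) (H : set (set S)) (f : S -> T) :
  (forall A, G A -> <<s H >> (f @^-1` A)) -> forall A, <<s G >> A -> <<s H >> (f @^-1` A).
Proof.
move=> h A; apply: (@smallest_sub _ _ G [set B | <<s H >> (f @^-1` B)]) => //; split.
- by rewrite /= preimage_set0; exact: sigma_algebra0.
- by move=> B /= hB; rewrite setTD preimage_setC; exact: salgC.
- by move=> B /= hB; rewrite preimage_bigcup; exact: sigma_algebra_bigcup.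
Qed.

End sigma_algebra_tools.

Definition cyl (s : seq nat) : set (nat -> nat) :=
  [set z | forall i, (i < size s)%N -> z i = nth 0%N s i].

Lemma cyl_mkseq (z : nat -> nat) k : cyl (mkseq z k) z.
Proof. by move=> i; rewrite size_mkseq => ik; rewrite nth_mkseq. Qed.

Lemma preimage_open_cyl (Y : topologicalType) (F : (nat -> nat) -> {ptws nat -> Y})
    (U : set {ptws nat -> Y}) :
  (forall n, exists k, forall z z', (forall i, (i < k)%N -> z i = z' i) -> F z n = F z' n) ->
  open U -> F @^-1` U = \bigcup_(s in [set s | cyl s `<=` F @^-1` U]) cyl s.
Proof.
move=> Floc oU; apply/seteqP; split; last by move=> z [s /= sU] /sU.
move=> z /= Uz.
suff [k hk] : exists k, forall z', (forall i, (i < k)%N -> z i = z' i) -> U (F z').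
  exists (mkseq z k); last exact: cyl_mkseq.
  by move=> z' hz'; apply: hk => i ik; rewrite hz' ?size_mkseq // nth_mkseq.
apply: contrapT => /forallNP H.
have {}H k : exists z', (forall i, (i < k)%N -> z i = z' i) /\ ~ U (F z').
  by have /existsNP[z' /not_implyP[h1 h2]] := H k; exists z'.
pose zz k := projT1 (cid (H k)).
have zz1 k : forall i, (i < k)%N -> z i = zz k i by rewrite /zz; case: cid => ? [].
have zz2 k : ~ U (F (zz k)) by rewrite /zz; case: cid => ? [].
have cv : (F \o zz) @ \oo --> (F z : {ptws nat -> Y}).
  apply/cvg_sup => n A /=; rewrite (@nbhsE (initial_topology (fun f : {ptws nat -> Y} => f n))) => -[V [[W oW <-] VFz] VA].
  have [k hk] := Floc n.
  exists k => // j /= kj; apply: VA; rewrite /preimage /= -(hk z (zz j)) // => i ik.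
  by apply: zz1; exact: leq_trans kj.
have /cv [k _ /(_ k (leqnn k))] : nbhs (F z) U by apply: open_nbhs_nbhs.
exact: zz2.
Qed.

Lemma open_coordinate (Y : topologicalType) n (A : set Y) : open A ->
  open [set x : {ptws nat -> Y} | A (x n)].
Proof.
move=> oA; rewrite openE => x /= Ax.
have : nbhs (proj n x) A by apply: open_nbhs_nbhs.
by move=> /(@proj_continuous nat (fun=> Y) n x).
Qed.

Section p_sums.
Context {R : realType}.

Lemma powR_addle (p a b : R) : 0 <= p -> 0 <= a -> 0 <= b ->
  (a + b) `^ p <= 2 `^ p * (a `^ p + b `^ p).
Proof.
move=> p0; wlog ab : a b / b <= a.
  by case: (leP b a) => [|/ltW] h H a0 b0; [exact: H|rewrite addrC [X in _ * X]addrC; exact: H].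
move=> a0 b0; apply: (@le_trans _ _ ((2 * a) `^ p)).
  by apply: ge0_ler_powR; rewrite ?nnegrE //; lra.
by rewrite powRM //; apply: ler_wpM2l; rewrite ?powR_ge0 // lerDl powR_ge0.
Qed.

Lemma esum_pickle (J : countType) (a : J -> \bar R) : (forall j, (0 <= a j)%E) ->
  (\esum_(n in [set: nat]) oapp a 0%E (pickle_inv n) = \esum_(j in [set: J]) a j)%E.
Proof.
move=> a0; transitivity (\esum_(n in range (@pickle J)) oapp a 0%E (pickle_inv n))%E.
  rewrite [RHS]esum_mkcond; apply: eq_esum => n _; case: ifPn => // /negP nr.
  have := @pickle_invK J n; case: pickle_inv => //= j jn; exfalso; apply: nr.
  by rewrite inE; exists j.
rewrite (@esum_image _ _ _ [set: J] (@pickle J)).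
  by apply: eq_esum => j _; rewrite pickleK_inv.
by move=> x y _ _; exact: (pcan_inj (@pickleK_inv J)).
Qed.

Variables (X : normedModType R) (p : R).
Hypothesis p1 : 1 <= p.

Let term_ge0 (x y : nat -> X) n : (0 <= (`|x n - y n| `^ p)%:E)%E.
Proof. by rewrite lee_fin powR_ge0. Qed.

Lemma E_rel_sym (x y : {ptws nat -> X}) : E_rel X p x y -> E_rel X p y x.
Proof. by rewrite /E_rel; under eq_eseriesr => n _ do rewrite distrC. Qed.

Lemma E_rel_trans (y x z : {ptws nat -> X}) : E_rel X p x y -> E_rel X p y z -> E_rel X p x z.
Proof.
rewrite /E_rel => xy yz; have p0 : 0 <= p by rewrite (le_trans _ p1).
apply: (@le_lt_trans _ _ (\sum_(0 <= n <oo) ((2 `^ p)%:E * ((`|x n - y n| `^ p)%:E + (`|y n - z n| `^ p)%:E)))%E).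
  apply: lee_nneseries => n _; first by move=> _; exact: term_ge0.
  rewrite -EFinD -EFinM lee_fin; apply: le_trans (powR_addle p0 _ _) => //.
  by apply: ge0_ler_powR; rewrite ?nnegrE ?addr_ge0 // ler_distD.
rewrite nneseriesZl; last by move=> n _; rewrite adde_ge0.
rewrite nneseriesD //.
have h0 := nneseries_ge0 (P := xpredT) (N := 0) (fun n _ _ => term_ge0 x y n).
have h1 := nneseries_ge0 (P := xpredT) (N := 0) (fun n _ _ => term_ge0 y z n).
rewrite -(fineK (x := (\sum_(0 <= n <oo) (`|x n - y n| `^ p)%:E)%E)) ?ge0_fin_numE //.
rewrite -(fineK (x := (\sum_(0 <= n <oo) (`|y n - z n| `^ p)%:E)%E)) ?ge0_fin_numE //.
by rewrite -EFinD -EFinM ltry.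
Qed.

Lemma E_rel_congr (x x' y y' : {ptws nat -> X}) :
  E_rel X p x x' -> E_rel X p y y' -> E_rel X p x y <-> E_rel X p x' y'.
Proof.
move=> xx' yy'; split=> h.
  by apply: E_rel_trans (E_rel_sym xx') _; exact: E_rel_trans h yy'.
by apply: E_rel_trans xx' _; apply: E_rel_trans h _; exact: E_rel_sym.
Qed.

End p_sums.

Section net_reduction.
Context {R : realType} (X Y : normedModType R) (I : countType) (p q : R).
Variables (d : nat -> X) (T : nat -> I -> Y) (c C : R).
Hypotheses (p1 : 1 <= p) (q1 : 1 <= q) (c0 : 0 < c).
Hypothesis d_dense : forall x e, 0 < e -> exists i, `|x - d i| < e.
Hypothesis Tge : forall i j, ((c * `|d i - d j| `^ p)%:E <=
  \esum_(k in [set: I]) (`|T i k - T j k| `^ q)%:E)%E.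
Hypothesis Tle : forall i j, (\esum_(k in [set: I]) (`|T i k - T j k| `^ q)%:E
  <= (C * `|d i - d j| `^ p)%:E)%E.

Let near_ex n x : exists i, `[< `|x - d i| < (2 ^+ n.+1)^-1 >].
Proof.
have [i hi] := d_dense x (e := (2 ^+ n.+1)^-1) ltac:(by rewrite invr_gt0 exprn_gt0).
by exists i; apply/asboolP.
Qed.

Let idx n x := ex_minn (near_ex n x).

Let idxP n x : `|x - d (idx n x)| < (2 ^+ n.+1)^-1.
Proof. by rewrite /idx; case: ex_minnP => i /asboolP. Qed.

Let code (x : nat -> X) : nat -> nat := fun n => idx n (x n).

Let dec (z : nat -> nat) : {ptws nat -> Y} :=
  fun m => oapp (fun k : nat * I => T (z k.1) k.2) 0 (pickle_inv m).

Let near_borel n (e : R) i : <<s [set U : set {ptws nat -> X} | open U] >>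
  [set x : {ptws nat -> X} | `|x n - d i| < e].
Proof.
apply: sub_sigma_algebra => /=.
have -> : [set x : {ptws nat -> X} | `|x n - d i| < e] = [set x | ball (d i) e (x n)].
  by apply/seteqP; split=> x; rewrite /= -ball_normE /= distrC.
by apply: open_coordinate; exact: ball_open.
Qed.

Let idx_borel n i : <<s [set U : set {ptws nat -> X} | open U] >>
  [set x : {ptws nat -> X} | idx n (x n) = i].
Proof.
have -> : [set x : {ptws nat -> X} | idx n (x n) = i] =
    [set x | `|x n - d i| < (2 ^+ n.+1)^-1] `&`
    [set x | forall j, (j < i)%N -> (~` [set x : {ptws nat -> X} | `|x n - d j| < (2 ^+ n.+1)^-1]) x].
  apply/seteqP; split=> x /=.
    move=> <-; split; first exact: idxP.
    move=> j; rewrite /idx; case: ex_minnP => m _ mP jm /asboolP /mP.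
    by rewrite leqNgt jm.
  case=> h1 h2; rewrite /idx; case: ex_minnP => m /asboolP mP1 mP2.
  apply/eqP; rewrite eqn_leq mP2 ?andTb; last exact/asboolP.
  by rewrite leqNgt; apply/negP => /h2.
apply: salgI; first exact: near_borel.
by apply: salg_fin_bigcap => j; apply: salgC; exact: near_borel.
Qed.

Let theta (x : {ptws nat -> X}) := dec (code x).

Let theta_borel : borel_map theta.
Proof.
rewrite /borel_map; apply: salg_preimage => U /= oU.
have -> : theta @^-1` U = code @^-1` (dec @^-1` U) by [].
rewrite (preimage_open_cyl _ oU); last first.
  move=> m; rewrite /dec; case: pickle_inv => [[n i]|]; last by exists 0%N.
  by exists n.+1 => z z' h /=; rewrite h.
rewrite bigcup_mkcond preimage_bigcup; apply: salg_bigcup_countable => s.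
case: ifP => _; last by rewrite preimage_set0; exact: sigma_algebra0.
have -> : code @^-1` cyl s = [set x | forall i, (i < size s)%N -> [set x : {ptws nat -> X} | idx i (x i) = nth 0%N s i] x] by [].
by apply: salg_fin_bigcap => i; exact: idx_borel.
Qed.

Let E_code x : E_rel X p x (fun n => d (code x n)).
Proof.
apply: (@le_lt_trans _ _ (\sum_(0 <= n <oo) ((2 ^+ n.+1)^-1)%:E)%E).
  apply: lee_nneseries => n _; first by rewrite lee_fin powR_ge0.
  rewrite lee_fin; apply: (@le_trans _ _ (((2 ^+ n.+1)^-1) `^ p)).
    apply: ge0_ler_powR; rewrite ?nnegrE ?invr_ge0 ?exprn_ge0 //; last exact/ltW/idxP.
    exact: le_trans p1.
  by apply: powR_le_id => //; rewrite invr_ge0 exprn_ge0 //= invf_le1 ?exprn_gt0 // exprn_ege1 // ler1n.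
have := @cvg_geometric_eseries_half R 1 0.
move=> /cvg_lim; under eq_eseriesr do rewrite addn1 div1r natrX.
by move=> ->; rewrite ?ltry.
Qed.

Lemma net_borel_reducible : borel_reducible (E_rel X p) (E_rel Y q).
Proof.
exists theta; first exact: theta_borel.
move=> x y; rewrite (E_rel_congr p1 (E_code x) (E_code y)).
have T0 i j (k : I) : (0 <= (`|T i k - T j k| `^ q)%:E)%E by rewrite lee_fin powR_ge0.
have -> : E_rel Y q (theta x) (theta y) =
   (\sum_(0 <= n <oo) \esum_(k in [set: I]) (`|T (code x n) k - T (code y n) k| `^ q)%:E < +oo)%E :> Prop.
  rewrite /E_rel; congr (is_true (_ < _)%E).
  rewrite !nneseries_esumT; last 2 first.
  - by move=> n; apply: esum_ge0.
  - by move=> n; rewrite lee_fin powR_ge0.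
  rewrite esum_esum; last by move=> *; rewrite lee_fin powR_ge0.
  rewrite (_ : setT `*`` _ = setT); last by apply/seteqP; split.
  rewrite -[RHS]esum_pickle; last by move=> j; rewrite lee_fin powR_ge0.
  apply: eq_esum => m _; rewrite /theta /dec; case: pickle_inv => //=.
  by rewrite subr0 normr0 powR0 // gt_eqF // (lt_le_trans _ q1).
have P0 : forall n, (0 <= (`|d (code x n) - d (code y n)| `^ p)%:E)%E by move=> n; rewrite lee_fin powR_ge0.
rewrite /E_rel; split => h.
- apply: (@le_lt_trans _ _ (\sum_(0 <= n <oo) (C%:E * (`|d (code x n) - d (code y n)| `^ p)%:E))%E).
    by apply: lee_nneseries => n _; [move=> _; apply: esum_ge0|rewrite -EFinM Tle].
  rewrite nneseriesZl // -(fineK (x := (\sum_(0 <= n <oo) (`|d (code x n) - d (code y n)| `^ p)%:E)%E)).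
    by rewrite -EFinM ltry.
  by rewrite ge0_fin_numE // nneseries_ge0.
- apply: (@le_lt_trans _ _ (\sum_(0 <= n <oo) ((c^-1)%:E * \esum_(k in [set: I]) (`|T (code x n) k - T (code y n) k| `^ q)%:E))%E).
    apply: lee_nneseries => n _ //.
    by rewrite muleC lee_pdivlMr // -EFinM mulrC Tge.
  rewrite nneseriesZl; last by move=> n _; apply: esum_ge0.
  rewrite -(fineK (x := (\sum_(0 <= n <oo) _)%E)); first by rewrite -EFinM ltry.
  by rewrite ge0_fin_numE // nneseries_ge0 // => n _ _; apply: esum_ge0.
Qed.

End net_reduction.

(** * Category and the block structure of Borel reductions *)

Section category.

#[local] Hint Resolve prefix_refl : core.

Lemma cyl_prefix (s t : seq nat) : prefix s t -> cyl t `<=` cyl s.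
Proof.
move=> /prefixP[u ->] z h i si; rewrite h ?size_cat ?ltn_addr //.
by rewrite nth_cat si.
Qed.

Lemma cyl_prefix_mkseq s z k : cyl s z -> (size s <= k)%N -> prefix s (mkseq z k).
Proof.
move=> sz sk; rewrite prefixE; apply/eqP; apply: (@eq_from_nth _ 0%N).
  by rewrite size_takel // size_mkseq.
move=> i; rewrite size_takel ?size_mkseq // => si.
by rewrite nth_take // nth_mkseq ?(leq_trans si) // sz.
Qed.

Definition forces (s : seq nat) (A : set (nat -> nat)) :=
  exists D : nat -> set (seq nat),
    (forall i t, prefix s t -> exists2 t', prefix t t' & D i t') /\
    (forall z, cyl s z -> (forall i, exists2 t, D i t & cyl t z) -> A z).

Lemma forces_prefix s t A : prefix s t -> forces s A -> forces t A.
Proof.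
move=> st [D [D1 D2]]; exists D; split=> [i u tu|z zt]; first exact: D1 (prefix_trans st tu).
by apply: D2; exact: cyl_prefix zt.
Qed.

Lemma forces_sub s (A B : set (nat -> nat)) : (forall z, cyl s z -> A z -> B z) -> forces s A -> forces s B.
Proof. by move=> AB [D [D1 D2]]; exists D; split=> // z zs zD; apply: AB => //; exact: D2. Qed.

Lemma forces_cyl s (A : set (nat -> nat)) : cyl s `<=` A -> forces s A.
Proof. by move=> sA; exists (fun=> setT); split=> [i t _|z /sA //]; exists t. Qed.

Lemma forces_bigcap s (A : nat -> set (nat -> nat)) : (forall n, forces s (A n)) -> forces s (\bigcap_n A n).
Proof.
move=> /choice[D DP].
exists (fun k => oapp (fun m : nat * nat => D m.1 m.2) setT (unpickle k)); split.
  move=> i t st; case: unpickle => [[n j]|] /=; last by exists t.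
  exact: (DP n).1.
move=> z zs zD n _; apply: (DP n).2 => // i.
by have := zD (pickle (n, i)); rewrite pickleK.
Qed.

Lemma chain_limit (t : nat -> seq nat) :
  (forall i, prefix (t i) (t i.+1)) -> (forall i, (i <= size (t i))%N) ->
  exists z, forall i, cyl (t i) z.
Proof.
move=> tp ts.
have tp' i k : prefix (t i) (t (i + k)%N).
  by elim: k => [|k IH]; rewrite ?addn0 ?prefix_refl // addnS; exact: prefix_trans IH (tp _).
exists (fun n => nth 0%N (t n.+1) n) => i n ni.
case: (leqP i n.+1) => [h|/ltnW h].
  by have /prefixP[u] := tp' i (n.+1 - i)%N; rewrite subnKC // => ->; rewrite nth_cat ni.
by have /prefixP[u] := tp' n.+1 (i - n.+1)%N; rewrite subnKC // => ->; rewrite nth_cat (ts n.+1).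
Qed.

Lemma forces_nonempty s A : forces s A -> exists2 z, cyl s z & A z.
Proof.
move=> [D [D1 D2]].
pose R (x y : {t : nat * seq nat | prefix s t.2}) := (sval y).1 = (sval x).1.+1 /\
  exists2 u, prefix (sval x).2 u /\ D (sval x).1 u & (sval y).2 = rcons u 0%N.
have [|f [f0 fS]] := @dependent_choice _ R _ (exist _ (0%N, s) (prefix_refl s)).
  move=> [[i t] /= st]; apply: cid.
  have [u tu Du] := D1 i t st.
  have su : prefix s (rcons u 0%N) by rewrite (prefix_trans st) // (prefix_trans tu) // prefix_rcons.
  by exists (exist _ (i.+1, rcons u 0%N) su); split => //; exists u.
have fi i : (sval (f i)).1 = i by elim: i => [|i IH]; rewrite ?f0 // (fS i).1 IH.
have [||z zP] := @chain_limit (fun i => (sval (f i)).2).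
- move=> i; have [_ [u [h _] ->]] := fS i; exact: prefix_trans h (prefix_rcons _ _).
- elim=> // i IH; have [_ [u [h _] ->]] := fS i; rewrite size_rcons ltnS (leq_trans IH) //.
  exact: size_prefix h.
have zs : cyl s z by have := zP 0%N; rewrite f0.
exists z => //; apply: D2 => // i; have [_ [u [_ Du] e]] := fS i.
exists u; first by rewrite -{1}(fi i).
apply: cyl_prefix (zP i.+1); rewrite e; exact: prefix_rcons.
Qed.

Lemma generic_family (A : nat -> set (nat -> nat)) :
  exists D : nat -> set (seq nat),
    (forall i t, exists2 t', prefix t t' & D i t') /\
    (forall n s, forces s (A n) -> forall z, cyl s z ->
      (forall i, exists2 t, D i t & cyl t z) -> A n z).
Proof.
pose P (k : nat * seq nat) (D : nat -> set (seq nat)) := forces k.2 (A k.1) ->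
    (forall i t, prefix k.2 t -> exists2 t', prefix t t' & D i t') /\
    (forall z, cyl k.2 z -> (forall i, exists2 t, D i t & cyl t z) -> A k.1 z).
have /choice[D DP] k : exists D, P k D.
  case: k => n s; have [h|h] := pselect (forces s (A n)); last by exists (fun=> setT).
  by have [D DP] := h; exists D.
pose E (k : nat * seq nat * nat) : set (seq nat) := [set t |
  ~ forces k.1.2 (A k.1.1) \/ (D k.1 k.2 t) \/ ~ (exists2 z, cyl t z & cyl k.1.2 z)].
exists (fun i => oapp E setT (unpickle i)); split.
  move=> i t; case: unpickle => [[[n s] j]|] /=; last by exists t.
  have [h|h] := pselect (forces s (A n)); last by exists t => //; left.
  have [[z zt zs]|nz] := pselect (exists2 z, cyl t z & cyl s z); last by exists t => //; right; right.
  have [|t' tt' Dt] := (DP (n, s) h).1 j (mkseq z (maxn (size s) (size t))).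
    by apply: cyl_prefix_mkseq => //; rewrite leq_maxl.
  exists t'; last by right; left.
  by apply: prefix_trans tt'; apply: cyl_prefix_mkseq => //; rewrite leq_maxr.
move=> n s h z zs zE; apply: (DP (n, s) h).2 => // i.
have := zE (pickle (n, s, i)); rewrite pickleK /= => -[t [//|[Dt|nz]] zt]; first by exists t.
by exfalso; apply: nz; exists z.
Qed.

Lemma forces_local s A : (forall t, prefix s t -> exists2 t', prefix t t' & forces t' A) -> forces s A.
Proof.
move=> h; have [D [D1 D2]] := generic_family (fun=> A).
exists (fun i => if i is j.+1 then D j else [set t | forces t A]); split.
  by move=> [|i] t st; [exact: h|exact: D1].
move=> z zs zD; have [t ft zt] := zD 0%N.
by apply: (D2 0%N t ft z zt) => i; exact: zD i.+1.
Qed.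

Definition baire_borel : set (set (nat -> nat)) := <<s range cyl >>.

Lemma decided A : baire_borel A ->
  forall s, exists2 t, prefix s t & forces t A \/ forces t (~` A).
Proof.
apply: (@smallest_sub _ _ _ [set A | forall s, exists2 t, prefix s t & forces t A \/ forces t (~` A)]).
- split.
  + by move=> s; exists s => //; right; apply: forces_cyl; rewrite setC0.
  + move=> B hB s; have [t st h] := hB s; exists t => //; rewrite setTD setCK.
    by case: h; [right|left].
  + move=> B hB s.
    have [[n [t [st ft]]]|no] := pselect (exists n t, prefix s t /\ forces t (B n)).
      by exists t => //; left; apply: forces_sub ft => z _ h; exists n.
    exists s => //; right; rewrite setC_bigcup; apply: forces_bigcap => n.
    apply: forces_local => t st; have [t' tt' [h|h]] := hB n t; last by exists t'.
    by exfalso; apply: no; exists n, t'; split => //; exact: prefix_trans st tt'.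
- move=> _ [u _ <-] s.
  have [[z zs zu]|nz] := pselect (exists2 z, cyl s z & cyl u z).
    exists (mkseq z (maxn (size s) (size u))).
      by apply: cyl_prefix_mkseq => //; rewrite leq_maxl.
    left; apply: forces_cyl; apply: cyl_prefix; apply: cyl_prefix_mkseq => //; exact: leq_maxr.
  by exists s => //; right; apply: forces_cyl => z zs zu; apply: nz; exists z.
Qed.

Lemma forces_cover s (A : nat -> set (nat -> nat)) : (forall i, baire_borel (A i)) ->
  cyl s `<=` \bigcup_i A i -> exists i, exists2 t, prefix s t & forces t (A i).
Proof.
move=> mA sA; apply: contrapT => no.
have : forces s (\bigcap_i ~` A i).
  apply: forces_bigcap => n; apply: forces_local => t st.
  have [t' tt' [h|h]] := decided (mA n) t; last by exists t'.
  by exfalso; apply: no; exists n, t' => //; exact: prefix_trans st tt'.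
by move=> /forces_nonempty[z zs h]; have [i _ Ai] := sA z zs; exact: (h i I).
Qed.

Definition open_dense (P : set (seq nat)) :=
  (forall s t, prefix s t -> P s -> P t) /\ (forall s, exists2 t, prefix s t & P t).

Lemma open_dense_all (I : eqType) (r : seq I) (P : I -> set (seq nat)) :
  (forall i, i \in r -> open_dense (P i)) -> open_dense [set s | forall i, i \in r -> P i s].
Proof.
elim: r => [|a r IH] h; first by split => [//|s]; exists s.
have [r1 r2] := IH (fun i ir => h i (mem_behead (s := a :: r) ir)).
have [a1 a2] := h a (mem_head a r); split.
  by move=> s t st hs i ir; apply: (h i ir).1 st _; exact: hs.
move=> s; have [t st Pt] := a2 s; have [u tu Pu] := r2 t.
exists u; first exact: prefix_trans tu.
by move=> i; rewrite inE => /orP[/eqP ->|]; [exact: a1 tu Pt|exact: Pu].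
Qed.

Definition ov (ns vs : seq nat) (x : nat -> nat) : nat -> nat :=
  fun n => if n \in ns then nth 0%N vs (index n ns) else x n.

Definition ovs (ns vs t : seq nat) : seq nat := mkseq (ov ns vs (nth 0%N t)) (size t).

Lemma ov_ext ns vs x y n : x n = y n -> ov ns vs x n = ov ns vs y n.
Proof. by rewrite /ov => ->. Qed.

Lemma cyl_ov ns vs t z : cyl t z -> cyl (ovs ns vs t) (ov ns vs z).
Proof.
move=> zt i; rewrite size_mkseq => it; rewrite nth_mkseq //; apply: ov_ext.
exact: zt.
Qed.

Lemma ovs_prefix ns vs s t : prefix s t -> prefix (ovs ns vs s) (ovs ns vs t).
Proof.
move=> /prefixP[u ->]; rewrite prefixE; apply/eqP; apply: (@eq_from_nth _ 0%N).
  by rewrite size_takel // !size_mkseq size_cat leq_addr.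
move=> i; rewrite size_takel ?size_mkseq ?size_cat ?leq_addr // => si.
rewrite nth_take // !nth_mkseq ?size_cat ?ltn_addr //; apply: ov_ext.
by rewrite nth_cat si.
Qed.

Lemma open_dense_ovs (ns t : seq nat) (P : set (seq nat)) (r : seq (seq nat)) :
  (forall n, n \in ns -> (n < size t)%N) -> open_dense P ->
  exists2 t', prefix t t' & forall vs, vs \in r -> P (ovs ns vs t').
Proof.
move=> nst [P1 P2]; elim: r => [|vs r [t1 tt1 IH]]; first by exists t.
have [u su Pu] := P2 (ovs ns vs t1).
have st1 : (size t1 <= size u)%N by have := size_prefix su; rewrite size_mkseq.
pose t2 := t1 ++ drop (size t1) u.
have t12 : prefix t1 t2 by rewrite prefix_prefix.
have st2 : size t2 = size u by rewrite size_cat size_drop subnKC.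
have e : ovs ns vs t2 = u.
  apply: (@eq_from_nth _ 0%N); rewrite size_mkseq ?st2 // => i iu.
  rewrite nth_mkseq ?st2 //.
  have [it|ti] := ltnP i (size t1).
    have -> : nth 0%N u i = nth 0%N (ovs ns vs t1) i.
      by move/prefixP: su => [v ->]; rewrite nth_cat size_mkseq it.
    by rewrite nth_mkseq //; apply: ov_ext; rewrite nth_cat it.
  rewrite /ov ifN; first by rewrite nth_cat ltnNge ti /= nth_drop subnKC.
  apply: contraL ti => /nst h; rewrite -ltnNge (leq_trans h) //; exact: size_prefix tt1.
exists t2; first exact: prefix_trans t12.
move=> w; rewrite inE => /orP[/eqP ->|wr]; first by rewrite e.
by apply: P1 (IH w wr); exact: ovs_prefix.
Qed.

End category.

#[local] Hint Resolve prefix_refl : core.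

Section blocks.
Context {R : realType} (Y : normedModType R) (d : nat -> Y) (q : R).
Hypothesis d_dense : forall (y : Y) (e : R), 0 < e -> exists i, `|y - d i| < e.
Hypothesis q1 : 1 <= q.

Definition ball_measurable (g : (nat -> nat) -> Y) :=
  forall (y : Y) (e : R), baire_borel [set z | `|g z - y| < e].

Let baireT := g_sigma_algebraType (range cyl).

Let measurable_dist (g h : (nat -> nat) -> Y) : ball_measurable g -> ball_measurable h ->
  measurable_fun setT (fun z : baireT => `|g z - h z| : R).
Proof.
move=> mg mh; apply: (measurability _ (RGenInftyO.measurableE R)) => // _ [_ [t ->] <-]; rewrite setTI.
have -> : (fun z : baireT => `|g z - h z| : R) @^-1` `]-oo, t[%classic =
    \bigcup_(k : nat * rat) ([set z | `|g z - d k.1| < ratr k.2] `&` [set z | `|h z - d k.1| < t - ratr k.2]).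
  apply/seteqP; split=> z /=; rewrite in_itv /=.
    move=> lt; have d0 : 0 < (t - `|g z - h z|) / 3 by lra.
    have [i hi] := d_dense (g z) d0.
    have [u] := @rat_in_itvoo _ _ _ hi; rewrite in_itv /= => /andP[u1 u2].
    exists (i, u) => //=; split => //.
    have := ler_distD (g z) (h z) (d i); rewrite (distrC (h z) (g z)).
    move: u1 u2 lt hi; move: `|g z - d i| `|g z - h z| `|h z - d i| => a b c; lra.
  move=> [[i u] _ /= [h1 h2]]; have := ler_distD (d i) (g z) (h z); rewrite (distrC (d i) (h z)).
  move: h1 h2; move: `|g z - d i| `|g z - h z| `|h z - d i| => a b c; lra.
by apply: salg_bigcup_countable => k; apply: salgI; [exact: mg|exact: mh].
Qed.

Lemma baire_borel_coord n v : baire_borel [set z : nat -> nat | z n = v].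
Proof.
have -> : [set z : nat -> nat | z n = v] = \bigcup_(s : seq nat) (if (n < size s)%N && (nth 0%N s n == v) then cyl s else set0).
  apply/seteqP; split=> z /=.
    move=> zn; exists (mkseq z n.+1) => //; rewrite size_mkseq ltnSn nth_mkseq // zn eqxx /=.
    exact: cyl_mkseq.
  by move=> [s _]; case: ifP => // /andP[ns /eqP <-] /(_ n ns).
apply: salg_bigcup_countable => s; case: ifP => _; last exact: sigma_algebra0.
by apply: sub_sigma_algebra; exists s.
Qed.

Lemma baire_borel_ov ns vs A : baire_borel A -> baire_borel (ov ns vs @^-1` A).
Proof.
apply: salg_preimage => _ [s _ <-].
have -> : ov ns vs @^-1` cyl s = [set z | forall i, (i < size s)%N -> [set z : nat -> nat | ov ns vs z i = nth 0%N s i] z] by [].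
apply: salg_fin_bigcap => i.
have -> : [set z : nat -> nat | ov ns vs z i = nth 0%N s i] = if i \in ns then
    (if nth 0%N vs (index i ns) == nth 0%N s i then setT else set0) else [set z | z i = nth 0%N s i].
  rewrite /ov; case: ifP => // _; apply/seteqP; split=> z /=; first by move=> ->; rewrite eqxx.
  by case: ifP => [/eqP ->|].
case: ifP => _; last exact: baire_borel_coord.
by case: ifP => _; [exact: salgT|exact: sigma_algebra0].
Qed.

Variable theta : (nat -> nat) -> nat -> Y.
Hypothesis theta_meas : forall n, ball_measurable (fun z => theta z n).
Hypothesis theta_fin : forall z z', (exists k, forall n, (k <= n)%N -> z n = z' n) ->
  (\sum_(0 <= n <oo) (`|theta z n - theta z' n| `^ q)%:E < +oo)%E.

Let tail_set (l k : nat) (ns vs : seq nat) : set (nat -> nat) :=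
  [set z | forall m, \sum_(l <= n < m) `|theta z n - theta (ov ns vs z) n| `^ q <= (2 ^+ k)^-1].

Let head_set (n i l k : nat) : set (nat -> nat) :=
  [set z | `|theta z n - d i| < (2 ^+ (k + l).+1)^-1].

Let tail_set_borel l k ns vs : baire_borel (tail_set l k ns vs).
Proof.
have -> : tail_set l k ns vs = \bigcap_m [set z : baireT | \sum_(l <= n < m) `|theta z n - theta (ov ns vs z) n| `^ q <= (2 ^+ k)^-1].
  by apply/seteqP; split=> z h m; [move=> _|]; exact: h.
have : measurable (\bigcap_m [set z : baireT | \sum_(l <= n < m) `|theta z n - theta (ov ns vs z) n| `^ q <= (2 ^+ k)^-1]).
  apply: bigcapT_measurable => m; rewrite -[X in measurable X]setTI; apply: measurable_fun_le => //.
  apply: measurable_sum => n.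
  apply: (@measurableT_comp _ _ _ _ _ _ (fun x : R => x `^ q)) => //.
  apply: measurable_dist => // y e.
  exact: (baire_borel_ov ns vs (theta_meas n y e)).
by [].
Qed.

Let head_set_borel n i l k : baire_borel (head_set n i l k).
Proof. exact: theta_meas. Qed.

Let tail_cover k ns vs z : exists l, tail_set l k ns vs z.
Proof.
pose u n := (`|theta z n - theta (ov ns vs z) n| `^ q)%:E.
have fin : (\sum_(0 <= n <oo) u n < +oo)%E.
  have [B BP] : exists B, forall n, n \in ns -> (n < B)%N.
    elim: (ns) => [|a r [B BP]]; first by exists 0%N.
    by exists (maxn a.+1 B) => n; rewrite inE leq_max => /orP[/eqP ->|/BP ->]; rewrite ?leqnn ?orbT.
  apply: theta_fin; exists B => n hn; rewrite /ov ifN //.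
  by apply/negP => /BP; rewrite ltnNge hn.
have u0 n : (0 <= u n)%E by rewrite lee_fin powR_ge0.
have e0 : 0 < (2 ^+ k)^-1 :> R by rewrite invr_gt0 exprn_gt0.
have := nneseries_tail_cvg fin (fun n _ => u0 n).
move=> /fine_cvgP[_ /cvgrPdist_lt /(_ _ e0)] [l _ /(_ l (leqnn l))] /=.
have tfin : (\sum_(l <= n <oo) u n)%E \is a fin_num.
  rewrite ge0_fin_numE; last exact: nneseries_ge0.
  apply: le_lt_trans fin; rewrite (nneseries_split 0 l) //; rewrite add0n leeDr //; exact: sume_ge0.
rewrite sub0r normrN ger0_norm ?fine_ge0 ?nneseries_ge0 // => h.
exists l => m.
rewrite -lee_fin -sumEFin; apply: le_trans (_ : _ <= (fine (\sum_(l <= n <oo) u n)%E)%:E)%E _; last by rewrite lee_fin ltW.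
rewrite fineK //; apply: nneseries_lim_ge => n _ _; exact: u0.
Qed.

Let tail_mono l l' k ns vs : (l <= l')%N -> tail_set l k ns vs `<=` tail_set l' k ns vs.
Proof.
move=> ll z h m; apply: le_trans (h m).
have [ml|lm] := leqP m l'; first by rewrite big_geq // sumr_ge0 // => n _; exact: powR_ge0.
by rewrite [leRHS](big_cat_nat (n := l')) //= ?(ltnW lm) // lerDr sumr_ge0 // => n _; exact: powR_ge0.
Qed.

Let open_dense_tail k ns (r : seq (seq nat)) :
  open_dense [set s | exists l, forall vs, vs \in r -> forces s (tail_set l k ns vs)].
Proof.
split=> [s t st [l h]|].
  by exists l => vs vr; apply: forces_prefix (h vs vr).
elim: r => [|vs r IH] s; first by exists s => //; exists 0%N.
have [t st [l h]] := IH s.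
have [l' [u tu h']] := forces_cover (fun l' => tail_set_borel l' k ns vs) (fun z (_ : cyl t z) => let: ex_intro l' h := tail_cover k ns vs z in ex_intro2 _ _ l' I h).
exists u; first exact: prefix_trans tu.
exists (maxn l l') => w; rewrite inE => /orP[/eqP ->|wr].
  by apply: forces_sub h' => z _; apply: tail_mono; exact: leq_maxr.
apply: forces_prefix tu _; apply: forces_sub (h w wr) => z _; apply: tail_mono; exact: leq_maxl.
Qed.

Let open_dense_head l k :
  open_dense [set s | forall n, (n < l)%N -> exists i, forces s (head_set n i l k)].
Proof.
have : open_dense [set s | forall n, n \in iota 0 l -> (fun n => [set s | exists i, forces s (head_set n i l k)]) n s].
  apply: open_dense_all => n _; split=> [s t st [i h]|s].
    by exists i; exact: forces_prefix h.
  have cov : cyl s `<=` \bigcup_i head_set n i l k.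
    move=> z _; have [|i hi] := d_dense (theta z n) (e := (2 ^+ (k + l).+1)^-1); first by rewrite invr_gt0 exprn_gt0.
    by exists i.
  have [i [t st h]] := forces_cover (fun i => head_set_borel n i l k) cov.
  by exists t => //; exists i.
have -> // : [set s | forall n, n \in iota 0 l -> (fun n => [set s | exists i, forces s (head_set n i l k)]) n s] = [set s | forall n, (n < l)%N -> exists i, forces s (head_set n i l k)].
by apply/seteqP; split=> s h n; have := h n; rewrite mem_iota add0n.
Qed.

Variable (F : nat -> seq nat) (o : nat -> nat).

Fixpoint choices (j : nat) : seq (seq nat) :=
  if j is i.+1 then [seq rcons vs v | vs <- choices i, v <- F i] else [:: [::]].

Lemma choices_mkseq w j : (forall i, w i \in F i) -> mkseq w j \in choices j.
Proof.
move=> wF; elim: j => [|j IH] //=; rewrite mkseqS.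
by apply/allpairsP; exists (mkseq w j, w j); split => //=; exact: wF.
Qed.

Let step_rel (D : nat -> set (seq nat)) (st st' : seq nat * seq nat * nat) :=
  [/\ st'.1.2 = rcons st.1.2 (size st.1.1), prefix (rcons st.1.1 (o (size st.1.2))) st'.1.1,
   (st.2 < st'.2)%N &
   forall vs, vs \in choices (size st'.1.2) ->
   [/\ forall i, (i <= size st.1.2)%N -> exists2 u, D i u & prefix u (ovs st'.1.2 vs st'.1.1),
       forall vs', vs' \in choices (size st'.1.2) ->
         forces (ovs st'.1.2 vs st'.1.1) (tail_set st'.2 (size st.1.2) st'.1.2 vs') &
       forall n, (n < st'.2)%N ->
         exists i, forces (ovs st'.1.2 vs st'.1.1) (head_set n i st'.2 (size st.1.2))]].

Let step_ex D : (forall i t, exists2 t', prefix t t' & D i t') ->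
  forall st, (forall n, n \in st.1.2 -> (n < size st.1.1)%N) ->
  exists2 st', (forall n, n \in st'.1.2 -> (n < size st'.1.1)%N) & step_rel D st st'.
Proof.
move=> Dd [[t ns] l] /= nst.
pose ns' := rcons ns (size t); pose t0 := rcons t (o (size ns)).
pose r := choices (size ns').
have n0 n : n \in ns' -> (n < size t0)%N.
  rewrite mem_rcons inE size_rcons => /orP[/eqP -> //|/nst h]; exact: ltnW.
have odD : open_dense [set s | forall i, i \in iota 0 (size ns).+1 -> (fun i => [set s | exists2 u, D i u & prefix u s]) i s].
  apply: open_dense_all => i _; split=> [s s' ss' [u Du us]|s].
    by exists u => //; exact: prefix_trans us ss'.
  by have [s' ss' Ds'] := Dd i s; exists s' => //; exists s'.
have [t1 t01 h1] := open_dense_ovs r n0 odD.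
have n1 n : n \in ns' -> (n < size t1)%N by move=> /n0 h; rewrite (leq_trans h) // size_prefix.
have [t2 t12 h2] := open_dense_ovs r n1 (open_dense_tail (size ns) ns' r).
have n2 n : n \in ns' -> (n < size t2)%N by move=> /n1 h; rewrite (leq_trans h) // size_prefix.
have [L LP] : exists L, forall vs, vs \in r -> forall vs', vs' \in r -> forces (ovs ns' vs t2) (tail_set L (size ns) ns' vs').
  elim: {1 3}r h2 => [|a r0 IH] h2; first by exists 0%N.
  have [|L LP] := IH; first by move=> vs vr; apply: h2; rewrite inE vr orbT.
  have [L' LP'] := h2 a (mem_head _ _).
  exists (maxn L L') => vs; rewrite inE => /orP[/eqP ->|vr] vs' vr'.
    apply: forces_sub (LP' vs' vr') => z _; apply: tail_mono; exact: leq_maxr.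
  apply: forces_sub (LP vs vr vs' vr') => z _; apply: tail_mono; exact: leq_maxl.
pose l' := maxn l.+1 L.
have [t3 t23 h3] := open_dense_ovs r n2 (open_dense_head l' (size ns)).
exists (t3, ns', l') => /=.
  by move=> n /n2 h; rewrite (leq_trans h) // size_prefix.
split => //; first by apply: prefix_trans t23; exact: prefix_trans t12.
  exact: leq_maxl.
move=> vs vr; split.
- move=> i; rewrite -ltnS => ij.
  have [|u Du us] := h1 vs vr i; first by rewrite mem_iota add0n.
  exists u => //; apply: prefix_trans us _; apply: ovs_prefix; exact: prefix_trans t23.
- move=> vs' vr'; apply: forces_prefix (ovs_prefix ns' vs t23) _.
  apply: forces_sub (LP vs vr vs' vr') => z _; apply: tail_mono; exact: leq_maxr.
- by move=> n; exact: h3.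
Qed.

Lemma ov_in (N w : nat -> nat) g k i : (forall i j, (i < j)%N -> (N i < N j)%N) -> (i < k)%N ->
  ov (mkseq N k) (mkseq w k) g (N i) = w i.
Proof.
move=> Nmono ik.
have Ninj : injective N.
  move=> a b ab; case: (ltngtP a b) => // /Nmono; by rewrite ab ltnn.
have Nk : N i = nth 0%N (mkseq N k) i by rewrite nth_mkseq.
have Nin : N i \in mkseq N k by rewrite Nk mem_nth ?size_mkseq.
by rewrite /ov Nin Nk index_uniq ?size_mkseq ?mkseq_uniq // nth_mkseq.
Qed.

Lemma ov_out (N w : nat -> nat) g k n : (forall i, (i < k)%N -> N i != n) ->
  ov (mkseq N k) (mkseq w k) g n = g n.
Proof.
move=> h; rewrite /ov ifN //; apply/negP => /mapP[i +]; rewrite mem_iota add0n => /andP[_ ik] e.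
by move: (h i ik); rewrite e eqxx.
Qed.

Lemma block_structure : exists (N l : nat -> nat) (x : (nat -> nat) -> nat -> nat),
  [/\ [/\ l 0%N = 0%N, forall j, (l j < l j.+1)%N & forall i j, (i < j)%N -> (N i < N j)%N],
      (forall w j, x w (N j) = w j),
      (forall w w' n, (forall j, N j != n) -> x w n = x w' n),
      (forall w w' k, (forall j, w j \in F j) -> (forall j, w' j \in F j) ->
        (forall j, (k < j)%N -> w j = w' j) -> forall m,
        \sum_(l k.+1 <= n < m) `|theta (x w) n - theta (x w') n| `^ q <= (2 ^+ k)^-1) &
      (forall w w' k, (forall j, w j \in F j) -> (forall j, w' j \in F j) ->
        (forall j, (j <= k)%N -> w j = w' j) ->
        \sum_(0 <= n < l k.+1) `|theta (x w) n - theta (x w') n| `^ q <= (2 ^+ k)^-1)].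
Proof.
pose A (k : nat) : set (nat -> nat) := if unpickle k is Some e then
  match (e : (nat * nat * seq nat * seq nat) + (nat * nat * nat * nat)) with
  | inl (l, k, ns, vs) => tail_set l k ns vs
  | inr (n, i, l, k) => head_set n i l k end else setT.
have [D [Dd DA]] := generic_family A.
have Dtail l k ns vs s z : forces s (tail_set l k ns vs) -> cyl s z ->
    (forall i, exists2 t, D i t & cyl t z) -> tail_set l k ns vs z.
  move=> fs; have := DA (pickle (inl (l, k, ns, vs) : (nat * nat * seq nat * seq nat) + (nat * nat * nat * nat))).
  rewrite /A pickleK => h; exact: h fs z.
have Dhead n i l k s z : forces s (head_set n i l k) -> cyl s z ->
    (forall i, exists2 t, D i t & cyl t z) -> head_set n i l k z.
  move=> fs; have := DA (pickle (inr (n, i, l, k) : (nat * nat * seq nat * seq nat) + (nat * nat * nat * nat))).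
  rewrite /A pickleK => h; exact: h fs z.
pose St := {st : seq nat * seq nat * nat | forall n, n \in st.1.2 -> (n < size st.1.1)%N}.
have st0 : forall n, n \in (([::] : seq nat, [::] : seq nat, 0%N).1.2) -> (n < size (([::] : seq nat, [::] : seq nat, 0%N).1.1))%N by [].
have [|f [f0 fS]] := @dependent_choice St (fun a b => step_rel D (sval a) (sval b)) _ (exist _ _ st0).
  by move=> [st hst] /=; apply: cid; have [st' h1 h2] := step_ex Dd hst; exists (exist _ st' h1).
pose t j := (sval (f j)).1.1; pose N j := size (t j); pose l j := (sval (f j)).2.
pose ns j := (sval (f j)).1.2.
have H j : [/\ ns j.+1 = rcons (ns j) (N j), prefix (rcons (t j) (o (size (ns j)))) (t j.+1), (l j < l j.+1)%N &
   forall vs, vs \in choices (size (ns j.+1)) ->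
   [/\ forall i, (i <= size (ns j))%N -> exists2 u, D i u & prefix u (ovs (ns j.+1) vs (t j.+1)),
       forall vs', vs' \in choices (size (ns j.+1)) -> forces (ovs (ns j.+1) vs (t j.+1)) (tail_set (l j.+1) (size (ns j)) (ns j.+1) vs') &
       forall n, (n < l j.+1)%N -> exists i, forces (ovs (ns j.+1) vs (t j.+1)) (head_set n i (l j.+1) (size (ns j)))]].
  exact: fS j.
have nsE j : ns j = mkseq N j.
  elim: j => [|j IH]; first by rewrite /ns f0.
  by have [-> _ _ _] := H j; rewrite IH mkseqS.
have sns j : size (ns j) = j by rewrite nsE size_mkseq.
have Nlt j : (N j < N j.+1)%N.
  by have [_ /size_prefix + _ _] := H j; rewrite size_rcons.
have Nmono i j : (i < j)%N -> (N i < N j)%N.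
  elim: j => // j IH; rewrite ltnS leq_eqVlt => /orP[/eqP -> //|/IH h]; exact: ltn_trans (Nlt j).
have jN j : (j <= N j)%N by elim: j => // j IH; exact: leq_ltn_trans (Nlt j).
have [||g gP] := @chain_limit t; [|by move=> i; exact: jN|].
  by move=> j; have [_ h _ _] := H j; exact: prefix_trans (prefix_rcons _ _) h.
pose x (w : nat -> nat) n := ov (mkseq N n.+1) (mkseq w n.+1) g n.
have xN w j : x w (N j) = w j by apply: ov_in => //; rewrite ltnS.
have xnN w n : (forall j, N j != n) -> x w n = g n by move=> h; apply: ov_out => i _.
have NP n : (exists j, N j = n) \/ (forall j, N j != n).
  have [h|h] := pselect (exists j, N j = n); [by left|right=> j; apply/eqP => e; apply: h; by exists j].
have xE w k n : (n < N k)%N -> x w n = ov (mkseq N k) (mkseq w k) g n.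
  have [[j <-] jk|h _] := NP n.
    by rewrite xN ov_in //; rewrite ltnNge; apply: contraL jk; rewrite leq_eqVlt -leqNgt => /orP[/eqP ->//|/Nmono/ltnW].
  by rewrite xnN // ov_out.
have xcyl w k : cyl (ovs (ns k) (mkseq w k) (t k)) (x w).
  move=> i; rewrite size_mkseq => it; rewrite (xE w k) // -nsE.
  apply: cyl_ov; [exact: gP|by rewrite size_mkseq].
have xgen w : (forall j, w j \in F j) -> forall i, exists2 u, D i u & cyl u (x w).
  move=> wF i; have [_ _ _ /(_ (mkseq w i.+1))] := H i; rewrite !sns => /(_ (choices_mkseq _ wF))[h _ _].
  by have [u Du us] := h i (leqnn i); exists u => //; apply: cyl_prefix us _ _; exact: xcyl.
exists N, l, x; split=> //.
- by split=> //; [rewrite /l f0|move=> j; have [] := H j].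
- by move=> w w' n h; rewrite !xnN.
- move=> w w' k wF w'F ww' m.
  have [_ _ _ /(_ (mkseq w k.+1))] := H k; rewrite !sns => /(_ (choices_mkseq _ wF))[_ h _].
  have := Dtail _ _ _ _ _ _ (h (mkseq w' k.+1) (choices_mkseq _ w'F)) (xcyl w k.+1) (xgen w wF).
  move=> /(_ m); rewrite /tail_set /=.
  suff -> : ov (ns k.+1) (mkseq w' k.+1) (x w) = x w' by [].
  apply/funext => n; rewrite nsE; have [[j <-]|hn] := NP n.
    have [jk|kj] := ltnP j k.+1; first by rewrite ov_in // xN.
    rewrite ov_out ?xN ?ww' // => i ik; rewrite neq_ltn Nmono //; exact: leq_trans kj.
  by rewrite ov_out // !xnN.
- move=> w w' k wF w'F ww'.
  have e : mkseq w' k.+1 = mkseq w k.+1.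
    by apply: (@eq_from_nth _ 0%N) => [|i]; rewrite !size_mkseq // => ik; rewrite !nth_mkseq // ww'.
  have [_ _ _ /(_ (mkseq w k.+1))] := H k; rewrite !sns => /(_ (choices_mkseq _ wF))[_ _ h].
  pose e0 : R := (2 ^+ (k + l k.+1).+1)^-1.
  have ee : e0 + e0 = (2 ^+ k)^-1 * (2 ^+ l k.+1)^-1.
    by rewrite /e0 exprS exprD; field; rewrite !expf_neq0.
  apply: (@le_trans _ _ (\sum_(0 <= n < l k.+1) (e0 + e0))).
    rewrite big_nat [leRHS]big_nat; apply: ler_sum => n /andP[_ nl].
    have [i fi] := h n nl.
    have h1 := Dhead _ _ _ _ _ _ fi (xcyl w k.+1) (xgen w wF).
    have h2 : head_set n i (l k.+1) k (x w').
      by apply: (Dhead _ _ _ _ _ _ fi _ (xgen w' w'F)); rewrite -e; exact: xcyl.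
    have h3 : `|theta (x w) n - theta (x w') n| <= e0 + e0.
      have := ler_distD (d i) (theta (x w) n) (theta (x w') n); rewrite (distrC (d i)).
      move: h1 h2; rewrite /head_set /= -/e0.
      move: `|_ - _| `|_ - _| `|_ - _| => a b c; lra.
    apply: (le_trans _ h3); apply: powR_le_id => //; rewrite normr_ge0 /=; apply: (le_trans h3).
    rewrite ee -invfM invf_le1 ?mulr_gt0 ?exprn_gt0 // -exprD exprn_ege1 // ler1n //.
  rewrite sumr_const_nat subn0 ee -mulrnAr ler_piMr ?invr_ge0 ?exprn_ge0 //.
  rewrite -[X in X <= _]mulr_natl ler_pdivrMr ?exprn_gt0 // mul1r -natrX ler_nat ltnW // ltn_expl //.
Qed.

End blocks.

Section series_blocks.
Context {R : realType}.

Lemma nneseries_le (u : nat -> \bar R) (b : \bar R) : (forall n, (0 <= u n)%E) ->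
  (forall m, (\sum_(0 <= n < m) u n <= b)%E) -> (\sum_(0 <= n <oo) u n <= b)%E.
Proof.
move=> u0 h; apply: lime_le; first by apply: is_cvg_nneseries => n _ _; exact: u0.
by apply: nearW => m; exact: h.
Qed.

Variable l : nat -> nat.
Hypotheses (l0 : l 0%N = 0%N) (lS : forall j, (l j < l j.+1)%N).

Lemma block_mono i j : (i <= j)%N -> (l i <= l j)%N.
Proof.
elim: j => [|j IH]; first by rewrite leqn0 => /eqP ->.
by rewrite leq_eqVlt => /orP[/eqP -> //|/IH h]; exact: leq_trans (ltnW (lS j)).
Qed.

Lemma block_ge j : (j <= l j)%N.
Proof. by elim: j => // j IH; exact: leq_ltn_trans (lS j). Qed.

Lemma block_ex n : exists j, (l j <= n < l j.+1)%N.
Proof.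
elim: n => [|n [j /andP[h1 h2]]]; first by exists 0%N; rewrite l0 -[X in (X < _)%N]l0 lS.
have [h|h] := leqP (l j.+1) n.+1.
  exists j.+1; rewrite h /=; apply: leq_trans (lS j.+1); by rewrite ltnS.
by exists j; rewrite h andbT (leq_trans h1).
Qed.

Definition block n := ex_minn (block_ex n).

Lemma blockP n : (l (block n) <= n < l (block n).+1)%N.
Proof. by rewrite /block; case: ex_minnP. Qed.

Lemma block_eq n j : (l j <= n < l j.+1)%N -> block n = j.
Proof.
have /andP[h1 h2] := blockP n => /andP[h3 h4]; case: (ltngtP (block n) j) => // h.
  by have := leq_ltn_trans (block_mono h) (leq_ltn_trans h3 h2); rewrite ltnn.
by have := leq_ltn_trans (block_mono h) (leq_ltn_trans h1 h4); rewrite ltnn.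
Qed.

Lemma sum_blocks (V : nmodType) (u : nat -> V) J :
  \sum_(0 <= j < J) \sum_(l j <= n < l j.+1) u n = \sum_(0 <= n < l J) u n.
Proof.
elim: J => [|J IH]; first by rewrite !big_geq // l0.
rewrite big_nat_recr //= IH [RHS](big_cat_nat (n := l J)) //=; exact: ltnW.
Qed.

Lemma nneseries_blocks (u : nat -> \bar R) : (forall n, (0 <= u n)%E) ->
  (\sum_(0 <= n <oo) u n = \sum_(0 <= j <oo) \sum_(l j <= n < l j.+1) u n)%E.
Proof.
move=> u0; apply/eqP; rewrite eq_le; apply/andP; split.
- apply: nneseries_le => // m.
  apply: (@le_trans _ _ (\sum_(0 <= n < l m) u n)%E).
    by rewrite [leRHS](big_cat_nat (n := m)) //= ?block_ge // leeDl // sume_ge0.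
  rewrite -sum_blocks; apply: nneseries_lim_ge => j _ _; exact: sume_ge0.
- apply: nneseries_le => [j|m]; first exact: sume_ge0.
  by rewrite sum_blocks; apply: nneseries_lim_ge => j _ _.
Qed.

Lemma nneseries_sub (u : nat -> \bar R) m n : (forall n, (0 <= u n)%E) ->
  (\sum_(m <= k < n) u k <= \sum_(0 <= k <oo) u k)%E.
Proof.
move=> u0; apply: (@le_trans _ _ (\sum_(0 <= k < n) u k)%E); last by apply: nneseries_lim_ge.
have [mn|nm] := leqP m n; last by rewrite big_geq ?sume_ge0 // ltnW.
by rewrite [leRHS](big_cat_nat (n := m)) //= leeDr // sume_ge0.
Qed.

End series_blocks.

Section extraction.
Context {R : realType}.

Lemma finite_pos_bound (r : seq R) : (forall x, x \in r -> 0 < x) ->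
  exists2 e, 0 < e & forall x, x \in r -> e <= x.
Proof.
elim: r => [|a r IH] h; first by exists 1.
have [|e e0 eP] := IH; first by move=> x xr; apply: h; rewrite inE xr orbT.
exists (Num.min a e); first by rewrite lt_min e0 h ?mem_head.
by move=> x; rewrite inE ge_min => /orP[/eqP ->|/eP ->]; rewrite ?lexx ?orbT.
Qed.

Variables (tau : nat -> nat) (F : nat -> seq nat) (o : nat -> nat).
Variables (dl : nat -> nat -> R) (rh : nat -> nat -> nat -> R).
Hypothesis oF : forall i, o i \in F i.
Hypothesis dl_bound : forall i a b, a \in F i -> b \in F i -> a != b -> 0 < dl a b <= (2 ^+ i)^-1.
Hypothesis dl_refl : forall a, dl a a = 0.
Hypothesis dl_ge0 : forall a b, 0 <= dl a b.
Hypothesis rh_refl : forall j a, rh j a a = 0.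
Hypothesis rh_ge0 : forall j a b, 0 <= rh j a b.
Hypothesis equiv : forall w w', (forall j, w j \in F (tau j)) -> (forall j, w' j \in F (tau j)) ->
  (\sum_(0 <= j <oo) (dl (w j) (w' j))%:E < +oo)%E <-> (\sum_(0 <= j <oo) (rh j (w j) (w' j))%:E < +oo)%E.

Let frequently (bad : nat -> nat -> nat -> nat -> Prop) :=
  forall k i0, exists2 i, (i0 <= i)%N & forall j0, exists j, [/\ (j0 <= j)%N, tau j = i &
    exists a b, [/\ a \in F i, b \in F i, a != b & bad k j a b]].

Lemma pick_block (bad : nat -> nat -> nat -> nat -> Prop) (h : nat -> R) :
  (forall k, (2 ^+ k)^-1 <= h k) -> frequently bad -> forall k m,
  exists e : nat * (nat -> nat) * (nat -> nat), let: (m', u, u') := e in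
    [/\ (m < m')%N, (forall j, u j \in F (tau j)), (forall j, u' j \in F (tau j)),
      h k <= \sum_(m <= j < m') dl (u j) (u' j) <= h k + h k &
      forall j, u j = u' j \/ bad k j (u j) (u' j)].
Proof.
move=> hk freq k m; have [i ki iP] := freq k k.
pose B j := exists ab : nat * nat, [/\ ab.1 \in F i, ab.2 \in F i, ab.1 != ab.2 & bad k j ab.1 ab.2].
have /choice[uu uuP] j : exists ab : nat * nat,
   [/\ ab.1 \in F (tau j), ab.2 \in F (tau j), ab.1 = ab.2 \/ (tau j = i /\ bad k j ab.1 ab.2) & tau j = i /\ B j -> tau j = i /\ ab.1 != ab.2].
  have [[tj [ab [h1 h2 h3 h4]]]|nB] := pselect (tau j = i /\ B j).
    by exists ab; rewrite tj; split => //; right.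
  by exists (o (tau j), o (tau j)); split => //=; left.
pose g j := dl (uu j).1 (uu j).2.
have g0 j : 0 <= g j by exact: dl_ge0.
have [|eta eta0 etaP] := @finite_pos_bound [seq dl p.1 p.2 | p <- [seq (a, b) | a <- F i, b <- F i] & p.1 != p.2].
  move=> x /mapP[[a b]]; rewrite mem_filter /= => /andP[ab /allpairsP[[a' b'] [/= aF bF [ea eb]]]] ->.
  by have /andP[] : 0 < dl a b <= (2 ^+ i)^-1 by apply: dl_bound => //; rewrite ?ea ?eb.
have geta j : tau j = i -> B j -> eta <= g j.
  move=> tj Bj; have [h1 h2 _ /(_ (conj tj Bj))[_ ne]] := uuP j.
  apply: etaP; apply/mapP; exists (uu j) => //; rewrite mem_filter ne /=.
  by apply/allpairsP; exists ((uu j).1, (uu j).2) => /=; rewrite -tj; split => //; case: (uu j).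
have unb c : exists m', (m <= m')%N /\ c%:R * eta <= \sum_(m <= j < m') g j.
  elim: c => [|c [m' [mm' hc]]]; first by exists m; rewrite mul0r big_geq.
  have [j [j1 j2 Bj]] := iP m'.
  have {}Bj : B j by have [a [b ?]] := Bj; exists (a, b).
  exists j.+1; split; first by rewrite leqW // (leq_trans mm').
  rewrite big_nat_recr ?(leq_trans mm') //= -natr1 mulrDl mul1r lerD ?geta //.
  apply: (le_trans hc); rewrite [leRHS](big_cat_nat (n := m')) //= lerDl sumr_ge0 //.
have hk0 : 0 < h k by apply: lt_le_trans (hk k); rewrite invr_gt0 exprn_gt0.
have ex : exists m', (m <= m')%N && (h k <= \sum_(m <= j < m') g j).
  have [m' [mm' mP]] := unb (Num.truncn (h k / eta)).+1; exists m'; rewrite mm' /=; apply: le_trans mP.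
  rewrite -ler_pdivrMr //; apply/ltW; exact: truncnS_gt.
exists (ex_minn ex, fun j => (uu j).1, fun j => (uu j).2).
case: ex_minnP => m' /andP[mm' h1] m'min.
have lt : (m < m')%N.
  rewrite ltn_neqAle mm' andbT; apply/eqP => e; move: h1; rewrite -e big_geq // leNgt hk0 //.
split => //.
- by move=> j; have [] := uuP j.
- by move=> j; have [] := uuP j.
- rewrite h1 /=; case: m' lt m'min {mm' h1} => // n; rewrite ltnS => mn m'min.
  rewrite big_nat_recr //=; apply: lerD.
    rewrite leNgt; apply/negP => /ltW hh; have := m'min n; rewrite mn hh => /(_ isT); by rewrite ltnn.
  have [h1 h2 _ _] := uuP n; apply: le_trans (_ : _ <= (2 ^+ k)^-1) (hk k).
  have [e|ne] := eqVneq (uu n).1 (uu n).2; first by rewrite e dl_refl invr_ge0 exprn_ge0.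
  have [_ _ [e|[tn _]] _] := uuP n; first by rewrite e eqxx in ne.
  rewrite tn in h1 h2; have /andP[_ hh] := dl_bound h1 h2 ne; apply: le_trans hh _.
  by rewrite lef_pV2 ?posrE ?exprn_gt0 // ler_eXn2l // ltr1n.
- by move=> j; have [_ _ [->|[_ ?]] _] := uuP j; [left|right].
Qed.

(* Concatenating the blocks given by [pick_block] yields two points whose
   distance is comparable to the series of the [h k]. *)
Lemma pick_blocks (bad : nat -> nat -> nat -> nat -> Prop) (h : nat -> R) :
  (forall k, (2 ^+ k)^-1 <= h k) -> frequently bad ->
  exists (m : nat -> nat) (w w' : nat -> nat),
    [/\ m 0%N = 0%N /\ (forall k, (m k < m k.+1)%N),
        (forall j, w j \in F (tau j)), (forall j, w' j \in F (tau j)),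
        (forall k, h k <= \sum_(m k <= j < m k.+1) dl (w j) (w' j) <= h k + h k) &
        (forall k j, (m k <= j < m k.+1)%N -> w j = w' j \/ bad k j (w j) (w' j))].
Proof.
move=> hk freq.
have /choice[e eP] (km : nat * nat) := pick_block hk freq km.1 km.2.
pose nxt k m := (e (k, m)).1.1.
pose m := fix m k := if k is k'.+1 then nxt k' (m k') else 0%N.
have mS k : (m k < m k.+1)%N.
  by rewrite /= /nxt; have := eP (k, m k); case: (e _) => [[m' u] u'] [].
pose b := block (erefl : m 0%N = 0%N) mS.
pose w j := (e (b j, m (b j))).1.2 j; pose w' j := (e (b j, m (b j))).2 j.
have bE k j : (m k <= j < m k.+1)%N -> b j = k by exact: block_eq.
exists m, w, w'; split=> //.
- by move=> j; rewrite /w; have := eP (b j, m (b j)); case: (e _) => [[m' u] u'] [].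
- by move=> j; rewrite /w'; have := eP (b j, m (b j)); case: (e _) => [[m' u] u'] [].
- move=> k; rewrite (eq_big_nat _ _ (F2 := fun j => dl ((e (k, m k)).1.2 j) ((e (k, m k)).2 j))).
    by have := eP (k, m k); rewrite /= /nxt; case: (e _) => [[m' u] u'] [].
  by move=> j /bE; rewrite /w /w' => ->.
- move=> k j /bE kj; rewrite /w /w' kj.
  by have := eP (k, m k); case: (e _) => [[m' u] u'] [].
Qed.

Lemma sum_half_lt (c : R) : (\sum_(0 <= k <oo) (c / 2 ^+ k)%:E < +oo)%E.
Proof.
rewrite (_ : (\sum_(0 <= k <oo) (c / 2 ^+ k)%:E)%E = (\sum_(0 <= k <oo) ((c * 2) / (2 ^ (k + 1))%:R)%:E)%E).
  by have /cvg_lim -> := @cvg_geometric_eseries_half R (c * 2) 0; rewrite ?ltry.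
by apply: eq_eseriesr => k _; congr EFin; rewrite addn1 natrX exprS; field; rewrite expf_neq0.
Qed.

Lemma extraction_upper : ~ frequently (fun k j a b => 4 ^+ k * dl a b < rh j a b).
Proof.
move=> /(pick_blocks (h := fun k => (2 ^+ k)^-1)) [//|m [w [w' [[m0 mS] wF w'F hm hb]]]].
have fin : (\sum_(0 <= j <oo) (dl (w j) (w' j))%:E < +oo)%E.
  rewrite (nneseries_blocks m0 mS); last by move=> n; rewrite lee_fin.
  apply: le_lt_trans (sum_half_lt 2).
  apply: lee_nneseries => k _; first by move=> _; apply: sume_ge0 => j _; rewrite lee_fin.
  rewrite sumEFin lee_fin; have /andP[_] := hm k; rewrite (_ : 2 / 2 ^+ k = (2 ^+ k)^-1 + (2 ^+ k)^-1) //; ring.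
have := proj1 (equiv wF w'F) fin; apply/negP; rewrite -leNgt leye_eq; apply/eqP/eqyP => A A0.
pose k := (Num.truncn A).+1.
apply: (@le_trans _ _ (\sum_(m k <= j < m k.+1) (rh j (w j) (w' j))%:E)%E); last first.
  by apply: nneseries_sub => n; rewrite lee_fin.
rewrite sumEFin lee_fin; apply: (@le_trans _ _ (4 ^+ k * (2 ^+ k)^-1)).
  rewrite (_ : 4 = 2 * 2 :> R) ?exprMn ?mulfK ?expf_neq0 //; last by rewrite -natrM.
  apply: (@le_trans _ _ k%:R); first by apply/ltW; exact: truncnS_gt.
  by rewrite -natrX ler_nat ltnW // ltn_expl.
have /andP[h1 _] := hm k; apply: (@le_trans _ _ (4 ^+ k * \sum_(m k <= j < m k.+1) dl (w j) (w' j))).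
  by rewrite ler_pM2l // exprn_gt0.
rewrite mulr_sumr big_nat [leRHS]big_nat; apply: ler_sum => j /hb[->|/ltW //].
by rewrite dl_refl rh_refl mulr0.
Qed.

Lemma extraction_lower : ~ frequently (fun k j a b => 4 ^+ k * rh j a b < dl a b).
Proof.
move=> /(pick_blocks (h := fun k => 1)) [|m [w [w' [[m0 mS] wF w'F hm hb]]]].
  by move=> k; rewrite invf_le1 ?exprn_gt0 // exprn_ege1 // ler1n.
have fin : (\sum_(0 <= j <oo) (rh j (w j) (w' j))%:E < +oo)%E.
  rewrite (nneseries_blocks m0 mS) //; last by move=> n; rewrite lee_fin.
  apply: le_lt_trans (sum_half_lt 2).
  apply: lee_nneseries => k _; first by move=> _; apply: sume_ge0 => j _; rewrite lee_fin.
  have k4 : 0 < 4 ^+ k :> R by rewrite exprn_gt0.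
  rewrite sumEFin lee_fin; apply: (@le_trans _ _ (2 / 4 ^+ k)).
    rewrite ler_pdivlMr // mulrC mulr_sumr; have /andP[_ h2] := hm k; apply: le_trans h2.
    rewrite big_nat [leRHS]big_nat; apply: ler_sum => j /hb[->|/ltW //].
    by rewrite dl_refl rh_refl mulr0.
  rewrite ler_pM2l // lef_pV2 ?posrE ?exprn_gt0 //.
  by apply: lerXn2r; rewrite ?nnegrE ?ler_nat.
have := proj2 (equiv wF w'F) fin; apply/negP; rewrite -leNgt leye_eq.
rewrite (nneseries_blocks m0 mS); last by move=> n; rewrite lee_fin.
apply/eqP/eqyP => A A0.
pose k := (Num.truncn A).+1.
apply: (@le_trans _ _ (\sum_(0 <= i < k) 1%:E)%E).
  rewrite sumEFin lee_fin sumr_const_nat subn0; apply/ltW; exact: truncnS_gt.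
apply: (@le_trans _ _ (\sum_(0 <= i < k) \sum_(m i <= j < m i.+1) (dl (w j) (w' j))%:E)%E).
  by apply: lee_sum => i _; rewrite sumEFin lee_fin; have /andP[] := hm i.
by apply: nneseries_lim_ge => i _ _; apply: sume_ge0 => j _; rewrite lee_fin.
Qed.

Hypothesis tau_inf : forall i j0, exists2 j, (j0 <= j)%N & tau j = i.

Lemma extraction : exists (C : R) (i0 : nat), 0 < C /\ forall i, (i0 <= i)%N ->
  exists j, tau j = i /\ forall a b, a \in F i -> b \in F i ->
    dl a b <= C * rh j a b /\ rh j a b <= C * dl a b.
Proof.
have aux bad : ~ frequently bad -> exists k i0, forall i, (i0 <= i)%N -> exists j0, forall j, (j0 <= j)%N ->
    tau j = i -> forall a b, a \in F i -> b \in F i -> a != b -> ~ bad k j a b.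
  move=> nf; apply: contrapT => no; apply: nf => k i0; apply: contrapT => no1; apply: no.
  exists k, i0 => i ii; apply: contrapT => no2; apply: no1; exists i => // j0.
  apply: contrapT => no3; apply: no2; exists j0 => j jj tj a b aF bF ab bd; apply: no3.
  by exists j; split => //; exists a, b.
have [k1 [i1 P1]] := aux _ extraction_upper; have [k2 [i2 P2]] := aux _ extraction_lower.
exists (4 ^+ (maxn k1 k2)), (maxn i1 i2); split; first by rewrite exprn_gt0.
move=> i; rewrite geq_max => /andP[/P1[j1 {}P1] /P2[j2 {}P2]].
have [j] := tau_inf i (maxn j1 j2); rewrite geq_max => /andP[h1 h2] tj; exists j; split => // a b aF bF.
have [->|ab] := eqVneq a b; first by rewrite dl_refl rh_refl mulr0.
have /negP := P1 j h1 tj a b aF bF ab; rewrite -leNgt => g1.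
have /negP := P2 j h2 tj a b aF bF ab; rewrite -leNgt => g2.
have mono c c' (x : R) : (c <= c')%N -> 0 <= x -> 4 ^+ c * x <= 4 ^+ c' * x.
  by move=> cc x0; apply: ler_wpM2r => //; rewrite ler_eXn2l // ltr1n.
by split; [apply: le_trans g2 _|apply: le_trans g1 _]; apply: mono => //; rewrite ?leq_maxl ?leq_maxr.
Qed.

End extraction.

Lemma nneseries_support (R : realType) (u : nat -> \bar R) (N : nat -> nat) :
  (forall n, (0 <= u n)%E) -> (forall i j, (i < j)%N -> (N i < N j)%N) ->
  (forall n, (forall j, N j != n) -> u n = 0%E) ->
  (\sum_(0 <= n <oo) u n = \sum_(0 <= j <oo) u (N j))%E.
Proof.
move=> u0 Nmono uN; rewrite !nneseries_esumT //.
transitivity (\esum_(n in range N) u n)%E.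
  rewrite [RHS]esum_mkcond; apply: eq_esum => n _; case: ifPn => // /negP nr.
  by apply: uN => j; apply/eqP => e; apply: nr; rewrite inE; exists j.
rewrite (@esum_image _ _ _ [set: nat] N) // => i j _ _ e.
by case: (ltngtP i j) => // /Nmono; rewrite e ltnn.
Qed.

Section reduction_embeddings.
Context {R : realType} (X Y : normedModType R) (p q : R) (d : nat -> Y).
Hypotheses (p1 : 1 <= p) (q1 : 1 <= q).
Hypothesis d_dense : forall (y : Y) (e : R), 0 < e -> exists i, `|y - d i| < e.
Variables (T : nat -> finType) (v : forall i, T i -> X) (a0 : forall i, T i).
Hypothesis v_bound : forall i (a b : T i), a != b -> 0 < `|v a - v b| `^ p <= (2 ^+ i)^-1.

Let pt (m : nat) : X := if unpickle m is Some a then v (tagged (a : {i & T i})) else 0.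
Let cd i (a : T i) : nat := pickle (Tagged T a).
Let ptE i (a : T i) : pt (cd a) = v a.
Proof. by rewrite /pt /cd pickleK. Qed.
Let F (i : nat) : seq nat := [seq cd a | a <- enum (T i)].
Let FP i m : m \in F i -> exists a : T i, m = cd a.
Proof. by move=> /mapP[a _ ->]; exists a. Qed.
Let cdF i (a : T i) : cd a \in F i.
Proof. by apply: map_f; rewrite mem_enum. Qed.

Let tau j := logn 2 j.+1.

Let tau_inf i j0 : exists2 j, (j0 <= j)%N & tau j = i.
Proof.
have h : (0 < 2 ^ i * 3 ^ j0)%N by rewrite muln_gt0 !expn_gt0.
exists (2 ^ i * 3 ^ j0).-1.
  rewrite -ltnS prednK //; apply: leq_trans (ltn_expl j0 (isT : 1 < 3)%N) _.
  by rewrite leq_pmull // expn_gt0.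
by rewrite /tau prednK // lognM ?expn_gt0 // pfactorK // lognX (logn_coprime (p := 2) (m := 3)) // muln0 addn0.
Qed.

Variable theta0 : {ptws nat -> X} -> {ptws nat -> Y}.
Hypothesis theta0_borel : borel_map theta0.
Hypothesis theta0_red : forall x y, E_rel X p x y <-> E_rel Y q (theta0 x) (theta0 y).

Let e (z : nat -> nat) : {ptws nat -> X} := fun n => pt (z n).
Let theta (z : nat -> nat) (n : nat) : Y := theta0 (e z) n.

Let theta_meas n : ball_measurable (fun z => theta z n).
Proof.
move=> y r.
have -> : [set z | `|theta z n - y| < r] = e @^-1` (theta0 @^-1` [set f | ball y r (f n)]).
  by apply/seteqP; split=> z; rewrite /= -ball_normE /= distrC.
apply: (@salg_preimage _ _ [set U : set {ptws nat -> X} | open U]); last first.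
  apply: theta0_borel; apply: sub_sigma_algebra; apply: open_coordinate; exact: ball_open.
move=> U oU; rewrite (preimage_open_cyl _ oU); last first.
  by move=> m; exists m.+1 => z z' h; rewrite /e h.
rewrite bigcup_mkcond; apply: salg_bigcup_countable => s; case: ifP => _; last exact: sigma_algebra0.
by apply: sub_sigma_algebra; exists s.
Qed.

Let powR0' (s : R) : 1 <= s -> `|0 : R| `^ s = 0.
Proof. by move=> s1; rewrite normr0 powR0 // gt_eqF // (lt_le_trans _ s1). Qed.

Let theta_fin z z' : (exists k, forall n, (k <= n)%N -> z n = z' n) ->
  (\sum_(0 <= n <oo) (`|theta z n - theta z' n| `^ q)%:E < +oo)%E.
Proof.
move=> [k kP]; apply: (proj1 (theta0_red (e z) (e z'))).
rewrite /E_rel (nneseries_split 0 k); last by move=> n _; rewrite lee_fin powR_ge0.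
rewrite eseries0 ?adde0; first by rewrite sumEFin ltry.
move=> n; rewrite add0n => kn _; rewrite /e kP // subrr normr0 powR0 //.
by rewrite gt_eqF // (lt_le_trans _ p1).
Qed.

Lemma reduction_embeddings_aux : exists (C : R) (i0 : nat), 0 < C /\ forall i, (i0 <= i)%N ->
  exists (m n : nat) (U : T i -> nat -> Y), forall a b : T i,
    `|v a - v b| `^ p <= C * (\sum_(m <= k < n) `|U a k - U b k| `^ q) /\
    \sum_(m <= k < n) `|U a k - U b k| `^ q <= C * `|v a - v b| `^ p.
Proof.
have [N [l [x [[l0 lS Nmono] xN xnN xtail xhead]]]] := block_structure d_dense q1 theta_meas theta_fin (fun j => F (tau j)) (fun j => cd (a0 (tau j))).
pose o j := cd (a0 (tau j)).
pose upd j a := fun i => if i == j then a else o i.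
pose rh j a b := \sum_(l j <= n < l j.+1) `|theta (x (upd j a)) n - theta (x (upd j b)) n| `^ q.
pose dl a b := `|pt a - pt b| `^ p.
have updF j a : a \in F (tau j) -> forall i, upd j a i \in F (tau i).
  by move=> aF i; rewrite /upd; case: eqP => [->|_] //; exact: cdF.
have equiv w w' : (forall j, w j \in F (tau j)) -> (forall j, w' j \in F (tau j)) ->
  (\sum_(0 <= j <oo) (dl (w j) (w' j))%:E < +oo)%E <-> (\sum_(0 <= j <oo) (rh j (w j) (w' j))%:E < +oo)%E.
  move=> wF w'F.
  have -> : (\sum_(0 <= j <oo) (dl (w j) (w' j))%:E < +oo)%E <-> E_rel X p (e (x w)) (e (x w')).
    rewrite /E_rel (@nneseries_support _ (fun n => (`|e (x w) n - e (x w') n| `^ p)%:E) N).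
    - suff -> : (\sum_(0 <= j <oo) (`|e (x w) (N j) - e (x w') (N j)| `^ p)%:E = \sum_(0 <= j <oo) (dl (w j) (w' j))%:E)%E by [].
      by apply: eq_eseriesr => j _; rewrite /e !xN.
    - by move=> n; rewrite lee_fin powR_ge0.
    - exact: Nmono.
    - by move=> n h; rewrite /e (xnN w w' n h) subrr normr0 powR0 // gt_eqF // (lt_le_trans _ p1).
  rewrite theta0_red.
  pose y w : {ptws nat -> Y} := fun n => theta (x (upd (block l0 lS n) (w (block l0 lS n)))) n.
  have yP u : (forall j, u j \in F (tau j)) -> E_rel Y q (theta0 (e (x u))) (y u).
    move=> uF; rewrite /E_rel (nneseries_blocks l0 lS); last by move=> n; rewrite lee_fin powR_ge0.
    apply: (@le_lt_trans _ _ (\sum_(0 <= j <oo) ((2 `^ q * 3) / 2 ^+ j)%:E)%E); last exact: sum_half_lt.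
    apply: lee_nneseries => j _; first by move=> _; apply: sume_ge0 => n _; rewrite lee_fin powR_ge0.
    rewrite sumEFin lee_fin.
    pose u1 i := if (i < j)%N then o i else u i.
    have u1F i : u1 i \in F (tau i) by rewrite /u1; case: ifP => // _; exact: cdF.
    have h1 : \sum_(l j <= n < l j.+1) `|theta (x u) n - theta (x u1) n| `^ q <= 2 / 2 ^+ j.
      rewrite /u1; case: j @u1 u1F => [|j] u1 u1F.
        by rewrite big1 ?expr0 // => n _; rewrite subrr normr0 powR0 // gt_eqF // (lt_le_trans _ q1).
      rewrite exprS invfM mulrA divff // mul1r; apply: xtail => // i; rewrite /u1 ltnS => ji.
      by rewrite leqNgt ji.
    have h2 : \sum_(l j <= n < l j.+1) `|theta (x u1) n - theta (x (upd j (u j))) n| `^ q <= (2 ^+ j)^-1.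
      have := xhead u1 (upd j (u j)) j u1F (updF j _ (uF j)).
      rewrite (big_cat_nat (n := l j)) //=; last exact: ltnW.
      move=> h; apply: le_trans (h _).
        by rewrite lerDr sumr_ge0 // => n _; exact: powR_ge0.
      move=> i; rewrite leq_eqVlt /u1 /upd => /orP[/eqP ->|ij]; first by rewrite ltnn eqxx.
      by rewrite ij ltn_eqF.
    apply: (@le_trans _ _ (\sum_(l j <= n < l j.+1) 2 `^ q * (`|theta (x u) n - theta (x u1) n| `^ q + `|theta (x u1) n - theta (x (upd j (u j))) n| `^ q))).
      rewrite big_nat [leRHS]big_nat; apply: ler_sum => n nj.
      have -> : theta0 (e (x u)) n - y u n = theta (x u) n - theta (x (upd j (u j))) n by rewrite /y (block_eq l0 lS nj).
      have q0 : 0 <= q by rewrite (le_trans _ q1).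
      apply: le_trans (powR_addle q0 _ _) => //.
      by apply: ge0_ler_powR; rewrite ?nnegrE ?addr_ge0 // ler_distD.
    rewrite -mulr_sumr big_split /= -!mulrA ler_pM2l ?powR_gt0 //.
    by rewrite (_ : 3 / 2 ^+ j = 2 / 2 ^+ j + (2 ^+ j)^-1); [apply: lerD|ring].
  rewrite (E_rel_congr q1 (yP w wF) (yP w' w'F)) /E_rel (nneseries_blocks l0 lS); last by move=> n; rewrite lee_fin powR_ge0.
  suff -> : (\sum_(0 <= j <oo) \sum_(l j <= n < l j.+1) (`|y w n - y w' n| `^ q)%:E = \sum_(0 <= j <oo) (rh j (w j) (w' j))%:E)%E by [].
  apply: eq_eseriesr => j _; rewrite sumEFin; congr EFin; apply: eq_big_nat => n nj.
  by rewrite /y (block_eq l0 lS nj).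
have [||||||C [i0 [C0 CP]]] := extraction (F := F) (tau := tau) (o := fun i => cd (a0 i)) (dl := dl) (rh := rh) _ _ _ _ _ _ equiv tau_inf.
- by move=> i; exact: cdF.
- move=> i _ _ /FP[a ->] /FP[b ->] ab; rewrite /dl !ptE; apply: v_bound.
  by apply: contraNneq ab => ->.
- by move=> a; rewrite /dl subrr normr0 powR0 // gt_eqF // (lt_le_trans _ p1).
- by move=> a b; exact: powR_ge0.
- move=> j a; rewrite /rh big1 // => n _; by rewrite subrr normr0 powR0 // gt_eqF // (lt_le_trans _ q1).
- by move=> j a b; apply: sumr_ge0 => n _; exact: powR_ge0.
exists C, i0; split => // i /CP[j [tj jP]].
exists (l j), (l j.+1), (fun a n => theta (x (upd j (cd a))) n) => a b.
have := jP (cd a) (cd b) (cdF a) (cdF b); rewrite /dl /rh !ptE; exact.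
Qed.

End reduction_embeddings.

(** * Sums over dyadic scales *)

Section scales.
Context {R : realType}.

Lemma powR_gt1_log (B s : R) : 1 < B -> 0 < s -> B `^ (ln s / ln B) = s.
Proof.
move=> B1 s0; have B0 : 0 < B by rewrite (lt_trans _ B1).
rewrite /powR gt_eqF // divfK ?lnK ?posrE // gt_eqF //.
by rewrite ln_gt0.
Qed.

Lemma ltr_powR1 (B x y : R) : 1 < B -> x < y -> B `^ x < B `^ y.
Proof.
move=> B1 xy; have B0 : 0 < B by rewrite (lt_trans _ B1).
by rewrite /powR gt_eqF // ltr_expR ltr_pM2r // ln_gt0.
Qed.

Lemma scale_ex (B s : R) : 1 < B -> 0 < s -> exists m : int, B `^ m%:~R <= s < B `^ (m + 1)%:~R.
Proof.
move=> B1 s0; exists (Num.floor (ln s / ln B)); have /andP[h1 h2] := floor_itv (ln s / ln B).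
have B0 : 0 < B by rewrite (lt_trans _ B1).
rewrite -{2 3}(powR_gt1_log B1 s0) ler_powR ?(ltW B1) //=.
exact: ltr_powR1.
Qed.

Lemma esum_int (F : int -> \bar R) : (forall k, (0 <= F k)%E) ->
  (\esum_(k in [set: int]) F k = \sum_(0 <= j <oo) F (Posz j) + \sum_(0 <= j <oo) F (Negz j))%E.
Proof.
move=> F0; rewrite (esumID (range Posz)) // !setTI; congr (_ + _)%E.
  by rewrite (@esum_image _ _ _ [set: nat] Posz) ?nneseries_esumT // => i j _ _ [].
rewrite (_ : ~` _ = range Negz).
  by rewrite (@esum_image _ _ _ [set: nat] Negz) ?nneseries_esumT // => i j _ _ [].
apply/seteqP; split=> -[j|j] /=; [by case; exists j|by move=> _; exists j|by case|by move=> _ []].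
Qed.

Lemma geometric_nneseries (z : R) : 0 <= z < 1 -> (\sum_(0 <= j <oo) (z ^+ j)%:E <= ((1 - z)^-1)%:E)%E.
Proof.
move=> /andP[z0 z1]; apply: lime_le; first by apply: is_cvg_nneseries => n _ _; rewrite lee_fin exprn_ge0.
apply: nearW => m; rewrite sumEFin lee_fin -[leRHS]mul1r ler_pdivlMr ?subr_gt0 //.
have -> : (\sum_(0 <= i < m) z ^+ i) * (1 - z) = 1 - z ^+ m.
  elim: m => [|m IH]; first by rewrite big_geq // mul0r expr0 subrr.
  by rewrite big_nat_recr //= mulrDl IH exprS; ring.
by rewrite gerBl exprn_ge0.
Qed.

Lemma powR_geo (B a : R) (j : nat) : 0 <= B -> B `^ (- (j%:R * a)) = (B `^ (- a)) ^+ j.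
Proof. by move=> B0; rewrite -mulrN mulrC powRrM powR_mulrn ?powR_ge0. Qed.

Lemma scale_sum (B b t0 t1 : R) : 1 < B -> t0 < b < t1 -> exists2 C : R, 0 < C &
  forall (s K : R) (phi : int -> R), 0 < s -> 0 <= K -> (forall k, 0 <= phi k) ->
  (forall k, phi k <= K * (s / B `^ k%:~R) `^ t1) -> (forall k, phi k <= K * (s / B `^ k%:~R) `^ t0) ->
  (\esum_(k in [set: int]) (B `^ (k%:~R * b) * phi k)%:E <= (K * C * s `^ b)%:E)%E.
Proof.
move=> B1 /andP[tb bt]; have B0 : 0 < B by rewrite (lt_trans _ B1).
have lt1 a : 0 < a -> 0 <= B `^ (- a) < 1.
  move=> a0; rewrite powR_ge0 /= -(powRr0 B); apply: ltr_powR1 => //; lra.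
have a0 : 0 < t1 - b by lra. have c0 : 0 < b - t0 by lra.
pose C := B `^ (t1 - b) * (1 - B `^ (- (t1 - b)))^-1 + (1 - B `^ (- (b - t0)))^-1.
have /andP[p1 p2] := lt1 _ a0; have /andP[p3 p4] := lt1 _ c0.
exists C.
  by rewrite addr_gt0 ?mulr_gt0 ?powR_gt0 ?invr_gt0 ?subr_gt0.
move=> s K phi s0 K0 phi0 h1 h0.
have [x sE] : exists x, s = B `^ x by exists (ln s / ln B); rewrite powR_gt1_log.
have Bn : B != 0 by rewrite gt_eqF.
have D (u v : R) : B `^ (u + v) = B `^ u * B `^ v by rewrite powRD // Bn implybT.
have uE k t : (s / B `^ k) `^ t = B `^ ((x - k) * t).
  by rewrite sE -powRN -D powRrM.
pose m := Num.floor x; have /andP[m1 m2] := floor_itv x.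
rewrite (reindex_esum [set: int] [set: int] (fun k => k + m)); last first.
  by split=> // [i j _ _ /addIr //|k _]; exists (k - m) => //; rewrite subrK.
rewrite esum_int; last by move=> k; rewrite lee_fin mulr_ge0 ?powR_ge0.
have -> : (K * C * s `^ b)%:E = ((K * s `^ b * B `^ (t1 - b) * (1 - B `^ (- (t1 - b)))^-1)%:E + (K * s `^ b * (1 - B `^ (- (b - t0)))^-1)%:E)%E.
  by rewrite -EFinD; congr EFin; rewrite /C; ring.
have sb : s `^ b = B `^ (x * b) by rewrite sE powRrM.
have Ksb : 0 <= K * s `^ b by rewrite mulr_ge0 ?powR_ge0.
apply: leeD.
- apply: (@le_trans _ _ (\sum_(0 <= j <oo) ((K * s `^ b * B `^ (t1 - b))%:E * ((B `^ (- (t1 - b))) ^+ j)%:E))%E).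
    apply: lee_nneseries => j _; first by move=> _; rewrite lee_fin mulr_ge0 ?powR_ge0.
    rewrite -EFinM lee_fin; apply: le_trans (ler_wpM2l (powR_ge0 _ _) (h1 _)) _.
    rewrite uE sb -powR_geo ?(ltW B0) // mulrCA -!mulrA ler_wpM2l // -!D ler_powR ?(ltW B1) //.
    rewrite intrD -pmulrn.
    move: m1 m2; rewrite intrD -/m; move: (m%:~R : R) (j%:R : R) => mm jj m1 m2.
    have : 0 <= (mm + 1 - x) * (t1 - b) by apply: mulr_ge0; lra.
    by nra.
  rewrite nneseriesZl; last by move=> j _; rewrite lee_fin exprn_ge0.
  rewrite [leRHS]EFinM; apply: lee_wpmul2l; first by rewrite lee_fin mulr_ge0 ?powR_ge0.
  by apply: geometric_nneseries; rewrite p1 p2.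
- apply: (@le_trans _ _ (\sum_(0 <= j <oo) ((K * s `^ b)%:E * ((B `^ (- (b - t0))) ^+ j)%:E))%E).
    apply: lee_nneseries => j _; first by move=> _; rewrite lee_fin mulr_ge0 ?powR_ge0.
    rewrite -EFinM lee_fin; apply: le_trans (ler_wpM2l (powR_ge0 _ _) (h0 _)) _.
    rewrite uE sb -powR_geo ?(ltW B0) // mulrCA -!mulrA ler_wpM2l // -!D ler_powR ?(ltW B1) //.
    rewrite NegzE intrD rmorphN /= -pmulrn -natr1.
    move: m1 m2; rewrite intrD -/m; move: (m%:~R : R) (j%:R : R) => mm jj m1 m2.
    have : 0 <= (x - mm) * (b - t0) by apply: mulr_ge0; lra.
    by nra.
  rewrite nneseriesZl; last by move=> j _; rewrite lee_fin exprn_ge0.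
  rewrite [leRHS]EFinM; apply: lee_wpmul2l; first by rewrite lee_fin.
  by apply: geometric_nneseries; rewrite p3 p4.
Qed.

Lemma esum_ge1 (I : choiceType) (F : I -> \bar R) i : (forall i, (0 <= F i)%E) ->
  (F i <= \esum_(k in [set: I]) F k)%E.
Proof.
move=> F0; apply: esum_ge; exists [set i]; last by rewrite fsbig_set1.
by split=> //; exact: finite_set1.
Qed.

Definition wave (t : bool) (x : R) : R := if t then sin x else cos x.

Lemma wave_dist2 x y : (wave true x - wave true y) ^+ 2 + (wave false x - wave false y) ^+ 2 = 2 - 2 * cos (x - y).
Proof. by rewrite /wave cosB; have := cos2Dsin2 x; have := cos2Dsin2 y; lra. Qed.

Lemma wave_lip t x y : `|wave t x - wave t y| <= `|x - y|.
Proof.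
wlog xy : x y / y <= x.
  by case: (leP y x) => [|/ltW] h H; [exact: H|rewrite distrC [leRHS]distrC; exact: H].
have [||c _ ->] := @MVT_segment R (wave t) (if t then cos else (fun x => - sin x)) y x xy.
- by move=> z _; rewrite /wave; case: (t) => /=; [exact: is_derive_sin|exact: is_derive_cos].
- by apply: continuous_subspaceT => z; rewrite /wave; case: (t); [exact: continuous_sin|exact: continuous_cos].
- rewrite normrM ler_piMl //; case: t; [exact: cos_max|rewrite normrN; exact: sin_max].
Qed.

Lemma wave_bound t x y : `|wave t x - wave t y| <= 2.
Proof.
have h z : `|wave t z| <= 1 by rewrite /wave; case: t; [exact: sin_max|exact: cos_max].
by apply: le_trans (ler_normB _ _) _; have := h x; have := h y; lra.
Qed.

Lemma wave_lower (a : R) : 0 < a <= 2 -> exists2 c, 0 < c & forall x y, a <= `|x - y| <= 2 ->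
  exists t, c <= `|wave t x - wave t y|.
Proof.
move=> /andP[a0 a2]; have pi2 := pi_ge2 R.
have ca : cos a < 1.
  by rewrite -cos0 ltr_cos // in_itv /= ?lexx ?pi_ge0 //; lra.
pose c := Num.min 1 ((2 - 2 * cos a) / 2).
have c0 : 0 < c by rewrite lt_min ltr01 /=; lra.
exists c => // x y xy.
have cosn : cos (x - y) = cos `|x - y|.
  by case: (ger0P (x - y)) => // _; rewrite cosN.
have cxy : cos (x - y) <= cos a.
  have /andP[h1 h2] := xy; rewrite cosn leNgt ltr_cos -?leNgt // in_itv /=; lra.
have := wave_dist2 x y.
have [h|h] := leP c `|wave true x - wave true y|; first by exists true.
have [h'|h'] := leP c `|wave false x - wave false y|; first by exists false.
rewrite -[X in X + _]real_normK ?num_real // -[X in _ + X]real_normK ?num_real //.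
have c1 : c <= 1 by rewrite ge_min lexx.
have c2 : c <= (2 - 2 * cos a) / 2 by rewrite ge_min lexx orbT.
move: h h' (normr_ge0 (wave true x - wave true y)) (normr_ge0 (wave false x - wave false y)).
move: `|_ - _| `|_ - _| => u v; nra.
Qed.

End scales.

(** * Snowflakes, Enflo type and the Mazur map *)

Section snowflake.
Context {R : realType}.

Lemma wave_snowflake (b t : R) : 0 < b < t -> exists c C : R, [/\ 0 < c, 0 < C &
  forall x y : R,
  ((c * `|x - y| `^ b)%:E <= \esum_(k in [set: int])
     (2 `^ (k%:~R * b) * \sum_(h : bool) `|wave h (x / 2 `^ k%:~R) - wave h (y / 2 `^ k%:~R)| `^ t)%:E)%E /\
  (\esum_(k in [set: int])
     (2 `^ (k%:~R * b) * \sum_(h : bool) `|wave h (x / 2 `^ k%:~R) - wave h (y / 2 `^ k%:~R)| `^ t)%:E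
   <= (C * `|x - y| `^ b)%:E)%E].
Proof.
move=> /andP[b0 bt]; have t0 : 0 < t by lra.
have B1 : 1 < 2 :> R by rewrite ltr1n.
have [|C C0 CP] := @scale_sum R 2 b 0 t B1; first by rewrite b0.
have [|c c0 cP] := @wave_lower R 1; first by lra.
pose K : R := 2 * 2 `^ t; have K0 : 0 <= K by rewrite mulr_ge0 ?powR_ge0.
have K1 : 0 < K by rewrite mulr_gt0 ?powR_gt0.
exists (2 `^ (- b) * c `^ t), (K * C); split; first by rewrite mulr_gt0 ?powR_gt0.
  by rewrite mulr_gt0.
move=> x y; have [xy|xy] := eqVneq x y.
  have z : `|x - y| `^ b = 0 by rewrite xy subrr normr0 powR0 // gt_eqF.
  have -> : (\esum_(k in [set: int]) (2 `^ (k%:~R * b) * \sum_(h : bool) `|wave h (x / 2 `^ k%:~R) - wave h (y / 2 `^ k%:~R)| `^ t)%:E = 0)%E.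
    apply: esum1 => k _; rewrite xy big1 ?mulr0 // => h _.
    by rewrite subrr normr0 powR0 // gt_eqF.
  by rewrite z !mulr0.
have s0 : 0 < `|x - y| by rewrite normr_gt0 subr_eq0.
pose phi (k : int) := \sum_(h : bool) `|wave h (x / 2 `^ k%:~R) - wave h (y / 2 `^ k%:~R)| `^ t.
have phi0 k : 0 <= phi k by apply: sumr_ge0 => h _; exact: powR_ge0.
have uE (k : int) : `|x / 2 `^ k%:~R - y / 2 `^ k%:~R| = `|x - y| / 2 `^ k%:~R.
  by rewrite -mulrBl normrM (ger0_norm (x := (2 `^ k%:~R)^-1)) // invr_ge0 powR_ge0.
split.
- have [m /andP[m1 m2]] := scale_ex B1 s0.
  have pm : 0 < 2 `^ m%:~R :> R by rewrite powR_gt0.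
  apply: le_trans (esum_ge1 m _); last by move=> k; rewrite lee_fin mulr_ge0 ?powR_ge0 //; exact: phi0.
  have [|h hP] := cP (x / 2 `^ m%:~R) (y / 2 `^ m%:~R).
    rewrite uE ler_pdivlMr // mul1r m1 /= ler_pdivrMr //; move: m2.
    by rewrite intrD powRD ?pnatr_eq0 ?implybT // powRr1 // mulrC => /ltW.
  rewrite lee_fin mulrAC; apply: ler_pM; rewrite ?mulr_ge0 ?powR_ge0 //.
    rewrite mulrC powRN ler_pdivrMr ?powR_gt0 // powRrM -powRM ?powR_ge0 //.
    apply: ge0_ler_powR; rewrite ?nnegrE ?mulr_ge0 ?powR_ge0 ?(ltW b0) //.
    by move: m2; rewrite intrD powRD ?pnatr_eq0 ?implybT // powRr1 // => /ltW.
  rewrite (bigD1 h) //=; apply: ler_wpDr; first by apply: sumr_ge0 => i _; exact: powR_ge0.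
  by apply: ge0_ler_powR; rewrite ?nnegrE ?(ltW t0) ?(ltW c0).
- apply: (CP `|x - y| K phi s0 K0 phi0) => k.
  + rewrite /phi big_bool /K -mulrA; apply: (@le_trans _ _ (2 * (`|x - y| / 2 `^ k%:~R) `^ t)).
      rewrite [leRHS](_ : _ = (`|x - y| / 2 `^ k%:~R) `^ t + (`|x - y| / 2 `^ k%:~R) `^ t); last by ring.
      by apply: lerD; apply: ge0_ler_powR; rewrite ?nnegrE ?(ltW t0) ?divr_ge0 ?powR_ge0 // -uE wave_lip.
    have h2 : 1 <= 2 `^ t :> R.
      by rewrite -[leLHS](powRr0 2); apply: ler_powR; [rewrite ler1n|exact: ltW].
    by rewrite ler_pM2l // ler_peMl ?powR_ge0.
  + rewrite powRr0 mulr1 /phi big_bool /K [leRHS](_ : _ = 2 `^ t + 2 `^ t); last by ring.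
    by apply: lerD; apply: ge0_ler_powR; rewrite ?nnegrE ?(ltW t0) // wave_bound.
Qed.

End snowflake.

Section enflo_squares.
Context {R : realType} (T : finType).
Local Notation cube := {ffun T -> bool}.

Definition flip (j : T) (e : cube) : cube := [ffun i => (i == j) (+) e i].

Lemma flipK j : involutive (flip j).
Proof. by move=> e; apply/ffunP => i; rewrite !ffunE addbA addbb. Qed.

Definition flips (s : seq T) (e : cube) : cube := foldr flip e s.

Lemma flip_comm i j e : flip i (flip j e) = flip j (flip i e).
Proof. by apply/ffunP => k; rewrite !ffunE addbCA. Qed.

Lemma flip_flips j s e : flip j (flips s e) = flips s (flip j e).
Proof. by elim: s => //= i s IH; rewrite flip_comm IH. Qed.

Lemma flips_inj s : injective (flips s).
Proof. by elim: s => [//|j s IH] e f /= /(inv_inj (flipK j))/IH. Qed.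

Lemma enflo_squares (U : cube -> R) (s : seq T) :
  \sum_e (U e - U (flips s e)) ^+ 2 <= \sum_(j <- s) \sum_e (U e - U (flip j e)) ^+ 2.
Proof.
elim: s => [|j s IH]; first by rewrite big_nil big1 // => e _; rewrite subrr expr0n.
rewrite big_cons /=.
pose A e := U e; pose B e := U (flip j e); pose C e := U (flips s e); pose D e := U (flip j (flips s e)).
have e1 : \sum_e (B e - C e) ^+ 2 = \sum_e (A e - D e) ^+ 2.
  rewrite (reindex_inj (inv_inj (flipK j))) /=; apply: eq_bigr => e _.
  by rewrite /A /B /C /D flipK flip_flips.
have e2 : \sum_e (C e - D e) ^+ 2 = \sum_e (A e - B e) ^+ 2.
  by rewrite [RHS](reindex_inj (@flips_inj s)).
have e3 : \sum_e (B e - D e) ^+ 2 = \sum_e (A e - C e) ^+ 2.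
  rewrite [RHS](reindex_inj (inv_inj (flipK j))) /=; apply: eq_bigr => e _.
  by rewrite /A /B /C /D flip_flips.
have : \sum_e (A e - D e) ^+ 2 + \sum_e (B e - C e) ^+ 2 <=
   \sum_e (A e - B e) ^+ 2 + \sum_e (C e - D e) ^+ 2 + \sum_e (A e - C e) ^+ 2 + \sum_e (B e - D e) ^+ 2.
  rewrite -!big_split /=; apply: ler_sum => e _; have := sqr_ge0 (A e + D e - B e - C e).
  by move: (A e) (B e) (C e) (D e) => a b c d; nra.
rewrite e1 e2 e3 => h; apply: le_trans (lerD (lexx _) IH).
rewrite /A /B /C /D in h; lra.
Qed.

Definition antipode (e : cube) : cube := [ffun i => ~~ e i].

Lemma flips_enum e : flips (enum T) e = antipode e.
Proof.
have H s i : uniq s -> flips s e i = (i \in s) (+) e i.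
  elim: s => [//|j s IH] /= /andP[js us]; rewrite ffunE IH // inE.
  by case: eqP => [->|_] //=; rewrite (negbTE js).
by apply/ffunP => i; rewrite H ?enum_uniq // mem_enum ffunE.
Qed.

Lemma enflo_antipode (U : cube -> R) :
  \sum_e (U e - U (antipode e)) ^+ 2 <= \sum_j \sum_e (U e - U (flip j e)) ^+ 2.
Proof.
have := enflo_squares U (enum T); under eq_bigr do rewrite flips_enum.
by move=> h; apply: le_trans h _; rewrite big_enum.
Qed.

End enflo_squares.

Section enflo.
Context {R : realType}.

Lemma enflo_real (s : R) : 1 <= s <= 2 -> exists2 K : R, 0 < K &
  forall (T : finType) (U : {ffun T -> bool} -> R),
    \sum_e `|U e - U (antipode e)| `^ s <= K * \sum_j \sum_e `|U e - U (flip j e)| `^ s.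
Proof.
move=> /andP[s1]; rewrite le_eqVlt => /orP[/eqP ->|s2].
  have sq (x : R) : `|x| `^ 2 = x ^+ 2 by rewrite powR_mulrn // real_normK ?num_real.
  exists 1 => // T U; rewrite mul1r; under eq_bigr do rewrite sq.
  by under [leRHS]eq_bigr do under eq_bigr do rewrite sq; exact: enflo_antipode.
have [|c [C [c0 C0 cC]]] := @wave_snowflake R s 2; first by rewrite s2 andbT (lt_le_trans _ s1).
exists (C / c); first by rewrite divr_gt0.
move=> T U; rewrite mulrAC ler_pdivlMr // mulrC -lee_fin.
pose Z (k : int) (h : bool) (x : R) := wave h (x / 2 `^ k%:~R).
pose S x y := (\esum_(k in [set: int]) (2 `^ (k%:~R * s) * \sum_(h : bool) `|Z k h x - Z k h y| `^ 2)%:E)%E.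
have S0 k x y : (0 <= (2 `^ (k%:~R * s) * \sum_(h : bool) `|Z k h x - Z k h y| `^ 2)%:E)%E.
  by rewrite lee_fin mulr_ge0 ?powR_ge0 // sumr_ge0 // => h _; exact: powR_ge0.
apply: (@le_trans _ _ (\sum_e S (U e) (U (antipode e)))%E).
  by rewrite mulr_sumr -sumEFin; apply: lee_sum => e _; have [] := cC (U e) (U (antipode e)).
apply: (@le_trans _ _ (\sum_j \sum_e S (U e) (U (flip j e)))%E); last first.
  rewrite mulr_sumr -sumEFin; apply: lee_sum => j _; rewrite mulr_sumr -sumEFin; apply: lee_sum => e _.
  by have [] := cC (U e) (U (flip j e)).
rewrite /S -esum_sum; last by move=> k e _ _; exact: S0.
rewrite [leRHS](eq_bigr (fun j => \esum_(k in [set: int]) \sum_e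
    (2 `^ (k%:~R * s) * \sum_(h : bool) `|Z k h (U e) - Z k h (U (flip j e))| `^ 2)%:E)%E); last first.
  by move=> j _; rewrite esum_sum // => k e _ _; exact: S0.
rewrite -esum_sum; last by move=> k e _ _; apply: sume_ge0 => ? _; exact: S0.
apply: le_esum => k _; rewrite !sumEFin; under [leRHS]eq_bigr do rewrite sumEFin.
rewrite sumEFin lee_fin -mulr_sumr; under [leRHS]eq_bigr do rewrite -mulr_sumr.
rewrite -mulr_sumr; apply: ler_wpM2l; first exact: powR_ge0.
under [leRHS]eq_bigr do rewrite exchange_big.
rewrite exchange_big /= [leRHS]exchange_big /=; apply: ler_sum => h _.
have sq (x : R) : `|x| `^ 2 = x ^+ 2 by rewrite powR_mulrn // real_normK ?num_real.
under eq_bigr do rewrite sq.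
under [leRHS]eq_bigr do under eq_bigr do rewrite sq.
exact: (enflo_antipode (fun e => Z k h (U e))).
Qed.

Lemma L01_sum_dist (s : R) (s1 : 1 <= s) (I : finType) (f g : I -> L01 s1) :
  (\sum_i `|f i - g i| `^ s)%:E = (\int[lebesgue01 R]_x (\sum_i `|fn (f i) x - fn (g i) x| `^ s)%:E)%E.
Proof.
under [RHS]eq_integral do rewrite -sumEFin.
rewrite ge0_integral_sum //.
- by rewrite -sumEFin; apply: eq_bigr => i _; exact: L01_distE.
- by move=> i; apply: measurable_powR_dist; exact: fn_measurable.
Qed.

Lemma enflo_L01 (s : R) (s1 : 1 <= s) : s <= 2 -> exists2 K : R, 0 < K &
  forall (T : finType) (U : {ffun T -> bool} -> L01 s1),
    \sum_e `|U e - U (antipode e)| `^ s <= K * \sum_j \sum_e `|U e - U (flip j e)| `^ s.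
Proof.
move=> s2; have [|K K0 KP] := @enflo_real s; first by rewrite s1.
exists K => // T U.
rewrite -lee_fin L01_sum_dist pair_big /= EFinM.
rewrite (L01_sum_dist (fun k : T * {ffun T -> bool} => U k.2) (fun k => U (flip k.1 k.2))).
have mS (I : finType) (f g : I -> L01 s1) : measurable_fun setT (fun x => (\sum_i `|fn (f i) x - fn (g i) x| `^ s)%:E).
  apply/measurable_EFinP; apply: measurable_sum => i; apply/measurable_EFinP.
  by apply: measurable_powR_dist; exact: fn_measurable.
rewrite -ge0_integralZl_EFin //; first last.
- exact: ltW.
- by move=> x _; rewrite lee_fin sumr_ge0 // => i _; exact: powR_ge0.
apply: ge0_le_integral => //.
- by move=> x _; rewrite lee_fin sumr_ge0 // => i _; exact: powR_ge0.
- by apply: measurable_funeM; exact: mS.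
- move=> x _; rewrite -EFinM lee_fin; have := KP T (fun e => fn (U e) x).
  by rewrite pair_big.
Qed.

End enflo.

Section mazur.
Context {R : realType} (V : normedModType R) (t : R).
Hypothesis t1 : 1 <= t.

Definition mazur (u : V) : V := `|u| `^ (t - 1) *: u.

Let t0 : 0 < t. Proof. exact: lt_le_trans t1. Qed.

Let t10 : 0 <= t - 1. Proof. by rewrite subr_ge0. Qed.

Let split_powR (x : R) : 0 <= x -> x `^ t = x `^ (t - 1) * x.
Proof.
move=> x0; have [->|xn] := eqVneq x 0; first by rewrite mulr0 powR0 ?gt_eqF.
by rewrite -{3}(powRr1 x0) -powRD ?subrK // xn implybT.
Qed.

Lemma mazur_norm u : `|mazur u| = `|u| `^ t.
Proof. by rewrite normrZ ger0_norm ?powR_ge0 // split_powR. Qed.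

Let powR_sub_le (a b : R) (n : nat) : t <= n%:R -> 0 <= b <= a ->
  a `^ t - b `^ t <= n%:R * a `^ (t - 1) * (a - b).
Proof.
move=> tn /andP[b0 ba]; have [a0|a0] := eqVneq a 0.
  have -> : b = 0 by apply/eqP; rewrite eq_le b0 andbT -a0.
  by rewrite a0 !subrr mulr0.
have ap : 0 < a by rewrite lt_def a0 (le_trans b0).
have xa : 0 <= b / a <= 1 by rewrite divr_ge0 ?(ltW ap) //= ler_pdivrMr // mul1r.
have -> : b = (b / a) * a by rewrite divfK.
move: xa; move: (b / a) => x /andP[x0 x1].
have bern : 1 - n%:R * (1 - x) <= x ^+ n.
  elim: (n) => [|m IH]; first by rewrite mul0r subr0 expr0.
  rewrite exprS -natr1; have : x * (1 - m%:R * (1 - x)) <= x * x ^+ m by apply: ler_wpM2l.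
  have : 0 <= m%:R * (1 - x) * (1 - x) by rewrite !mulr_ge0 // subr_ge0.
  by move: (x * x ^+ m) (m%:R : R) => X M; nra.
have xt : x ^+ n <= x `^ t.
  rewrite -powR_mulrn //; have [->|xn] := eqVneq x 0.
    by rewrite [leLHS]powR0 ?powR_ge0 // gt_eqF // (lt_le_trans t0).
  by apply: ger_powR => //; rewrite x1 andbT lt_def xn.
rewrite powRM ?(ltW ap) // (split_powR (ltW ap)).
have A0 : 0 <= a `^ (t - 1) * a by rewrite mulr_ge0 ?powR_ge0 ?(ltW ap).
rewrite [leRHS](_ : _ = n%:R * (1 - x) * (a `^ (t - 1) * a)); last by ring.
rewrite -[X in X - _]mul1r -mulrBl; apply: ler_wpM2r => //; lra.
Qed.

Let powR_superadd (a b : R) : 0 <= b <= a -> (a - b) `^ t <= a `^ t - b `^ t.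
Proof.
move=> /andP[b0 ba]; have ab0 : 0 <= a - b by rewrite subr_ge0.
have a0 : 0 <= a by exact: le_trans ba.
have h (x : R) : 0 <= x -> x <= a -> x `^ t <= a `^ (t - 1) * x.
  move=> x0 xa; rewrite split_powR //; apply: ler_wpM2r => //; exact: ge0_ler_powR.
rewrite lerBrDr; apply: le_trans (lerD (h _ ab0 _) (h _ b0 ba)) _; first by rewrite gerBl.
by rewrite -mulrDr subrK -split_powR.
Qed.

Lemma mazur_upper : exists2 C : R, 0 < C & forall u v : V,
  `|mazur u - mazur v| <= C * (Num.max `|u| `|v|) `^ (t - 1) * `|u - v|.
Proof.
pose n := (Num.truncn t).+1; have tn : t <= n%:R by apply/ltW; exact: truncnS_gt.
exists (1 + n%:R) => [|u v]; first by rewrite ltr_wpDr.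
wlog uv : u v / `|v| <= `|u|.
  move=> H; case: (leP `|v| `|u|) => [|/ltW] h; first by have := H u v h; rewrite max_l.
  by have := H v u h; rewrite max_l // distrC (distrC v).
rewrite max_l //.
have -> : mazur u - mazur v = `|u| `^ (t - 1) *: (u - v) + (`|u| `^ (t - 1) - `|v| `^ (t - 1)) *: v.
  by rewrite /mazur scalerBr scalerBl addrA subrK.
apply: le_trans (ler_normD _ _) _; rewrite !normrZ ger0_norm ?powR_ge0 // -mulrA mulrDl mul1r lerD2l.
rewrite ger0_norm; last by rewrite subr_ge0; apply: ge0_ler_powR; rewrite ?nnegrE.
rewrite mulrBl -split_powR //.
apply: (@le_trans _ _ (`|u| `^ t - `|v| `^ t)).
  by rewrite lerD2r split_powR // ler_wpM2l // powR_ge0.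
apply: le_trans (powR_sub_le tn _) _; first by rewrite normr_ge0.
by rewrite -mulrA ler_wpM2l // ler_wpM2l ?powR_ge0 // lerB_dist.
Qed.

Lemma mazur_lower : exists2 c : R, 0 < c & forall u v : V, c * `|u - v| `^ t <= `|mazur u - mazur v|.
Proof.
pose n := (Num.truncn t).+1; have tn : t <= n%:R by apply/ltW; exact: truncnS_gt.
have n0 : 0 < n%:R :> R by [].
have n1 : 1 <= n%:R :> R by rewrite ler1n.
exists ((2 * n%:R)^-1 `^ t) => [|u v]; first by rewrite powR_gt0 // invr_gt0 mulr_gt0.
wlog uv : u v / `|v| <= `|u|.
  move=> H; case: (leP `|v| `|u|) => [|/ltW] h; first exact: H.
  by have := H v u h; rewrite distrC (distrC (mazur v)).
have i0 : 0 <= (2 * n%:R)^-1 :> R by rewrite invr_ge0 mulr_ge0.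
rewrite -powRM //; set d := `|u - v|.
have d0 : 0 <= d by exact: normr_ge0.
have vp : 0 <= `|v| <= `|u| by rewrite normr_ge0.
have [h|h] := leP (n%:R * (`|u| - `|v|)) (d / 2); last first.
  apply: (@le_trans _ _ (`|u| `^ t - `|v| `^ t)); last by rewrite -!mazur_norm lerB_dist.
  apply: le_trans (powR_superadd vp); apply: ge0_ler_powR; rewrite ?nnegrE ?(ltW t0) ?mulr_ge0 //.
    by rewrite subr_ge0.
  rewrite mulrC ler_pdivrMr ?mulr_gt0 //; nra.
have du : d / 2 <= `|u| by have := ler_normB u v; rewrite -/d; lra.
apply: (@le_trans _ _ ((d / 2) `^ t)).
  apply: ge0_ler_powR; rewrite ?nnegrE ?(ltW t0) ?mulr_ge0 // ?divr_ge0 //.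
  by rewrite mulrC ler_wpM2l // lef_pV2 ?posrE ?mulr_gt0 // ler_peMr.
have -> : mazur u - mazur v = `|u| `^ (t - 1) *: (u - v) + (`|u| `^ (t - 1) - `|v| `^ (t - 1)) *: v.
  by rewrite /mazur scalerBr scalerBl addrA subrK.
have e1 : `| `|u| `^ (t - 1) *: (u - v)| = `|u| `^ (t - 1) * d by rewrite normrZ ger0_norm ?powR_ge0.
have e2 : `|(`|u| `^ (t - 1) - `|v| `^ (t - 1)) *: v| <= `|u| `^ (t - 1) * (d / 2).
  rewrite normrZ ger0_norm; last by rewrite subr_ge0; apply: ge0_ler_powR; rewrite ?nnegrE.
  rewrite mulrBl -split_powR //.
  apply: (@le_trans _ _ (`|u| `^ t - `|v| `^ t)).
    by rewrite lerD2r split_powR // ler_wpM2l // powR_ge0.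
  apply: le_trans (powR_sub_le tn vp) _.
  by rewrite -mulrA mulrCA ler_wpM2l // powR_ge0.
apply: (@le_trans _ _ (`|u| `^ (t - 1) * (d / 2))).
  rewrite split_powR ?divr_ge0 //; apply: ler_wpM2r; first by rewrite divr_ge0.
  by apply: ge0_ler_powR; rewrite ?nnegrE ?divr_ge0.
have := lerB_normD (`|u| `^ (t - 1) *: (u - v)) ((`|u| `^ (t - 1) - `|v| `^ (t - 1)) *: v).
rewrite e1; apply: le_trans; rewrite lerBrDr -lerBrDl; apply: le_trans e2 _.
by rewrite -mulrBr; apply: ler_wpM2l; [exact: powR_ge0|lra].
Qed.

End mazur.

(** * Necessity *)

Lemma powR_pred (R : realType) (x a : R) : 0 < x -> x `^ a = x `^ (a - 1) * x.
Proof.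
move=> x0; transitivity (x `^ (a - 1) * x `^ 1); last by rewrite powRr1 // ltW.
by rewrite -powRD ?subrK // (gt_eqF x0) implybT.
Qed.

Lemma powR_le1 (R : realType) (x a : R) : 0 <= x <= 1 -> 0 <= a -> x `^ a <= 1.
Proof.
move=> /andP[x0 x1] a0; have -> : 1 = 1 `^ a :> R by rewrite powR1.
by apply: ge0_ler_powR; rewrite ?nnegrE.
Qed.

Lemma powR_invl (R : realType) (x a : R) : 0 <= x -> x^-1 `^ a = x `^ (- a).
Proof. by move=> x0; rewrite -powR_inv1 // -powRrM mulN1r. Qed.

Lemma power_mean (R : realType) (q : R) (I : finType) (x : I -> R) : 1 <= q -> (forall i, 0 <= x i) ->
  (\sum_i x i) `^ q <= #|I|%:R `^ (q - 1) * \sum_i x i `^ q.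
Proof.
rewrite le_eqVlt => /orP[/eqP <-|q1] x0.
  rewrite subrr powRr0 mul1r powRr1 ?sumr_ge0 //; apply: ler_sum => i _; by rewrite powRr1.
have q0 : 0 < q by rewrite (lt_trans _ q1).
have [->|nz] := eqVneq (\sum_i x i) 0.
  by rewrite powR0 ?gt_eqF // mulr_ge0 ?powR_ge0 // sumr_ge0 // => i _; exact: powR_ge0.
have S0 : 0 <= \sum_i x i by exact: sumr_ge0.
have Sp : 0 < \sum_i x i by rewrite lt_def nz.
have N0 : 0 < #|I|%:R :> R.
  rewrite ltr0n lt0n; apply: contraNneq nz => /card0_eq I0; apply/eqP/big1 => i _.
  by have := I0 i.
set N : R := #|I|%:R in N0 *; set S := \sum_i x i in S0 Sp nz *.
pose m := S / N; have m0 : 0 < m by rewrite divr_gt0.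
have tangent (y : R) : 0 <= y -> q * (y * m `^ (q - 1)) <= y `^ q + (q - 1) * m `^ q.
  move=> y0; have q'0 : 0 < q / (q - 1) by rewrite divr_gt0 // subr_gt0.
  have h1 : q^-1 + (q / (q - 1))^-1 = 1 by rewrite invf_div; field; rewrite ?subr_eq0 ?gt_eqF //.
  have := @conjugate_powR R y (m `^ (q - 1)) q (q / (q - 1)) y0 (powR_ge0 _ _) q0 q'0 h1.
  rewrite -powRrM mulrCA divff ?subr_eq0 ?gt_eqF // mulr1.
  move=> h; have := ler_wpM2l (ltW q0) h.
  rewrite [leRHS](_ : _ = y `^ q + (q - 1) * m `^ q) //.
  by field; rewrite subr_eq0 !gt_eqF.
have : \sum_i q * (x i * m `^ (q - 1)) <= \sum_i (x i `^ q + (q - 1) * m `^ q).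
  by apply: ler_sum => i _; exact: tangent.
rewrite -mulr_sumr -mulr_suml big_split /= sumr_const -/S -mulr_natr -/N.
have mq : m `^ q = m * m `^ (q - 1).
  by rewrite mulrC; exact: powR_pred.
have SE : S = m * N by rewrite /m divfK ?gt_eqF.
have -> : q * (S * m `^ (q - 1)) = q * m `^ q * N by rewrite mq SE; ring.
rewrite SE powRM ?(ltW m0) ?(ltW N0) // => h.
have h2 : m `^ q * N <= \sum_i x i `^ q by move: h; move: (\sum_i _) => Z; move: (m `^ q) => M h; nra.
by rewrite (powR_pred _ N0) mulrCA; apply: ler_wpM2l => //; exact: powR_ge0.
Qed.

Lemma pow2_decay (R : realType) (K t : R) (i0 : nat) : 0 < t ->
  (forall i, (i0 <= i)%N -> 1 <= K * (2 ^+ i) `^ (- t)) -> False.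
Proof.
move=> t0 h; have z1 : `|2 `^ (- t) : R| < 1.
  by rewrite ger0_norm ?powR_ge0 // -[ltRHS](powRr0 2); apply: ltr_powR1; rewrite ?ltr1n // oppr_lt0.
have zE i : (2 ^+ i) `^ (- t) = (2 `^ (- t)) ^+ i :> R.
  by elim: i => [|i IH]; rewrite ?expr0 ?powR1 // !exprS powRM // IH.
have : (fun i => K * (2 `^ (- t)) ^+ i) @ \oo --> K * 0.
  by apply: cvgM; [exact: cvg_cst|exact: cvg_expr].
rewrite mulr0 => /cvgrPdist_lt /(_ 1 ltr01) [j _ jP].
have := jP (maxn i0 j) (leq_maxr _ _); have := h (maxn i0 j) (leq_maxl _ _).
rewrite zE sub0r normrN => h1; rewrite ger0_norm; last exact: le_trans h1.
by move=> h2; have := le_lt_trans h1 h2; rewrite ltxx.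
Qed.

Section negative.
Context {R : realType} (r s p q : R) (r1 : 1 <= r) (s1 : 1 <= s) (p1 : 1 <= p) (q1 : 1 <= q).
Hypothesis red : borel_reducible (E_rel (L01 r1) p) (E_rel (L01 s1) q).

Lemma reduction_embeddings (T : nat -> finType) (v : forall i, T i -> L01 r1) (a0 : forall i, T i) :
  (forall i (a b : T i), a != b -> 0 < `|v i a - v i b| `^ p <= (2 ^+ i)^-1) ->
  exists C i0, 0 < C /\ forall i, (i0 <= i)%N -> exists m n (U : T i -> nat -> L01 s1), forall a b,
    `|v i a - v i b| `^ p <= C * \sum_(m <= k < n) `|U a k - U b k| `^ q /\
    \sum_(m <= k < n) `|U a k - U b k| `^ q <= C * `|v i a - v i b| `^ p.
Proof.
move=> vb; have [theta tb tr] := red.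
pose d i : L01 s1 := if unpickle i is Some c then step s1 c else 0.
apply: (@reduction_embeddings_aux R (L01 r1) (L01 s1) p q d p1 q1 _ T v a0 vb theta tb tr).
move=> y e e0; have [c cP] := step_dense y e0.
by exists (pickle c); rewrite /d pickleK.
Qed.

Let p0 : 0 < p. Proof. exact: lt_le_trans p1. Qed.
Let q0 : 0 < q. Proof. exact: lt_le_trans q1. Qed.
Let r0 : 0 < r. Proof. exact: lt_le_trans r1. Qed.
Let s0 : 0 < s. Proof. exact: lt_le_trans s1. Qed.


Lemma cube_embedding (mu : R) i : 0 <= mu -> exists v : {ffun {ffun 'I_i -> bool} -> bool} -> L01 r1,
  forall A B, `|v A - v B| `^ r = mu `^ r * ((\sum_w (A w != B w)%:R) / 2 ^+ i).
Proof.
move=> mu0; have mF (A : {ffun {ffun 'I_i -> bool} -> bool}) :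
    measurable_fun setT (fun x : measurableTypeR R => mu * (A (pre i (digs x)))%:R).
  exact: (measurable_cylinder (fun w => mu * (A w)%:R)).
have ex (A : {ffun {ffun 'I_i -> bool} -> bool}) : exists f : L01 r1,
    {ae lebesgue01 R, forall x : measurableTypeR R, fn f x = mu * (A (pre i (digs x)))%:R}.
  apply: L01_mk => //; apply: (@finite_mu01 R _ mu r (ltW r0)) => // x.
  by rewrite normrM ger0_norm // ger0_norm // ler_piMr // lern1; case: (A _).
exists (fun A => projT1 (cid (ex A))) => A B; apply: EFin_inj.
rewrite (L01_dist_aeE (mF A) (mF B) (projT2 (cid (ex A))) (projT2 (cid (ex B)))).
pose G (w : {ffun 'I_i -> bool}) : R := mu `^ r * (A w != B w)%:R.
rewrite (eq_integral (fun x : measurableTypeR R => (G (pre i (digs x)))%:E)); last first.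
  move=> x _; congr EFin; rewrite /G -mulrBr normrM (ger0_norm mu0) powRM //; congr (_ * _).
  case: (A _); case: (B _); rewrite /= ?subrr ?subr0 ?sub0r ?normrN ?normr0 ?normr1 ?powR1 //;
  by rewrite powR0 // gt_eqF.
rewrite digs_law; last by move=> w; rewrite /G mulr_ge0 ?powR_ge0.
by rewrite /G -mulr_sumr mulrA.
Qed.

Lemma cube_family : exists v : forall i, {ffun {ffun 'I_i -> bool} -> bool} -> L01 r1,
  forall i A B, `|v i A - v i B| `^ p = (2 ^+ i)^-1 * ((\sum_w (A w != B w)%:R) / 2 ^+ i) `^ (p / r).
Proof.
have H : forall i, exists v : {ffun {ffun 'I_i -> bool} -> bool} -> L01 r1,
    forall A B, `|v A - v B| `^ p = (2 ^+ i)^-1 * ((\sum_w (A w != B w)%:R) / 2 ^+ i) `^ (p / r).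
  move=> i; have [v vP] := @cube_embedding ((2 ^+ i)^-1 `^ p^-1) i (powR_ge0 _ _).
  exists v => A B; have e : p = r * (p / r) by rewrite mulrCA divff ?mulr1 ?gt_eqF.
  rewrite [in LHS]e powRrM vP powRM ?powR_ge0 ?divr_ge0 ?sumr_ge0 //.
  by rewrite -!powRrM -e mulVf ?gt_eqF // powRr1 // invr_ge0.
by exists (fun i => projT1 (cid (H i))) => i; exact: projT2 (cid (H i)).
Qed.

Lemma reduction_le : p <= q.
Proof.
rewrite leNgt; apply/negP => qp.
have [w w0] : exists w : L01 r1, 0 < `|w|.
  have [v vP] := @cube_embedding 1 0 ler01; pose A : {ffun {ffun 'I_0 -> bool} -> bool} := [ffun=> true].
  pose B : {ffun {ffun 'I_0 -> bool} -> bool} := [ffun=> false].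
  exists (v A - v B); rewrite lt_def normr_ge0 andbT; apply/eqP => h.
  have := vP A B; rewrite h powR0 ?gt_eqF // powR1 mul1r expr0 divr1 => /eqP.
  rewrite eq_sym (eq_bigr (fun=> 1)) => [|u _]; last by rewrite !ffunE.
  by rewrite sumr_const pnatr_eq0 card_ffun card_ord expn0.
pose mu i : R := (2 ^+ i)^-1 `^ p^-1.
pose v i (k : 'I_(2 ^ i).+1) : L01 r1 := (mu i * (k%:R / 2 ^+ i) / `|w|) *: w.
have vE i a b : `|v i a - v i b| `^ p = (2 ^+ i)^-1 * (`|a%:R - b%:R| / 2 ^+ i) `^ p.
  rewrite /v -scalerBl normrZ -mulrBl normrM -mulrA normrV ?unitfE ?gt_eqF // normr_id mulVf ?gt_eqF // mulr1.
  rewrite -mulrBr -mulrBl !normrM (ger0_norm (powR_ge0 _ _)) powRM ?powR_ge0 ?mulr_ge0 //.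
  by rewrite -powRrM mulVf ?gt_eqF // powRr1 ?invr_ge0 // normfV (ger0_norm (x := 2 ^+ i)).
have dist_le i (a b : 'I_(2 ^ i).+1) : `|a%:R - b%:R : R| <= 2 ^+ i.
  have h (c : 'I_(2 ^ i).+1) : 0 <= (c%:R : R) <= 2 ^+ i.
    by rewrite ler0n /= -natrX ler_nat -ltnS.
  by rewrite ler_norml; have := h a; have := h b; lra.
have vb i (a b : 'I_(2 ^ i).+1) : a != b -> 0 < `|v i a - v i b| `^ p <= (2 ^+ i)^-1.
  move=> ab; rewrite vE; apply/andP; split.
    rewrite mulr_gt0 ?invr_gt0 ?exprn_gt0 // powR_gt0 // divr_gt0 ?exprn_gt0 //.
    by rewrite normr_gt0 subr_eq0 eqr_nat.
  rewrite ler_piMr // powR_le1 ?(ltW p0) // divr_ge0 //=.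
  by rewrite ler_pdivrMr ?exprn_gt0 // mul1r.
have [C [i0 [C0 CP]]] := reduction_embeddings (fun=> ord0) vb.
apply: (@pow2_decay R (C * C) (p - q) i0); first by rewrite subr_gt0.
move=> i /CP[m [n [U UP]]].
set N : R := 2 ^+ i; have N0 : 0 < N by rewrite exprn_gt0.
pose x (j : nat) k : L01 s1 := U (inord j) k.
have tele k : `|x (2 ^ i)%N k - x 0%N k| <= \sum_(j < 2 ^ i) `|x j.+1 k - x j k|.
  elim: (2 ^ i)%N => [|l IH]; first by rewrite big_ord0 subrr normr0.
  rewrite big_ord_recr /=; apply: le_trans (ler_distD (x l k) _ _) _.
  by rewrite addrC; apply: lerD.
have pm k : `|x (2 ^ i)%N k - x 0%N k| `^ q <= N `^ (q - 1) * \sum_(j < 2 ^ i) `|x j.+1 k - x j k| `^ q.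
  apply: (@le_trans _ _ ((\sum_(j < 2 ^ i) `|x j.+1 k - x j k|) `^ q)).
    by apply: ge0_ler_powR; rewrite ?nnegrE ?(ltW q0) ?sumr_ge0.
  by have := @power_mean R q 'I_(2 ^ i) (fun j => `|x j.+1 k - x j k|) q1 (fun=> normr_ge0 _); rewrite card_ord natrX.
have step_le (j : 'I_(2 ^ i)) : \sum_(m <= k < n) `|x j.+1 k - x j k| `^ q <= C * (N^-1 * (N^-1) `^ p).
  have [_] := UP (inord j.+1) (inord j); rewrite vE !inordK ?ltnS // ?(ltnW (ltn_ord j)) //.
  have -> : j.+1%:R - j%:R = 1 :> R by rewrite -natr1 addrC addKr.
  by rewrite normr1 div1r.
have [h _] := UP (inord (2 ^ i)) (inord 0).
have : N^-1 <= C * (N `^ (q - 1) * (N * (C * (N^-1 * N^-1 `^ p)))).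
  have -> : N^-1 = `|v i (inord (2 ^ i)) - v i (inord 0)| `^ p.
    rewrite vE !inordK // subr0 ger0_norm // natrX divff ?gt_eqF // powR1 mulr1 //.
  apply: le_trans h _; rewrite ler_pM2l //.
  apply: (@le_trans _ _ (\sum_(m <= k < n) N `^ (q - 1) * \sum_(j < 2 ^ i) `|x j.+1 k - x j k| `^ q)).
    by apply: ler_sum => k _; exact: pm.
  rewrite -mulr_sumr ler_wpM2l ?powR_ge0 // exchange_big /=.
  have -> : `|v i (inord (2 ^ i)) - v i (inord 0)| `^ p = N^-1.
    rewrite vE !inordK // subr0 ger0_norm // natrX divff ?gt_eqF // powR1 mulr1 //.
  apply: (@le_trans _ _ (\sum_(j < 2 ^ i) (C * (N^-1 * N^-1 `^ p)))); first by apply: ler_sum.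
  by rewrite sumr_const card_ord -[leLHS]mulr_natl natrX.
have Np : N^-1 `^ p = N `^ (- p) by exact/powR_invl/ltW.
have -> : N `^ (- (p - q)) = N `^ (q - 1) * N * N^-1 `^ p.
  by rewrite Np -(powR_pred q N0) -powRD ?(gt_eqF N0) ?implybT // opprB.
move: (N `^ (q - 1)) (N^-1 `^ p) => A B hh.
have := ler_wpM2l (ltW N0) hh; rewrite divff ?gt_eqF // => h1; apply: le_trans h1 _.
by rewrite [leRHS](_ : _ = N * (C * (A * (N * (C * (N^-1 * B)))))) //; field; rewrite gt_eqF.
Qed.

Lemma reduction_type_le : s <= 2 -> s <= q -> s / q <= r / p.
Proof.
move=> s2 sq; rewrite leNgt; apply/negP => rs.
have [v vP] := cube_family.
have [K K0 KP] := enflo_L01 s1 s2.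
pose t := q / s; have t1 : 1 <= t by rewrite ler_pdivlMr ?mul1r.
have ts : t * s = q by rewrite divfK ?gt_eqF.
have [C1 C10 up] := @mazur_upper R (L01 s1) t t1.
have [c c0 low] := @mazur_lower R (L01 s1) t t1.
have vb i (A B : {ffun {ffun 'I_i -> bool} -> bool}) : A != B -> 0 < `|v i A - v i B| `^ p <= (2 ^+ i)^-1.
  move=> AB; have S0 : 0 < \sum_w (A w != B w)%:R :> R.
    have [w Aw] : exists w, A w != B w.
      by apply/existsP; apply: contraR AB => /existsPn h; apply/eqP/ffunP => w; apply/eqP; have := h w; rewrite negbK.
    by rewrite (bigD1 w) //= Aw ltr_wpDr // sumr_ge0.
  have S1 : \sum_w (A w != B w)%:R <= 2 ^+ i :> R.
    apply: (@le_trans _ _ (\sum_(w : {ffun 'I_i -> bool}) 1)).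
      by apply: ler_sum => w _; rewrite lern1; case: (_ != _).
    by rewrite sumr_const card_ffun card_bool card_ord natrX.
  rewrite vP; apply/andP; split.
    by rewrite mulr_gt0 ?invr_gt0 ?exprn_gt0 // powR_gt0 // divr_gt0 ?exprn_gt0.
  rewrite ler_piMr // powR_le1 ?divr_ge0 ?(ltW p0) ?(ltW r0) ?(ltW S0) //=.
  by rewrite ler_pdivrMr ?exprn_gt0 // mul1r.
have [C [i0 [C0 CP]]] := reduction_embeddings (fun i => [ffun=> false]) vb.
pose th := p * s / (r * q).
have th1 : 1 < th.
  rewrite /th ltr_pdivlMr ?mulr_gt0 // mul1r.
  by move: rs; rewrite ltr_pdivrMr // mulrAC ltr_pdivlMr // (mulrC s).
apply: (@pow2_decay R (K * C1 `^ s * 3 * C * C / c `^ s) (th - 1) i0); first by rewrite subr_gt0.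
move=> i /CP[m [n [U UP]]].
set N : R := 2 ^+ i; have N0 : 0 < N by rewrite exprn_gt0.
pose cube := {ffun {ffun 'I_i -> bool} -> bool}.
pose e0 : cube := [ffun=> false].
pose W (A : cube) k := mazur t (U A k - U e0 k).
pose tau : R := N `^ (- (p / (r * q))); have tau0 : 0 < tau by rewrite powR_gt0.
have young (M d : R) : 0 <= M -> 0 <= d -> M `^ (q - s) * d `^ s <= tau `^ s * M `^ q + tau^-1 `^ (q - s) * d `^ q.
  move=> M0 d0; have qE (y : R) : y `^ q = y `^ (q - s) * y `^ s.
    by rewrite -powRD ?subrK // gt_eqF.
  have [dM|Md] := leP d (tau * M).
    apply: ler_wpDr; first by rewrite mulr_ge0 ?powR_ge0.
    rewrite qE mulrCA ler_wpM2l ?powR_ge0 // -powRM ?(ltW tau0) //.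
    by apply: ge0_ler_powR; rewrite ?nnegrE ?(ltW s0) ?mulr_ge0 ?(ltW tau0).
  apply: ler_wpDl; first by rewrite mulr_ge0 ?powR_ge0.
  rewrite qE mulrA ler_wpM2r ?powR_ge0 // -powRM ?invr_ge0 ?(ltW tau0) //.
  apply: ge0_ler_powR; rewrite ?nnegrE ?subr_ge0 ?mulr_ge0 ?invr_ge0 ?(ltW tau0) //.
  by rewrite mulrC ler_pdivlMr // mulrC ltW.
have near (A : cube) : \sum_(m <= k < n) `|U A k - U e0 k| `^ q <= C / N.
  have [_ h] := UP A e0; apply: le_trans h _; rewrite ler_pM2l //.
  have [->|/vb/andP[]//] := eqVneq A e0.
  by rewrite subrr normr0 powR0 ?gt_eqF // invr_ge0 ltW.
have tauE : tau^-1 `^ (q - s) * N^-1 `^ (p / r) = tau `^ s.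
  rewrite !powR_invl ?(ltW tau0) ?(ltW N0) // /tau -!powRrM -powRD ?(gt_eqF N0) ?implybT //.
  by congr (_ `^ _); field; rewrite !gt_eqF.
have edge (j : {ffun 'I_i -> bool}) (A : cube) :
    \sum_(m <= k < n) `|W A k - W (flip j A) k| `^ s <= C1 `^ s * (3 * C / N * tau `^ s).
  apply: (@le_trans _ _ (\sum_(m <= k < n) C1 `^ s * (tau `^ s * (`|U A k - U e0 k| `^ q + `|U (flip j A) k - U e0 k| `^ q)
      + tau^-1 `^ (q - s) * `|U A k - U (flip j A) k| `^ q))).
    apply: ler_sum => k _; have := up (U A k - U e0 k) (U (flip j A) k - U e0 k).
    rewrite opprB addrA subrK; set a := `|U A k - U e0 k|; set b := `|U (flip j A) k - U e0 k|.
    set d := `|U A k - _|; set M := Num.max a b => h.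
    have M0 : 0 <= M by rewrite le_max normr_ge0.
    apply: (@le_trans _ _ ((C1 * M `^ (t - 1) * d) `^ s)).
      apply: ge0_ler_powR; rewrite ?nnegrE ?(ltW s0) ?mulr_ge0 ?powR_ge0 ?(ltW C10) //; exact: normr_ge0.
    rewrite powRM ?mulr_ge0 ?powR_ge0 ?normr_ge0 ?(ltW C10) // powRM ?powR_ge0 ?(ltW C10) // -mulrA.
    rewrite -powRrM mulrBl ts mul1r ler_wpM2l ?powR_ge0 //.
    apply: le_trans (young M d M0 (normr_ge0 _)) _; rewrite lerD2r ler_wpM2l ?powR_ge0 //.
    rewrite /M; case: (leP a b) => _; [rewrite lerDr|rewrite lerDl]; exact: powR_ge0.
  rewrite -mulr_sumr ler_wpM2l ?powR_ge0 // big_split /= -!mulr_sumr big_split /=.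
  have [_ h] := UP A (flip j A).
  have vN : `|v i A - v i (flip j A)| `^ p = N^-1 * N^-1 `^ (p / r).
    rewrite vP -/N; congr (_ * _ `^ _); rewrite (bigD1 j) //= big1 => [|w wj].
      by rewrite ffunE eqxx addr0 -[RHS]mul1r; case: (A j).
    by rewrite ffunE (negbTE wj) eqxx.
  rewrite vN in h; have n1 := near A; have n2 := near (flip j A).
  rewrite [leRHS](_ : _ = tau `^ s * (C / N + C / N) + tau `^ s * (C / N)); last by ring.
  apply: lerD; first by apply: ler_wpM2l; [exact: powR_ge0|exact: lerD].
  rewrite -tauE; apply: le_trans (ler_wpM2l (powR_ge0 _ _) h) _.
  by rewrite le_eqVlt; apply/orP; left; apply/eqP; ring.
have diag (A : cube) : c `^ s / C / N <= \sum_(m <= k < n) `|W A k - W (antipode A) k| `^ s.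
  have [h _] := UP A (antipode A).
  have vN : `|v i A - v i (antipode A)| `^ p = N^-1.
    rewrite vP -/N (eq_bigr (fun=> 1)) => [|w _]; last by rewrite ffunE; case: (A w).
    by rewrite sumr_const card_ffun card_bool card_ord natrX divff ?gt_eqF // powR1 mulr1.
  rewrite vN in h; apply: (@le_trans _ _ (\sum_(m <= k < n) c `^ s * `|U A k - U (antipode A) k| `^ q)).
    by rewrite -mulr_sumr -mulrA ler_wpM2l ?powR_ge0 // mulrC ler_pdivrMr // mulrC.
  apply: ler_sum => k _; have := low (U A k - U e0 k) (U (antipode A) k - U e0 k).
  rewrite opprB addrA subrK -ts powRrM -powRM ?powR_ge0 ?(ltW c0) // => hk.
  by apply: ge0_ler_powR; rewrite ?nnegrE ?(ltW s0) ?mulr_ge0 ?powR_ge0 ?(ltW c0).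
pose Nc : R := #|{: cube}|%:R.
have Nc0 : 0 < Nc by rewrite ltr0n; apply/card_gt0P; exists e0.
have main : Nc * (c `^ s / C / N) <= K * (N * (Nc * (C1 `^ s * (3 * C / N * tau `^ s)))).
  apply: (@le_trans _ _ (\sum_(A : cube) \sum_(m <= k < n) `|W A k - W (antipode A) k| `^ s)).
    by rewrite /Nc [leLHS]mulr_natl -sumr_const; apply: ler_sum => A _; exact: diag.
  apply: (@le_trans _ _ (\sum_(m <= k < n) K * \sum_j \sum_A `|W A k - W (flip j A) k| `^ s)).
    rewrite exchange_big /=; apply: ler_sum => k _; exact: (KP _ (fun A => W A k)).
  rewrite -mulr_sumr ler_pM2l // exchange_big /=.
  apply: (@le_trans _ _ (\sum_(j : {ffun 'I_i -> bool}) Nc * (C1 `^ s * (3 * C / N * tau `^ s)))); last first.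
    by rewrite sumr_const card_ffun card_bool card_ord -[leLHS]mulr_natl natrX.
  apply: ler_sum => j _; rewrite exchange_big /= /Nc [leRHS]mulr_natl -sumr_const.
  by apply: ler_sum => A _; exact: edge.
have tauN : N `^ (- (th - 1)) = N * tau `^ s.
  have -> : N `^ (- (th - 1)) = N `^ (- th) * N by rewrite (powR_pred _ N0); congr (_ `^ _ * _); ring.
  by rewrite mulrC /tau -powRrM; congr (_ * _ `^ _); rewrite /th; field; rewrite !gt_eqF.
rewrite -/N tauN; have cs0 : 0 < c `^ s by rewrite powR_gt0.
move: main; move: (tau `^ s) (C1 `^ s) (c `^ s) cs0 => A B D D0 main.
have {}main : D / C / N <= K * (N * (B * (3 * C / N * A))).
  by rewrite -(ler_pM2l Nc0); apply: le_trans main _; rewrite le_eqVlt; apply/orP; left; apply/eqP; ring.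
rewrite ler_pdivrMr // ler_pdivrMr // in main.
rewrite -(ler_pM2l D0) mulr1; apply: le_trans main _.
by rewrite le_eqVlt; apply/orP; left; apply/eqP; field; rewrite !gt_eqF.
Qed.

End negative.

(** * Rademacher series *)

Section grid_products.
Variables (N m : nat).
Local Notation grid_t := {ffun 'I_N * 'I_m -> bool}.

Definition grow (w : grid_t) (n : 'I_N) : {ffun 'I_m -> bool} := [ffun j => w (n, j)].

Lemma grid_prod (S : comNzRingType) (H : 'I_N -> {ffun 'I_m -> bool} -> S) :
  \sum_(w : grid_t) \prod_n H n (grow w n) = \prod_n \sum_v H n v.
Proof.
rewrite bigA_distr_bigA /= (reindex (fun w : grid_t => [ffun n => grow w n])) /=; last first.
  exists (fun g : {ffun 'I_N -> {ffun 'I_m -> bool}} => [ffun k : 'I_N * 'I_m => g k.1 k.2]).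
    by move=> w _; apply/ffunP => -[n j]; rewrite !ffunE.
  by move=> g _; apply/ffunP => n; apply/ffunP => j; rewrite !ffunE.
by apply: eq_bigr => w _; apply: eq_bigr => n _; rewrite ffunE.
Qed.

Lemma cos_sum_grid (R : realType) (x : 'I_N -> {ffun 'I_m -> bool} -> R) :
  (forall n, \sum_v sin (x n v) = 0) ->
  \sum_(w : grid_t) cos (\sum_n x n (grow w n)) = \prod_n \sum_v cos (x n v).
Proof.
move=> x0; pose e (y : R) : R[i] := Complex (cos y) (sin y).
have e0 : e 0 = 1 by rewrite /e cos0 sin0.
have eD y z : e (y + z) = e y * e z.
  by rewrite /e cosD sinD; apply/eqP; rewrite eq_complex /= eqxx addrC eqxx.
have ReD : {morph (@complex.Re R) : y z / y + z} by move=> [a b] [c d].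
have ImD : {morph (@complex.Im R) : y z / y + z} by move=> [a b] [c d].
have sumE n : \sum_v e (x n v) = real_complex R (\sum_v cos (x n v)).
  apply/eqP; rewrite eq_complex (big_morph _ ReD (erefl _)) (big_morph _ ImD (erefl _)) /=.
  by rewrite eqxx /= x0.
have := congr1 (@complex.Re R) (@grid_prod _ (fun n v => e (x n v))).
rewrite (eq_bigr (fun n => real_complex R (\sum_v cos (x n v)))) // -rmorph_prod /= => <-.
rewrite (big_morph _ ReD (erefl _)); apply: eq_bigr => w _.
by rewrite -(big_morph _ eD e0).
Qed.

End grid_products.

Section partial_products.
Context {R : realType}.

Lemma prod_norm_le1 (I : Type) (s : seq I) (a : I -> R) : (forall i, `|a i| <= 1) -> `|\prod_(i <- s) a i| <= 1.
Proof.
move=> a1; rewrite normr_prod; elim: s => [|i s IH]; first by rewrite big_nil.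
by rewrite big_cons -[leRHS]mulr1; apply: ler_pM => //; apply: prodr_ge0.
Qed.

Lemma subr_prod_le N (a : nat -> R) : (forall n, 0 <= a n <= 2) ->
  1 - \prod_(n < N) (1 - a n) <= \sum_(n < N) a n.
Proof.
move=> a2; elim: N => [|N IH]; first by rewrite !big_ord0 subrr.
rewrite !big_ord_recr /=; have := @prod_norm_le1 _ (index_enum 'I_N) (fun n => 1 - a n).
have h i : `|1 - a i| <= 1 by have := a2 i; rewrite ler_norml; lra.
move=> /(_ h).
rewrite ler_norml; move: IH (a2 N); move: (\prod_(n < N) _) (\sum_(n < N) _) (a N) => P S y.
by move=> IH /andP[y0 _] /andP[_ P1]; nra.
Qed.

Lemma prod_subr_le N (a : nat -> R) : (forall n, 0 <= a n <= 1) ->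
  0 <= \prod_(n < N) (1 - a n) <= (1 + \sum_(n < N) a n)^-1.
Proof.
move=> a1; have S0 M : 0 <= \sum_(n < M) a n by apply: sumr_ge0 => n _; have /andP[] := a1 n.
elim: N => [|N /andP[P0 IH]]; first by rewrite !big_ord0 addr0 invr1 ler01 lexx.
rewrite !big_ord_recr /=; have /andP[y0 y1] := a1 N; have SN := S0 N.
rewrite mulr_ge0 ?subr_ge0 //=.
apply: (@le_trans _ _ ((1 + \sum_(n < N) a n)^-1 * (1 - a N))); first by rewrite ler_wpM2r // subr_ge0.
move: (\sum_(n < N) a n) SN (a N) y0 y1 => S SN y y0 y1.
rewrite -[leRHS]mul1r ler_pdivlMr; last by lra.
rewrite -mulrA mulrC ler_pdivrMr; last by lra.
by rewrite mul1r; nra.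
Qed.

End partial_products.

Section rademacher.
Context {R : realType}.
Implicit Types (f : nat -> (nat -> bool) -> R).

Definition depends_on m (g : (nat -> bool) -> R) := forall s, g s = g (lift_seq (pre m s)).

Definition tail_stream n (x : R) : nat -> bool := fun j => stream n x j.+1.

Definition rad f N (x : R) : R := \sum_(n < N) (-1) ^+ (stream n x 0%N) * f n (tail_stream n x).

Definition cos_defect m (g : (nat -> bool) -> R) (u : R) : R :=
  (\sum_(v : {ffun 'I_m -> bool}) (1 - cos (u * g (lift_seq v)))) / 2 ^+ m.

Let tl m (v : {ffun 'I_m.+1 -> bool}) : {ffun 'I_m -> bool} := restr (lift ord0) v.

Let radG f N m (w : {ffun 'I_N * 'I_m.+1 -> bool}) : R :=
  \sum_(n < N) (-1) ^+ (grow w n ord0) * f n (lift_seq (tl (grow w n))).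

Let rad_grid f N m x : (forall n, depends_on m (f n)) -> rad f N x = radG f (grid N m.+1 x).
Proof.
move=> fm; apply: eq_bigr => n _; rewrite ffunE ffunE /=; congr (_ * _).
rewrite fm; congr (f n (lift_seq _)); apply/ffunP => j; rewrite !ffunE /=.
by rewrite /tail_stream.
Qed.

Lemma measurable_rad f N m : (forall n, depends_on m (f n)) ->
  measurable_fun setT (rad f N : measurableTypeR R -> R).
Proof.
move=> fm; apply: eq_measurable_fun (@measurable_grid R N m.+1 (@radG f N m)) => x _.
by rewrite (rad_grid _ _ fm).
Qed.

Lemma cos_defect_bound m g u : 0 <= cos_defect m g u <= 2.
Proof.
rewrite /cos_defect; apply/andP; split.
  by rewrite divr_ge0 ?exprn_ge0 // sumr_ge0 // => v _; rewrite subr_ge0 cos_le1.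
rewrite ler_pdivrMr ?exprn_gt0 //; apply: (@le_trans _ _ (\sum_(v : {ffun 'I_m -> bool}) 2)).
  by apply: ler_sum => v _; have := @cos_geN1 R (u * g (lift_seq v)); lra.
by rewrite sumr_const card_ffun card_bool card_ord -[leLHS]mulr_natr natrX.
Qed.

Lemma rad_law f N m u : (forall n, depends_on m (f n)) ->
  (\int[lebesgue01 R]_x (1 - cos (u * rad f N x))%:E =
   (1 - \prod_(n < N) (1 - cos_defect m (f n) u))%:E)%E.
Proof.
move=> fm; under eq_integral => x _ do rewrite (rad_grid N x fm).
rewrite (@grid_law R N m.+1 (fun w => 1 - cos (u * @radG f N m w))); last first.
  by move=> w; rewrite subr_ge0 cos_le1.
congr EFin; pose y n (v : {ffun 'I_m.+1 -> bool}) := u * ((-1) ^+ (v ord0) * f n (lift_seq (tl v))).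
have E1 : \sum_(w : {ffun 'I_N * 'I_m.+1 -> bool}) cos (u * @radG f N m w) = \prod_(n < N) \sum_v cos (y n v).
  rewrite -(@cos_sum_grid N m.+1 R (fun n v => y n v)).
    by apply: eq_bigr => w _; rewrite /radG mulr_sumr.
  move=> n; pose fl (v : {ffun 'I_m.+1 -> bool}) : {ffun 'I_m.+1 -> bool} := [ffun j => (j == ord0) (+) v j].
  have flK : involutive fl by move=> v; apply/ffunP => j; rewrite !ffunE addbA addbb.
  have : \sum_v sin (y n v) = - \sum_v sin (y n v).
    rewrite {1}(reindex_inj (inv_inj flK)) /= -sumrN; apply: eq_bigr => v _.
    have -> : y n (fl v) = - y n v; last by rewrite sinN.
    rewrite /y ffunE eqxx /= (_ : tl (fl v) = tl v); last by apply/ffunP => j; rewrite !ffunE.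
    by case: (v ord0); rewrite /= ?expr0 ?expr1 ?mul1r ?mulN1r ?mulrN ?opprK.
  by lra.
rewrite big_split /= sumrN E1 sumr_const card_ffun card_bool card_prod !card_ord natrX.
rewrite mulrBl divff ?gt_eqF ?exprn_gt0 //; congr (1 - _).
rewrite mulnC exprM -[X in _ / _ ^+ X](card_ord N) -prodr_const -prodf_div.
apply: eq_bigr => n _; transitivity ((\sum_(t : {ffun 'I_m -> bool}) cos (u * f n (lift_seq t))) / 2 ^+ m).
  have := @sum_restr 'I_m m.+1 (lift ord0) (@lift_inj _ ord0) R (fun t => cos (u * f n (lift_seq t))).
  rewrite card_ord => <-; congr (_ / _); apply: eq_bigr => v _.
  by rewrite /y; case: (v ord0); rewrite /= ?expr0 ?expr1 ?mul1r ?mulN1r ?mulrN ?cosN.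
rewrite /cos_defect big_split /= sumrN sumr_const card_ffun card_bool card_ord natrX mulrBl.
by rewrite divff ?gt_eqF ?exprn_gt0 // opprB addrC subrK.
Qed.

End rademacher.

Section moments.
Context {R : realType}.
Local Notation RM := (measurableTypeR R).

Lemma sum_wave_sqr (x y : R) : \sum_(h : bool) `|wave h x - wave h y| `^ 2 = 2 * (1 - cos (x - y)).
Proof.
have sq (z : R) : `|z| `^ 2 = z ^+ 2 by rewrite powR_mulrn // real_normK ?num_real.
by rewrite big_bool /= !sq wave_dist2; ring.
Qed.

Lemma one_sub_cos_le (x : R) : 1 - cos x <= `|x| `^ 2.
Proof.
have := sum_wave_sqr x 0; rewrite subr0 big_bool /= => h.
have l (t : bool) : `|wave t x - wave t 0| `^ 2 <= `|x| `^ 2.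
  by apply: ge0_ler_powR; rewrite ?nnegrE //; have := wave_lip t x 0; rewrite subr0.
by have := l true; have := l false; move: h => /=; lra.
Qed.

Lemma one_sub_cos_ge0 (x : R) : 0 <= 1 - cos x.
Proof. by rewrite subr_ge0 cos_le1. Qed.

Lemma one_sub_cos_le2 (x : R) : 1 - cos x <= 2.
Proof. by have := @cos_geN1 R x; lra. Qed.

Lemma measurable_defect (Y : RM -> R) u : measurable_fun setT Y ->
  measurable_fun setT (fun x => 1 - cos (u * Y x)).
Proof.
move=> mY; apply: measurable_funB => //.
apply: (measurableT_comp (continuous_measurable_fun (@continuous_cos R))).
by apply: measurable_funM.
Qed.

(* One minus the real part of the characteristic function of [Y] at [u]. *)
Definition defect (Y : RM -> R) (u : R) : R := fine (\int[lebesgue01 R]_x (1 - cos (u * Y x))%:E)%E.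

Lemma defectE (Y : RM -> R) u : measurable_fun setT Y ->
  ((defect Y u)%:E = \int[lebesgue01 R]_x (1 - cos (u * Y x))%:E)%E /\ 0 <= defect Y u <= 2.
Proof.
move=> mY; set I := (\int[_]_x _)%E.
have I0 : (0 <= I)%E by apply: integral_ge0 => x _; rewrite lee_fin one_sub_cos_ge0.
have I2 : (I <= 2%:E)%E.
  rewrite (_ : 2%:E = \int[lebesgue01 R]_x (cst 2%:E x))%E; last first.
    by rewrite integral_cst // mu01_setT mule1.
  apply: ge0_le_integral => //.
  - by apply/measurable_EFinP; exact: measurable_defect.
  - by move=> x _; rewrite lee_fin one_sub_cos_le2.
have If : I \is a fin_num by rewrite ge0_fin_numE // (le_lt_trans I2) // ltry.
have E : ((defect Y u)%:E = I)%E by rewrite /defect fineK.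
by split => //; rewrite -!lee_fin E I0.
Qed.

Lemma integral_esum_int (F : int -> RM -> R) : (forall k, measurable_fun setT (F k)) ->
  (forall k x, 0 <= F k x) ->
  (\int[lebesgue01 R]_x (\esum_(k in [set: int]) (F k x)%:E) =
   \esum_(k in [set: int]) (\int[lebesgue01 R]_x (F k x)%:E))%E.
Proof.
move=> mF F0; rewrite (eq_integral (fun x => \sum_(0 <= j <oo) (F (Posz j) x)%:E + \sum_(0 <= j <oo) (F (Negz j) x)%:E)%E); last first.
  by move=> x _; rewrite esum_int // => k; rewrite lee_fin.
rewrite esum_int; last by move=> k; apply: integral_ge0 => x _; rewrite lee_fin.
have mE k : measurable_fun setT (fun x => (F k x)%:E) by apply/measurable_EFinP.
rewrite ge0_integralD //.
- by rewrite !integral_nneseries // => n x _; rewrite lee_fin.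
- by move=> x _; apply: nneseries_ge0 => n _ _; rewrite lee_fin.
- by apply: ge0_emeasurable_sum => // n x _ _; rewrite lee_fin.
- by move=> x _; apply: nneseries_ge0 => n _ _; rewrite lee_fin.
- by apply: ge0_emeasurable_sum => // n x _ _; rewrite lee_fin.
Qed.

Lemma moment_defect (b : R) : 0 < b < 2 -> exists c C : R, [/\ 0 < c, 0 < C &
  forall Y : RM -> R, measurable_fun setT Y ->
  (c%:E * \int[lebesgue01 R]_x (`|Y x| `^ b)%:E <=
     \esum_(k in [set: int]) (2 `^ (k%:~R * b) * (2 * defect Y (2 `^ k%:~R)^-1))%:E)%E /\
  (\esum_(k in [set: int]) (2 `^ (k%:~R * b) * (2 * defect Y (2 `^ k%:~R)^-1))%:E <=
    C%:E * \int[lebesgue01 R]_x (`|Y x| `^ b)%:E)%E].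
Proof.
move=> b2; have [c [C [c0 C0 cC]]] := wave_snowflake b2.
exists c, C; split => // Y mY.
have mb : measurable_fun setT (fun x => (`|Y x| `^ b)%:E).
  have := measurable_powR_dist b mY (@measurable_cst _ _ RM R setT 0).
  by apply: eq_measurable_fun => x _; rewrite subr0.
pose F (k : int) (x : RM) : R := 2 `^ (k%:~R * b) * (2 * (1 - cos ((2 `^ k%:~R)^-1 * Y x))).
have mF k : measurable_fun setT (F k).
  by apply: measurable_funM => //; apply: measurable_funM => //; exact: measurable_defect.
have F0 k x : 0 <= F k x by rewrite !mulr_ge0 ?powR_ge0 ?one_sub_cos_ge0.
have FE x : (\esum_(k in [set: int]) (2 `^ (k%:~R * b) * \sum_(h : bool) `|wave h (Y x / 2 `^ k%:~R) - wave h (0 / 2 `^ k%:~R)| `^ 2)%:E =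
    \esum_(k in [set: int]) (F k x)%:E)%E.
  by apply: eq_esum => k _; rewrite sum_wave_sqr mul0r subr0 /F (mulrC _ (Y x)).
have -> : (\esum_(k in [set: int]) (2 `^ (k%:~R * b) * (2 * defect Y (2 `^ k%:~R)^-1))%:E =
    \int[lebesgue01 R]_x (\esum_(k in [set: int]) (F k x)%:E))%E.
  rewrite integral_esum_int //; apply: eq_esum => k _; rewrite mulrA EFinM (defectE _ mY).1.
  rewrite -ge0_integralZl_EFin ?mulr_ge0 ?powR_ge0 //.
  - by apply: eq_integral => x _; rewrite -EFinM /F mulrA.
  - by apply/measurable_EFinP; exact: measurable_defect.
have mS : measurable_fun setT (fun x => \esum_(k in [set: int]) (F k x)%:E)%E.
  apply: (eq_measurable_fun (fun x => \sum_(0 <= j <oo) (F (Posz j) x)%:E + \sum_(0 <= j <oo) (F (Negz j) x)%:E)%E).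
    by move=> x _; rewrite esum_int // => k; rewrite lee_fin.
  have mE k : measurable_fun setT (fun x => (F k x)%:E) by apply/measurable_EFinP.
  by apply: emeasurable_funD; apply: ge0_emeasurable_sum => // n x _ _; rewrite lee_fin.
have S0 x : (0 <= \esum_(k in [set: int]) (F k x)%:E)%E by apply: esum_ge0 => k _; rewrite lee_fin.
split.
- rewrite -ge0_integralZl_EFin ?(ltW c0) //.
  apply: ge0_le_integral => //.
  + by move=> x _; rewrite mule_ge0 ?lee_fin ?powR_ge0 ?(ltW c0).
  + exact: measurable_funeM.
  + by move=> x _; have [h _] := cC (Y x) 0; rewrite FE subr0 in h.
- rewrite -ge0_integralZl_EFin ?(ltW C0) //.
  apply: ge0_le_integral => //.
  + exact: measurable_funeM.
  + by move=> x _; have [_ h] := cC (Y x) 0; rewrite FE subr0 in h.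
Qed.

Lemma moment_le (b t : R) : 0 < b < t -> b < 2 -> exists2 C : R, 0 < C &
  forall (Y : RM -> R) (K s : R), measurable_fun setT Y -> 0 <= K -> 0 <= s ->
  (forall u, 0 < u -> defect Y u <= K * (u * s) `^ t) ->
  (\int[lebesgue01 R]_x (`|Y x| `^ b)%:E <= ((K + 2) * C * s `^ b)%:E)%E.
Proof.
move=> /andP[b0 bt] b2; have [|c [C' [c0 _ cP]]] := @moment_defect b; first by rewrite b0.
have B1 : 1 < 2 :> R by rewrite ltr1n.
have [|C C0 CP] := @scale_sum R 2 b 0 t B1; first by rewrite b0.
exists (2 * C / c); first by rewrite divr_gt0 ?mulr_gt0.
move=> Y K s mY K0; have [h _] := cP Y mY.
suff H : 0 <= s -> (forall u, 0 < u -> defect Y u <= K * (u * s) `^ t) ->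
    (\esum_(k in [set: int]) (2 `^ (k%:~R * b) * (2 * defect Y (2 `^ k%:~R)^-1))%:E <= ((2 * (K + 2)) * C * s `^ b)%:E)%E.
  move=> s0 /(H s0) h2; have ci : (0 <= (c^-1)%:E)%E by rewrite lee_fin invr_ge0 ltW.
  have := lee_wpmul2l ci (le_trans h h2).
  rewrite muleA -!EFinM mulVf ?gt_eqF // mul1e.
  rewrite (_ : c^-1 * _ = (K + 2) * (2 * C / c) * s `^ b); last by ring.
  exact.
have u0 (k : int) : 0 < (2 `^ k%:~R)^-1 :> R by rewrite invr_gt0 powR_gt0.
rewrite le_eqVlt => /orP[/eqP <-|s0] Hu.
  rewrite powR0 ?gt_eqF // mulr0 esum1 // => k _; have [_ /andP[d0 _]] := defectE (2 `^ k%:~R)^-1 mY.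
  have := Hu _ (u0 k); rewrite mulr0 powR0 ?gt_eqF ?(lt_trans b0) // mulr0 => d1.
  by rewrite (_ : defect _ _ = 0) ?mulr0 ?mulr0 //; apply/eqP; rewrite eq_le d0 d1.
apply: (CP s (2 * (K + 2)) (fun k => 2 * defect Y (2 `^ k%:~R)^-1)) => // [|k|k|k].
- by rewrite mulr_ge0 ?addr_ge0.
- by have [_ /andP[h0 _]] := defectE (2 `^ k%:~R)^-1 mY; rewrite mulr_ge0.
- rewrite -mulrA ler_pM2l //; apply: le_trans (Hu _ (u0 k)) _.
  by rewrite (mulrC _ s) ler_wpM2r ?powR_ge0 // lerDl.
- rewrite powRr0 mulr1 ler_pM2l //; have [_ /andP[_ d2]] := defectE (2 `^ k%:~R)^-1 mY.
  by apply: le_trans d2 _; rewrite lerDr.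
Qed.

Lemma moment_ge (b : R) : 0 < b < 2 -> exists2 c : R, 0 < c & forall (Y : RM -> R) (k : int), measurable_fun setT Y ->
  ((c * (2 `^ k%:~R) `^ b * defect Y (2 `^ k%:~R)^-1)%:E <= \int[lebesgue01 R]_x (`|Y x| `^ b)%:E)%E.
Proof.
move=> b2; have [c' [C [_ C0 CP]]] := moment_defect b2.
exists (2 / C); first by rewrite divr_gt0.
move=> Y k mY; have [_ h] := CP Y mY.
have ci : (0 <= (C^-1)%:E)%E by rewrite lee_fin invr_ge0 ltW.
have h1 : ((2 `^ (k%:~R * b) * (2 * defect Y (2 `^ k%:~R)^-1))%:E <=
    \esum_(k in [set: int]) (2 `^ (k%:~R * b) * (2 * defect Y (2 `^ k%:~R)^-1))%:E)%E.
  apply: (esum_ge1 (F := fun k : int => (2 `^ (k%:~R * b) * (2 * defect Y (2 `^ k%:~R)^-1))%:E)) => j.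
  by rewrite lee_fin !mulr_ge0 ?powR_ge0 //; have [_ /andP[]] := defectE (2 `^ j%:~R)^-1 mY.
have := lee_wpmul2l ci (le_trans h1 h).
rewrite muleA -!EFinM mulVf ?gt_eqF // mul1e powRrM.
rewrite (_ : C^-1 * _ = 2 / C * (2 `^ k%:~R) `^ b * defect Y (2 `^ k%:~R)^-1); last by ring.
exact.
Qed.

End moments.

(** * LePage series *)

Section abs_convergence.
Context {R : realType}.
Local Notation RM := (measurableTypeR R).

Lemma ae_summable (Y : nat -> RM -> R) (b : nat -> R) : (forall k, measurable_fun setT (Y k)) ->
  (forall k, (\int[lebesgue01 R]_x (`|Y k x| `^ 1)%:E <= (b k)%:E)%E) -> (\sum_(0 <= k <oo) (b k)%:E < +oo)%E ->
  exists2 X : RM -> R, measurable_fun setT X &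
    {ae lebesgue01 R, forall x : RM, (fun n => \sum_(0 <= k < n) Y k x) @ \oo --> X x}.
Proof.
move=> mY Yb bf.
have mN k : measurable_fun setT (fun x => (`|Y k x|)%:E) by apply/measurable_EFinP; exact: measurableT_comp.
pose g (x : RM) := (\sum_(0 <= k <oo) (`|Y k x|)%:E)%E.
have mg : measurable_fun setT g by apply: ge0_emeasurable_sum => // k x _ _; rewrite lee_fin.
have g0 x : (0 <= g x)%E by apply: nneseries_ge0 => k _ _; rewrite lee_fin.
have gi : (\int[lebesgue01 R]_x g x < +oo)%E.
  rewrite integral_nneseries //.
  apply: le_lt_trans bf; apply: lee_nneseries => k _.
    by move=> _; apply: integral_ge0 => x _; rewrite lee_fin.
  by apply: le_trans (Yb k); rewrite le_eqVlt; apply/orP; left; apply/eqP/eq_integral => x _; rewrite powRr1.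
have ig : (lebesgue01 R).-integrable setT g.
  by apply/integrableP; split => //; rewrite (eq_integral g) // => x _; rewrite gee0_abs.
have gfin := integrable_ae measurableT ig.
pose D : set RM := setT `&` [set x | g x \is a fin_num].
have mD : measurable D by exact: emeasurable_fin_num.
pose h n (x : RM) : R := \sum_(0 <= k < n) Y k x * \1_D x.
have cv (x : RM) : D x -> cvgn (series (fun k => Y k x)).
  move=> [_ gx]; apply: normed_cvg; apply: nondecreasing_is_cvgn.
    by apply: nondecreasing_series => k _ _; exact: normr_ge0.
  exists (fine (g x)) => _ [n _ <-]; rewrite -lee_fin fineK //.
  rewrite /series /= -sumEFin; apply: nneseries_lim_ge => k _ _; by rewrite lee_fin.
have hD (x : RM) : D x -> h^~ x = series (fun k => Y k x).
  move=> Dx; apply/funext => n; apply: eq_bigr => k _.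
  by rewrite indicE mem_set // mulr1.
have hn (x : RM) : ~ D x -> h^~ x = fun=> 0.
  move=> Dx; apply/funext => n; apply: big1 => k _.
  by rewrite indicE memNset // mulr0.
have hcv (x : RM) : cvgn (h^~ x).
  have [Dx|Dx] := pselect (D x); first by rewrite hD //; exact: cv.
  by rewrite hn //; exact: is_cvg_cst.
exists (fun x => limn (h^~ x)).
  apply: (@measurable_fun_cvg _ RM R setT h) => [n|x _]; last exact: hcv.
  by apply: measurable_sum => k; apply: measurable_funM => //; exact: measurable_indic.
apply: filterS gfin => x /(_ I) gx; have Dx : D x by [].
by have := hcv x; rewrite hD.
Qed.

Lemma defect_cvg (X : nat -> RM -> R) (Z : RM -> R) u : (forall n, measurable_fun setT (X n)) -> measurable_fun setT Z ->
  {ae lebesgue01 R, forall x : RM, X^~ x @ \oo --> Z x} -> (fun n => defect (X n) u) @ \oo --> defect Z u.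
Proof.
move=> mX mZ XZ; apply: fine_cvg; rewrite (defectE u mZ).1.
have mD (W : RM -> R) : measurable_fun setT W -> measurable_fun setT (fun x => (1 - cos (u * W x))%:E).
  by move=> mW; apply/measurable_EFinP; exact: measurable_defect.
have [|||_ _ h] := @dominated_convergence _ RM R (lebesgue01 R) setT measurableT
  (fun n x => (1 - cos (u * X n x))%:E) (fun x => (1 - cos (u * Z x))%:E) (cst 2%:E)
  (fun n => mD _ (mX n)) (mD _ mZ).
- apply: filterS XZ => x Xx _; apply: cvg_EFin; first by apply: nearW.
  have cs : {for u * Z x, continuous (@cos R)} by exact: continuous_cos.
  apply: (@cvgB _ R^o) => //; first exact: cvg_cst.
  apply: (continuous_cvg _ cs); apply: (@cvgM R) => //; exact: cvg_cst.
- apply/integrableP; split; first exact: measurable_cst.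
  under eq_integral do rewrite /= ger0_norm //.
  by rewrite integral_cst // mu01_setT mule1 ltry.
- apply/aeW => x n _; rewrite /= lee_fin ger0_norm ?one_sub_cos_ge0 //; exact: one_sub_cos_le2.
- exact: h.
Qed.

End abs_convergence.

Section lepage.
Context {R : realType} (r : R).
Hypotheses (r1 : 1 <= r) (r2 : r < 2).
Local Notation RM := (measurableTypeR R).
Implicit Types (g : (nat -> bool) -> R).

Let r0 : 0 < r. Proof. exact: lt_le_trans r1. Qed.

(* The block of indices [blocks K <= n < blocks K.+1] carries [2 ^ K.+1] jumps
   of size [2 `^ (- (K.+1 / r))]: dyadic values in place of the arrival times of
   the LePage series of an r-stable law. *)
Definition jump (k : nat) : R := 2 `^ (- (k%:R / r)).
Definition weight (n : nat) : R := jump (trunc_log 2 n.+2).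
Definition blocks (K : nat) : nat := (2 ^ K.+1 - 2)%N.
Definition lepage g K : RM -> R := rad (fun n s => weight n * g s) (blocks K).

Let jump0 k : 0 < jump k. Proof. exact: powR_gt0. Qed.

Let jumpr k : jump k `^ r = (2 ^+ k)^-1.
Proof. by rewrite /jump -powRrM mulNr divfK ?gt_eqF // powRN powR_mulrn. Qed.

Let blocksS K : blocks K.+1 = (blocks K + 2 ^ K.+1)%N.
Proof.
rewrite /blocks (expnS _ K.+1); have : (2 <= 2 ^ K.+1)%N by rewrite expnS leq_pmulr // expn_gt0.
by lia.
Qed.

Let weight_block K n : (blocks K <= n < blocks K.+1)%N -> weight n = jump K.+1.
Proof.
rewrite /blocks => h; rewrite /weight (@trunc_log_eq 2 K.+1) //.
have : (2 <= 2 ^ K.+1)%N by rewrite expnS leq_pmulr // expn_gt0.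
have : (2 <= 2 ^ K.+2)%N by rewrite expnS leq_pmulr // expn_gt0.
by lia.
Qed.

Let sum_block K (F : R -> R) : \sum_(blocks K <= n < blocks K.+1) F (weight n) = 2 ^+ K.+1 * F (jump K.+1).
Proof.
rewrite (eq_big_nat _ _ (F2 := fun=> F (jump K.+1))) => [|n /weight_block -> //].
by rewrite sumr_const_nat blocksS addKn -[LHS]mulr_natl natrX.
Qed.

Let sum_weight K (F : R -> R) : \sum_(n < blocks K) F (weight n) = \sum_(k < K) 2 ^+ k.+1 * F (jump k.+1).
Proof.
rewrite -(big_mkord xpredT (fun n => F (weight n))).
elim: K => [|K IH]; first by rewrite big_ord0 big_geq.
rewrite big_ord_recr /= (@big_cat_nat _ _ _ (blocks K)) //=; last by rewrite blocksS leq_addr.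
by rewrite IH sum_block.
Qed.

Lemma cos_defect_scale m g a u : cos_defect m (fun s => a * g s) u = cos_defect m g (u * a).
Proof. by rewrite /cos_defect; congr (_ / _); apply: eq_bigr => v _; rewrite mulrA. Qed.

Lemma depends_scale m g a : depends_on m g -> depends_on m (fun s => a * g s).
Proof. by move=> gm s; rewrite [in LHS]gm. Qed.

Let dep m g : depends_on m g -> forall n, depends_on m (fun s => weight n * g s).
Proof. by move=> gm n; exact: depends_scale. Qed.

Lemma measurable_lepage m g K : depends_on m g -> measurable_fun setT (lepage g K).
Proof. by move=> gm; apply: (@measurable_rad R _ _ m); exact: dep. Qed.

Lemma defect_rad f N m u : (forall n, depends_on m (f n)) ->
  defect (rad f N : RM -> R) u = 1 - \prod_(n < N) (1 - cos_defect m (f n) u).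
Proof.
by move=> fm; apply: EFin_inj; rewrite (defectE u (measurable_rad _ fm)).1; exact: rad_law.
Qed.

Definition power_mean_of (a : R) m g : R := (\sum_(v : {ffun 'I_m -> bool}) `|g (lift_seq v)| `^ a) / 2 ^+ m.

Lemma jump_sum_le : exists2 C : R, 0 < C & forall (y : R) K,
  \sum_(k < K) 2 ^+ k.+1 * (1 - cos (y * jump k.+1)) <= C * `|y| `^ r.
Proof.
have B1 : 1 < 2 `^ r^-1 :> R by rewrite -[ltLHS](powRr0 2); apply: ltr_powR1; rewrite ?ltr1n // invr_gt0.
have [|C C0 CP] := @scale_sum R (2 `^ r^-1) r 0 2 B1; first by rewrite r0.
exists (2 * C) => [|y K]; first by rewrite mulr_gt0.
have [->|yn] := eqVneq y 0.
  by rewrite big1 => [|k _]; rewrite ?mul0r ?cos0 ?subrr ?mulr0 // mulr_ge0 ?powR_ge0 // mulr_ge0 // ltW.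
have y0 : 0 < `|y| by rewrite normr_gt0.
have cosn z : cos (`|z| : R) = cos z by case: (ger0P z) => _; rewrite ?cosN.
pose phi (k : int) : R := 1 - cos (`|y| / (2 `^ r^-1) `^ k%:~R).
have jE (k : nat) : jump k = ((2 `^ r^-1) `^ k%:~R)^-1 by rewrite /jump powRN -powRrM mulrC.
rewrite -lee_fin; apply: le_trans (CP `|y| 2 phi y0 _ _ _ _) => //; last first.
- by move=> k; rewrite powRr0 mulr1; exact: one_sub_cos_le2.
- move=> k; rewrite /phi; apply: le_trans (one_sub_cos_le _) _.
  rewrite ger0_norm ?divr_ge0 ?powR_ge0 // ler_peMl ?powR_ge0 // ler1n //.
- by move=> k; exact: one_sub_cos_ge0.
have F0 k : (0 <= ((2 `^ r^-1) `^ (k%:~R * r) * phi k)%:E)%E.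
  by rewrite lee_fin mulr_ge0 ?powR_ge0 // one_sub_cos_ge0.
rewrite esum_int //; apply: (@le_trans _ _ (\sum_(0 <= j <oo) ((2 `^ r^-1) `^ ((Posz j)%:~R * r) * phi (Posz j))%:E)%E); last first.
  by rewrite leeDl // nneseries_ge0.
apply: le_trans (nneseries_lim_ge K.+1 (fun n _ _ => F0 (Posz n))).
rewrite sumEFin lee_fin big_mkord big_ord_recl /=; apply: ler_wpDl.
  by rewrite mulr_ge0 ?powR_ge0 // one_sub_cos_ge0.
apply: ler_sum => k _; rewrite /phi /bump /= add1n -jE -powRrM.
rewrite (_ : r^-1 * _ = k.+1%:R); last by rewrite mulrCA mulVf ?mulr1 // gt_eqF.
rewrite powR_mulrn // ler_pM2l ?exprn_gt0 //.
by rewrite -(cosn (y * _)) normrM (ger0_norm (ltW (jump0 _))).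
Qed.

Lemma jump_sum_ge : exists2 c : R, 0 < c & forall M : R, exists K0, forall (y : R) K, `|y| <= M -> (K0 <= K)%N ->
  c * (`|y| `^ r - 16^-1) <= \sum_(k < K) 2 ^+ k.+1 * (1 - cos (y * jump k.+1)).
Proof.
have [|w w0 wP] := @wave_lower R (32^-1); first by lra.
exists (w `^ 2 / 2) => [|M]; first by rewrite divr_gt0 // powR_gt0.
exists (Num.truncn (M `^ r)).+1 => y K yM K0.
set v := `|y|; have v0 : 0 <= v by exact: normr_ge0.
have T0 (k : nat) : 0 <= 2 ^+ k.+1 * (1 - cos (y * jump k.+1)) by rewrite mulr_ge0 ?exprn_ge0 ?one_sub_cos_ge0.
have c0 : 0 <= w `^ 2 / 2 by rewrite divr_ge0 ?powR_ge0.
have [vs|vl] := ltP v 16^-1.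
  apply: (@le_trans _ _ 0); last by apply: sumr_ge0 => k _; exact: T0.
  rewrite mulr_ge0_le0 // subr_le0; apply: (@le_trans _ _ v); last exact: ltW.
  by apply: powR_le_id => //; rewrite v0 /=; lra.
have ex : exists k, v `^ r <= 2 ^+ k.+1.
  exists (Num.truncn (M `^ r)); apply: (@le_trans _ _ (M `^ r)).
    by apply: ge0_ler_powR; rewrite ?nnegrE ?(ltW r0) // (le_trans v0).
  apply: (@le_trans _ _ (Num.truncn (M `^ r)).+1%:R); first by apply/ltW; exact: truncnS_gt.
  by rewrite -natrX ler_nat ltnW // ltn_expl.
have [k kP kmin] := ex_minnP ex.
have kK : (k < K)%N.
  apply: leq_trans K0; rewrite ltnS; apply: kmin; apply: (@le_trans _ _ (M `^ r)).
    by apply: ge0_ler_powR; rewrite ?nnegrE ?(ltW r0) // (le_trans v0).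
  apply: (@le_trans _ _ (Num.truncn (M `^ r)).+1%:R); first by apply/ltW; exact: truncnS_gt.
  by rewrite -natrX ler_nat ltnW // ltn_expl.
rewrite (bigD1 (Ordinal kK)) //=; apply: ler_wpDr; first by apply: sumr_ge0 => i _; exact: T0.
have zr : (v * jump k.+1) `^ r = v `^ r / 2 ^+ k.+1 by rewrite powRM ?(ltW (jump0 _)) // jumpr.
have z0 : 0 <= v * jump k.+1 by rewrite mulr_ge0 // ltW.
have z1 : v * jump k.+1 <= 1.
  rewrite leNgt; apply/negP => h; have : 1 < (v * jump k.+1) `^ r.
    by have := @gt0_ltr_powR R r r0 1 (v * jump k.+1); rewrite !nnegrE powR1 => ->.
  by rewrite zr ltr_pdivlMr ?exprn_gt0 // mul1r ltNge kP.
have z2 : 32^-1 <= v * jump k.+1.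
  case: k kP kmin kK zr z0 z1 => [|k] kP kmin kK zr z0 z1.
    have : 2^-1 <= jump 1.
      rewrite /jump mul1r -[leLHS](@powR_inv1 R 2) //; apply: ler_powR; first by rewrite ler1n.
      by rewrite lerN2 invf_le1.
    by move: (jump 1) => j j2; nra.
  have h : 2 ^+ k.+1 < v `^ r by rewrite ltNge; apply/negP => /kmin; rewrite ltnn.
  have zr2 : 2^-1 <= (v * jump k.+2) `^ r.
    by rewrite zr ler_pdivlMr ?exprn_gt0 // (exprS _ k.+1) mulKf // ltW.
  apply: (@le_trans _ _ 2^-1); first by lra.
  apply: le_trans zr2 _; apply: powR_le_id => //; by rewrite z0.
have [|t tP] := wP (v * jump k.+1) 0; first by rewrite subr0 ger0_norm // z2 /=; lra.
have cosn z : cos (`|z| : R) = cos z by case: (ger0P z) => _; rewrite ?cosN.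
have h : w `^ 2 / 2 <= 1 - cos (y * jump k.+1).
  rewrite -(cosn (y * _)) normrM (ger0_norm (ltW (jump0 _))) -/v.
  have := sum_wave_sqr (v * jump k.+1) 0; rewrite subr0 (bigD1 t) //= => e.
  rewrite ler_pdivrMr // mulrC -e; apply: ler_wpDr.
    by apply: sumr_ge0 => i _; exact: powR_ge0.
  by apply: ge0_ler_powR; rewrite ?nnegrE ?(ltW w0).
apply: (@le_trans _ _ (w `^ 2 / 2 * v `^ r)); first by rewrite ler_wpM2l // gerBl.
by rewrite mulrC; apply: ler_pM => //; exact: powR_ge0.
Qed.

Lemma lepage_defect_le : exists2 C : R, 0 < C & forall m g K u, depends_on m g ->
  defect (lepage g K) u <= C * (`|u| `^ r * power_mean_of r m g).
Proof.
have [C C0 CP] := jump_sum_le; exists C => // m g K u gm.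
rewrite /lepage (defect_rad _ _ (dep gm)).
apply: le_trans (@subr_prod_le R _ (fun n => cos_defect m (fun s => weight n * g s) u) _) _; first by move=> n; exact: cos_defect_bound.
under eq_bigr do rewrite cos_defect_scale.
rewrite (sum_weight K (fun a => cos_defect m g (u * a))) /cos_defect /power_mean_of.
rewrite (_ : \sum_(k < K) _ = (\sum_(v : {ffun 'I_m -> bool}) \sum_(k < K) 2 ^+ k.+1 * (1 - cos (u * g (lift_seq v) * jump k.+1))) / 2 ^+ m); last first.
  rewrite exchange_big /= mulr_suml; apply: eq_bigr => k _.
  rewrite -mulr_sumr -mulrA; congr (_ * (_ / _)); apply: eq_bigr => v _.
  by rewrite mulrAC.
rewrite !mulrA ler_pM2r ?invr_gt0 ?exprn_gt0 // mulr_sumr; apply: ler_sum => v _.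
by apply: le_trans (CP _ _) _; rewrite normrM powRM // mulrA.
Qed.

Lemma lepage_defect_ge : exists2 c : R, 0 < c & forall m g u, depends_on m g -> 0 <= u ->
  4^-1 <= u `^ r * power_mean_of r m g <= 1 ->
  exists K0, forall K, (K0 <= K)%N -> c <= defect (lepage g K) u.
Proof.
have [c c0 cP] := jump_sum_ge; have c1 : 0 < c * (4^-1 - 16^-1) by rewrite mulr_gt0 //; lra.
exists (1 - (1 + c * (4^-1 - 16^-1))^-1); first by rewrite subr_gt0 invf_lt1 ?ltrDl // addr_gt0.
move=> m g u gm u0 /andP[n1 n2].
have [K0 KP] := cP (\sum_(v : {ffun 'I_m -> bool}) `|u * g (lift_seq v)|).
exists K0 => K KK; rewrite /lepage (defect_rad _ _ (dep gm)) lerB //.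
pose a n := cos_defect m (fun s => weight n * g s) u.
have NE : u `^ r * power_mean_of r m g = (\sum_(v : {ffun 'I_m -> bool}) `|u * g (lift_seq v)| `^ r) / 2 ^+ m.
  rewrite /power_mean_of mulrA mulr_sumr; congr (_ / _); apply: eq_bigr => v _.
  by rewrite normrM powRM // ger0_norm.
have pow_le (z : R) : 1 - cos z <= 2 * `|z| `^ r.
  have [z1|z1] := leP `|z| 1.
    apply: le_trans (one_sub_cos_le z) _; apply: (@le_trans _ _ (`|z| `^ r)); last by rewrite ler_peMl ?powR_ge0 // ler1n.
    have [->|zn] := eqVneq `|z| 0; first by rewrite !powR0 ?gt_eqF.
    by apply: ger_powR; rewrite ?(ltW r2) // lt_def zn normr_ge0.
  apply: le_trans (one_sub_cos_le2 z) _; rewrite ler_peMr //.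
  have := @ge0_ler_powR R r (ltW r0) 1 `|z|; rewrite !nnegrE powR1; apply => //; exact: ltW.
have weight_le n : weight n `^ r <= 2^-1.
  have h : (1 <= trunc_log 2 n.+2)%N by apply: trunc_log_max.
  rewrite /weight jumpr lef_pV2 ?posrE ?exprn_gt0 // -[leLHS]expr1.
  by apply: ler_weXn2l => //; rewrite ler1n.
have a1 n : 0 <= a n <= 1.
  have /andP[h0 _] := cos_defect_bound m (fun s => weight n * g s) u; rewrite h0 /= /a cos_defect_scale /cos_defect.
  apply: (@le_trans _ _ (2 * weight n `^ r * ((\sum_(v : {ffun 'I_m -> bool}) `|u * g (lift_seq v)| `^ r) / 2 ^+ m))).
    rewrite mulrA ler_pM2r ?invr_gt0 ?exprn_gt0 // mulr_sumr; apply: ler_sum => v _.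
    apply: le_trans (pow_le _) _; rewrite (mulrAC u) normrM (ger0_norm (ltW (jump0 _))) powRM ?(ltW (jump0 _)) //.
    by rewrite -mulrA (mulrC (weight n `^ r)).
  rewrite -NE; apply: (@le_trans _ _ (2 * 2^-1 * 1)); last by rewrite mulr1 divff.
  apply: ler_pM => //; first by rewrite mulr_ge0 ?powR_ge0.
    by apply: le_trans n1.
  by rewrite ler_pM2l.
have /andP[_ h] := prod_subr_le (blocks K) a1; apply: le_trans h _.
have S : c * (4^-1 - 16^-1) <= \sum_(n < blocks K) a n.
  rewrite /a; under eq_bigr do rewrite cos_defect_scale.
  rewrite (sum_weight K (fun a => cos_defect m g (u * a))) /cos_defect.
  rewrite (_ : \sum_(k < K) _ = (\sum_(v : {ffun 'I_m -> bool}) \sum_(k < K) 2 ^+ k.+1 * (1 - cos (u * g (lift_seq v) * jump k.+1))) / 2 ^+ m); last first.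
    rewrite exchange_big /= mulr_suml; apply: eq_bigr => k _.
    rewrite -mulr_sumr -mulrA; congr (_ * (_ / _)); apply: eq_bigr => v _.
    by rewrite mulrAC.
  apply: (@le_trans _ _ ((\sum_(v : {ffun 'I_m -> bool}) c * (`|u * g (lift_seq v)| `^ r - 16^-1)) / 2 ^+ m)); last first.
    rewrite ler_pM2r ?invr_gt0 ?exprn_gt0 //; apply: ler_sum => v _; apply: KP => //.
    by rewrite (bigD1 v) //= lerDl sumr_ge0.
  rewrite -mulr_sumr big_split /= sumr_const card_ffun card_bool card_ord -mulrA ler_pM2l //.
  have -> : - 16^-1 *+ 2 ^ m = - 16^-1 * 2 ^+ m :> R by rewrite -[LHS]mulr_natr natrX.
  rewrite mulrDl -NE -mulrA divff ?gt_eqF ?exprn_gt0 // mulr1.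
  by rewrite lerD2r.
have S0 := lt_le_trans c1 S.
by rewrite lef_pV2 ?posrE ?lerD2l ?addr_gt0.
Qed.

Lemma lepage_step : exists C z : R, [/\ 0 <= C, 0 <= z < 1 & forall m g M K, depends_on m g -> 0 <= M ->
  (forall s, `|g s| <= M) -> (\int[lebesgue01 R]_x (`|lepage g K.+1 x - lepage g K x| `^ 1)%:E <= (C * M * z ^+ K)%:E)%E].
Proof.
have [||C C0 CP] := @moment_le R 1 2; rewrite ?ltr01 ?ltr1n //.
pose h : R := 2^-1 - r^-1; pose z : R := 2 `^ h.
have h0 : h < 0 by rewrite /h subr_lt0 ltf_pV2 ?posrE.
have z1 : 0 <= z < 1 by rewrite powR_ge0 /= -[ltRHS](powRr0 2) ltr_powR1 // ltr1n.
exists (3 * C * z), z; split => //; first by rewrite !mulr_ge0 ?(ltW C0) //; case/andP: z1.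
move=> m g M K gm M0 gM.
pose f n s := if (blocks K <= n)%N then weight n * g s else 0.
have fm n : depends_on m (f n).
  by move=> s; rewrite /f; case: ifP => // _; rewrite [in LHS]gm.
have E x : lepage g K.+1 x - lepage g K x = rad f (blocks K.+1) x.
  have nat_rad f' N : rad f' N x = \sum_(0 <= n < N) (-1) ^+ (stream n x 0%N) * f' n (tail_stream n x).
    by rewrite big_mkord.
  rewrite /lepage !nat_rad.
  rewrite (@big_cat_nat _ _ _ (blocks K)) //=; last by rewrite blocksS leq_addr.
  rewrite addrAC subrr add0r [RHS](@big_cat_nat _ _ _ (blocks K)) //=; last by rewrite blocksS leq_addr.
  rewrite [X in _ = X + _]big_nat [X in _ = X + _]big1 ?add0r => [|n /andP[_ nK]].
    by apply: eq_big_nat => n /andP[Kn _]; rewrite /f Kn.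
  by rewrite /f leqNgt nK /= mulr0.
under eq_integral => x _ do rewrite E.
pose s : R := M * z ^+ K.+1.
have s0 : 0 <= s by rewrite mulr_ge0 ?exprn_ge0 //; case/andP: z1.
have := CP (rad f (blocks K.+1)) 1 s (measurable_rad _ fm) ler01 s0.
rewrite powRr1 // (_ : (1 + 2) * C * s = 3 * C * z * M * z ^+ K); last by rewrite /s exprS; ring.
apply => u u0; rewrite mul1r (defect_rad _ _ fm).
apply: le_trans (@subr_prod_le R _ (fun n => cos_defect m (f n) u) _) _; first by move=> n; exact: cos_defect_bound.
rewrite -(big_mkord xpredT (fun n => cos_defect m (f n) u)) (@big_cat_nat _ _ _ (blocks K)) //=; last by rewrite blocksS leq_addr.
rewrite big_nat [X in X + _]big1 ?add0r => [|n /andP[_ nK]]; last first.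
  by rewrite /cos_defect big1 ?mul0r // => v _; rewrite /f leqNgt nK /= mulr0 cos0 subrr.
rewrite (eq_big_nat _ _ (F2 := fun n => cos_defect m g (u * weight n))) => [|n /andP[Kn _]]; last first.
  by rewrite -cos_defect_scale /f Kn.
rewrite (sum_block K (fun a => cos_defect m g (u * a))).
have ge : cos_defect m g (u * jump K.+1) <= (u * jump K.+1 * M) `^ 2.
  rewrite /cos_defect ler_pdivrMr ?exprn_gt0 //.
  apply: (@le_trans _ _ (\sum_(v : {ffun 'I_m -> bool}) (u * jump K.+1 * M) `^ 2)).
    apply: ler_sum => v _; apply: le_trans (one_sub_cos_le _) _.
    apply: ge0_ler_powR; rewrite ?nnegrE ?normr_ge0 //.
      by rewrite !mulr_ge0 ?(ltW u0) ?(ltW (jump0 _)).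
    rewrite normrM ger0_norm ?mulr_ge0 ?(ltW u0) ?(ltW (jump0 _)) // ler_wpM2l //.
    by rewrite mulr_ge0 ?(ltW u0) ?(ltW (jump0 _)).
  by rewrite sumr_const card_ffun card_bool card_ord -[leLHS]mulr_natr natrX.
apply: le_trans (ler_wpM2l (exprn_ge0 _ _) ge) _ => //.
have uj : 0 <= u * jump K.+1 by rewrite mulr_ge0 ?(ltW u0) ?(ltW (jump0 _)).
have z0 : 0 <= z by case/andP: z1.
rewrite (@powR_mulrn R (u * jump K.+1 * M) 2) ?mulr_ge0 ?(ltW u0) ?(ltW (jump0 _)) //.
rewrite (@powR_mulrn R (u * s) 2) ?mulr_ge0 ?exprn_ge0 ?(ltW u0) // /s.
pose y : R := 2 `^ (- r^-1); have p2 a b : 2 `^ a * 2 `^ b = 2 `^ (a + b) :> R.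
  by rewrite powRD ?pnatr_eq0 ?implybT.
have z2 : z ^+ 2 = 2 * y ^+ 2.
  rewrite -[2 in RHS](powRr1 (a := 2)) // !expr2 /z /y !p2; congr (_ `^ _); rewrite /h; field.
  by rewrite gt_eqF.
have jy : jump K.+1 = y ^+ K.+1.
  by rewrite /jump -[RHS]powR_mulrn ?powR_ge0 // /y -powRrM mulNr mulrC.
have zz : (z ^+ K.+1) ^+ 2 = 2 ^+ K.+1 * jump K.+1 ^+ 2 by rewrite exprAC z2 exprMn jy exprAC.
rewrite (_ : (u * (M * z ^+ K.+1)) ^+ 2 = u ^+ 2 * M ^+ 2 * (z ^+ K.+1) ^+ 2); last by ring.
by rewrite zz le_eqVlt; apply/orP; left; apply/eqP; ring.
Qed.

End lepage.

(** * Stable families *)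

Section stable.
Context {R : realType}.
Local Notation RM := (measurableTypeR R).
Implicit Types (g : (nat -> bool) -> R).

Lemma pre_lift (k m : nat) (s : nat -> bool) : (k <= m)%N -> pre k (lift_seq (pre m s)) = pre k s.
Proof.
move=> km; apply/ffunP => i; rewrite !ffunE.
by rewrite (lift_seqE (pre m s) (widen_ord km i)) ffunE.
Qed.

Lemma sfun_depends (c : scode) m : (tag c <= m)%N -> depends_on m (@sfun R c).
Proof. by move=> cm s; rewrite /sfun pre_lift. Qed.

Lemma depends_sub m g h : depends_on m g -> depends_on m h -> depends_on m (fun s => g s - h s).
Proof. by move=> gm hm s; rewrite [in LHS]gm [in LHS]hm. Qed.

Lemma step_distE (r : R) (r1 : 1 <= r) (i j : scode) m : (tag i <= m)%N -> (tag j <= m)%N ->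
  `|step r1 i - step r1 j| `^ r = power_mean_of r m (fun s => sfun i s - sfun j s).
Proof.
move=> im jm; apply: EFin_inj.
rewrite (L01_dist_aeE (measurable_sfun _) (measurable_sfun _) (stepE r1 i) (stepE r1 j)).
pose G (w : {ffun 'I_m -> bool}) : R := `|sfun i (lift_seq w) - sfun j (lift_seq w)| `^ r.
rewrite (eq_integral (fun x : RM => (G (pre m (digs x)))%:E)); last first.
  move=> x _; rewrite /G -(@depends_sub m (sfun i) (sfun j)) //; exact: sfun_depends.
by rewrite digs_law // => w; exact: powR_ge0.
Qed.

Definition stable_family (r : R) (r1 : 1 <= r) := exists (X : scode -> RM -> R) (c C : R),
  [/\ 0 < c, 0 < C, forall i, measurable_fun setT (X i) & forall i j u, 0 < u ->
    defect (fun x => X i x - X j x) u <= C * (u * `|step r1 i - step r1 j|) `^ r /\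
    (4^-1 <= (u * `|step r1 i - step r1 j|) `^ r <= 1 -> c <= defect (fun x => X i x - X j x) u)].

Lemma rad_sub f f' N (x : R) : rad f N x - rad f' N x = rad (fun n s => f n s - f' n s) N x.
Proof. by rewrite /rad -sumrB; apply: eq_bigr => n _; rewrite mulrBr. Qed.

Lemma stable_family_lt2 (r : R) (r1 : 1 <= r) : r < 2 -> stable_family r1.
Proof.
move=> r2.
have [C0 [z [C00 z01 stp]]] := lepage_step r1 r2.
have mL (c : scode) K : measurable_fun setT (lepage r (@sfun R c) K).
  by apply: measurable_lepage; exact: (sfun_depends (leqnn _)).
have lim (c : scode) : exists2 X : RM -> R, measurable_fun setT X &
    {ae lebesgue01 R, forall x : RM, (fun K => lepage r (@sfun R c) K x) @ \oo --> X x}.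
  have [M M0 MP] := @sfun_bounded R c.
  have [|||X mX Xl] := @ae_summable R (fun k x => lepage r (@sfun R c) k.+1 x - lepage r (@sfun R c) k x) (fun k => C0 * M * z ^+ k).
  - by move=> k; apply: measurable_funB; exact: mL.
  - by move=> k; apply: (stp (tag c)) => //; exact: sfun_depends.
  - under eq_eseriesr do rewrite EFinM; rewrite nneseriesZl; last by move=> n _; rewrite lee_fin exprn_ge0 //; case/andP: z01.
    have CM : (0 <= (C0 * M)%:E)%E by rewrite lee_fin mulr_ge0.
    apply: le_lt_trans (lee_wpmul2l CM (geometric_nneseries z01)) _.
    by rewrite -EFinM ltry.
  exists X => //; apply: filterS Xl => x; rewrite (_ : (fun n => _) = fun K => lepage r (@sfun R c) K x) //.
  apply/funext => K; rewrite telescope_sumr // [X in _ - X](_ : _ = 0) ?subr0 //.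
  by rewrite /lepage /rad /blocks big_ord0.
have [X XP] : {X : scode -> RM -> R | forall c, measurable_fun setT (X c) /\
    {ae lebesgue01 R, forall x : RM, (fun K => lepage r (@sfun R c) K x) @ \oo --> X c x}}.
  have /choice[X XP] : forall c, exists X : RM -> R, measurable_fun setT X /\
    {ae lebesgue01 R, forall x : RM, (fun K => lepage r (@sfun R c) K x) @ \oo --> X x}.
    by move=> c; have [X mX Xl] := lim c; exists X.
  by exists X.
have [C CC CP] := lepage_defect_le r1 r2; have [c cc cP] := lepage_defect_ge r1 r2.
exists X, c, C; split => // [i|i j u u0]; first by have [] := XP i.
have [mi li] := XP i; have [mj lj] := XP j.
pose m := maxn (tag i) (tag j).
have di := @sfun_depends i m (leq_maxl _ _); have dj := @sfun_depends j m (leq_maxr _ _).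
pose g s : R := sfun i s - sfun j s; have dg : depends_on m g by exact: depends_sub.
have E K x : lepage r (@sfun R i) K x - lepage r (@sfun R j) K x = lepage r g K x.
  by rewrite /lepage rad_sub; apply: eq_bigr => n _; congr (_ * _); rewrite /g mulrBr.
have cv : (fun K => defect (lepage r g K : RM -> R) u) @ \oo --> defect (fun x => X i x - X j x) u.
  apply: defect_cvg.
  - by move=> K; exact: measurable_lepage dg.
  - exact: measurable_funB.
  - apply: filterS2 li lj => x lix ljx; under eq_fun do rewrite -E.
    exact: (@cvgB _ R^o).
have N : (u * `|step r1 i - step r1 j|) `^ r = u `^ r * power_mean_of r m g.
  by rewrite powRM ?(ltW u0) // (step_distE r1 (m := m)) // ?leq_maxl ?leq_maxr.
rewrite N; split.
- apply: (cvgr_to_le cv); apply: nearW => K.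
  by have := CP m g K u dg; rewrite gtr0_norm.
- move=> h; have [K0 KP] := cP m g u dg (ltW u0) h.
  by apply: (cvgr_to_ge cv); exists K0.
Qed.

(* Numbering of the binary tree with root [1] and sons [2n], [2n+1]. *)
Fixpoint node (m : nat) (s : nat -> bool) : nat := if m is k.+1 then (node k s).*2 + s k else 1.

(* [haar m s] lists the coordinates of a random mass given to the cylinder of
   the first [m] digits of [s]: each mass is split in two halves up to a fresh
   independent sign, which makes the masses of one level orthogonal. *)
Fixpoint haar (m : nat) (s : nat -> bool) (n : nat) : R :=
  if m is k.+1 then (haar k s n + (-1) ^+ s k * 2 `^ (- (k%:R / 2)) * (n == node k s)%:R) / 2 else (n == 0%N)%:R.

Lemma node_bound m s : (2 ^ m <= node m s < 2 ^ m.+1)%N.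
Proof.
elim: m => [//|m /andP[h1 h2]] /=; rewrite !expnS in h2 *.
by apply/andP; split; move: h1 h2; case: (s m); rewrite /= -!muln2; lia.
Qed.

Lemma node_inj m s t : node m s = node m t -> forall i, (i < m)%N -> s i = t i.
Proof.
elim: m => [//|m IH] /= h i; have e : s m = t m.
  by have := congr1 odd h; rewrite !oddD !odd_double; case: (s m); case: (t m).
rewrite ltnS leq_eqVlt => /orP[/eqP -> //|im]; apply: IH => //.
by apply: double_inj; move: h; rewrite e => /addIn.
Qed.

Lemma eq_node m s t : (forall i, (i < m)%N -> s i = t i) -> node m s = node m t.
Proof. by elim: m => [//|m IH] st /=; rewrite IH ?st // => i im; apply: st; rewrite ltnW. Qed.

Lemma eq_haar m s t n : (forall i, (i < m)%N -> s i = t i) -> haar m s n = haar m t n.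
Proof.
elim: m => [//|m IH] st /=; rewrite IH ?st ?(@eq_node m s t) // => i im; apply: st; exact: ltnW.
Qed.

Lemma haar_support m s n : (2 ^ m <= n)%N -> haar m s n = 0.
Proof.
elim: m => [|m IH] h /=; first by rewrite expn0 in h; case: n h.
have /andP[_ h2] := node_bound m s; rewrite IH; last by apply: leq_trans h; rewrite leq_exp2l.
by rewrite gtn_eqF ?mulr0 ?addr0 ?mul0r //; exact: leq_trans h2 h.
Qed.

Lemma haar_ortho m s t : \sum_(n < 2 ^ m) haar m s n * haar m t n = (2 ^+ m)^-1 * (node m s == node m t)%:R.
Proof.
elim: m => [|m IH] /=; first by rewrite big_ord1 /= !mulr1 invr1.
have widen (F : nat -> R) : (forall n, (2 ^ m <= n)%N -> F n = 0) ->
    \sum_(n < 2 ^ m.+1) F n = \sum_(n < 2 ^ m) F n.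
  move=> F0; rewrite -!(big_mkord xpredT F) (@big_cat_nat _ _ _ (2 ^ m)) //=; last by rewrite leq_exp2l.
  by rewrite [X in _ + X]big_nat [X in _ + X]big1 ?addr0 // => n /andP[h _]; exact: F0.
have pick u (F : nat -> R) : \sum_(n < 2 ^ m.+1) F n * (nat_of_ord n == node m u)%:R = F (node m u).
  have /andP[_ h] := node_bound m u.
  rewrite (bigD1 (Ordinal h)) //= eqxx mulr1 big1 ?addr0 // => n /eqP hn.
  by case: eqP => [e|]; rewrite ?mulr0 //; case: hn; apply: val_inj.
pose e u : R := (-1) ^+ u m * 2 `^ (- (m%:R / 2)).
transitivity (4^-1 * (\sum_(n < 2 ^ m.+1) haar m s n * haar m t n
   + e t * \sum_(n < 2 ^ m.+1) haar m s n * (nat_of_ord n == node m t)%:R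
   + e s * \sum_(n < 2 ^ m.+1) haar m t n * (nat_of_ord n == node m s)%:R
   + e s * e t * \sum_(n < 2 ^ m.+1) (nat_of_ord n == node m s)%:R * (nat_of_ord n == node m t)%:R)).
  rewrite !mulr_sumr -!big_split /= mulr_sumr; apply: eq_bigr => n _.
  by rewrite -/(e s) -/(e t); field.
rewrite (widen (fun n => haar m s n * haar m t n)); last by move=> n h; rewrite haar_support // mul0r.
rewrite IH (pick t (haar m s)) (pick s (haar m t)) (pick t (fun n => (n == node m s)%:R)).
have /andP[hs _] := node_bound m s; have /andP[ht _] := node_bound m t.
rewrite (haar_support _ ht) (haar_support _ hs) !mulr0 !addr0 eq_sym.
have ee : e s * e t = (-1) ^+ (s m) * (-1) ^+ (t m) * (2 ^+ m)^-1.
  rewrite /e mulrACA -powRD ?pnatr_eq0 ?implybT // -opprD -splitr powRN powR_mulrn //.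
have -> : ((node m s).*2 + s m == (node m t).*2 + t m)%N = (node m s == node m t) && (s m == t m).
  apply/eqP/andP => [h|[/eqP -> /eqP -> //]]; have e' : s m = t m.
    by have := congr1 odd h; rewrite !oddD !odd_double; case: (s m); case: (t m).
  by split; [apply/eqP/double_inj; move: h; rewrite e' => /addIn|rewrite e'].
rewrite ee exprS (eq_sym (node m t)); case: (node m s == node m t); last by rewrite /= !mulr0 addr0 mulr0.
have p0 : 2 ^+ m != 0 :> R by rewrite expf_neq0 // pnatr_eq0.
by case: (s m); case: (t m); rewrite /= ?expr0 ?expr1 ?mulr1 ?mulr0; field; rewrite p0.
Qed.

Definition extend m (v : {ffun 'I_m -> bool}) (b : bool) : {ffun 'I_m.+1 -> bool} :=
  [ffun i => if unlift ord_max i is Some j then v j else b].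

Lemma sum_extend m (F : {ffun 'I_m.+1 -> bool} -> R) : \sum_v F v = \sum_(v : {ffun 'I_m -> bool}) \sum_b F (extend v b).
Proof.
rewrite pair_big /= (reindex (fun w : {ffun 'I_m -> bool} * bool => extend w.1 w.2)) //=.
exists (fun w : {ffun 'I_m.+1 -> bool} => ([ffun j => w (lift ord_max j)], w ord_max)) => [[v b] _|w _] /=.
  by congr (_, _); [apply/ffunP => j; rewrite !ffunE liftK|rewrite ffunE unlift_none].
apply/ffunP => i; rewrite ffunE; case: unliftP => [j ->|->] //; by rewrite ffunE.
Qed.

Lemma lift_extend m (v : {ffun 'I_m -> bool}) b i : (i < m)%N -> lift_seq (extend v b) i = lift_seq v i.
Proof.
move=> im; have := lift_seqE (extend v b) (lift ord_max (Ordinal im)).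
by rewrite lift_max /= => ->; rewrite ffunE liftK -(lift_seqE v (Ordinal im)).
Qed.

Lemma lift_extend_max m (v : {ffun 'I_m -> bool}) b : lift_seq (extend v b) m = b.
Proof. by have := lift_seqE (extend v b) ord_max; rewrite /= => ->; rewrite ffunE unlift_none. Qed.

Definition haar_coef m g n : R := \sum_(v : {ffun 'I_m -> bool}) g (lift_seq v) * haar m (lift_seq v) n.

Lemma haar_coefS m g n : depends_on m g -> haar_coef m.+1 g n = haar_coef m g n.
Proof.
move=> gm; rewrite /haar_coef sum_extend; apply: eq_bigr => v _.
have gE b : g (lift_seq (extend v b)) = g (lift_seq v).
  rewrite [LHS]gm; congr (g (lift_seq _)); apply/ffunP => i.
  by rewrite ffunE lift_extend // lift_seqE.
rewrite big_bool /= !gE !lift_extend_max.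
rewrite !(@eq_haar m (lift_seq (extend v _)) (lift_seq v)) => [|i im|i im]; try exact: lift_extend.
rewrite !(@eq_node m (lift_seq (extend v _)) (lift_seq v)) => [|i im|i im]; try exact: lift_extend.
by rewrite expr0 expr1; field.
Qed.

Lemma haar_coef_le m M g n : (m <= M)%N -> depends_on m g -> haar_coef M g n = haar_coef m g n.
Proof.
elim: M => [|M IH]; first by rewrite leqn0 => /eqP ->.
rewrite leq_eqVlt => /orP[/eqP -> //|]; rewrite ltnS => mM gm.
rewrite haar_coefS ?IH // => s; rewrite [LHS]gm [RHS]gm; by rewrite pre_lift.
Qed.

Lemma haar_coef_sub m g h n : haar_coef m (fun s => g s - h s) n = haar_coef m g n - haar_coef m h n.
Proof. by rewrite /haar_coef -sumrB; apply: eq_bigr => v _; rewrite mulrBl. Qed.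

Lemma haar_parseval m g : \sum_(n < 2 ^ m) haar_coef m g n ^+ 2 = power_mean_of 2 m g.
Proof.
transitivity (\sum_(v : {ffun 'I_m -> bool}) \sum_(w : {ffun 'I_m -> bool})
   g (lift_seq v) * g (lift_seq w) * \sum_(n < 2 ^ m) haar m (lift_seq v) n * haar m (lift_seq w) n).
  transitivity (\sum_(n < 2 ^ m) \sum_(v : {ffun 'I_m -> bool}) \sum_(w : {ffun 'I_m -> bool})
      g (lift_seq v) * g (lift_seq w) * (haar m (lift_seq v) n * haar m (lift_seq w) n)).
    apply: eq_bigr => n _; rewrite expr2 /haar_coef mulr_suml; apply: eq_bigr => v _.
    by rewrite mulr_sumr; apply: eq_bigr => w _; rewrite mulrACA.
  rewrite exchange_big /=; apply: eq_bigr => v _; rewrite exchange_big /=; apply: eq_bigr => w _.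
  by rewrite mulr_sumr.
rewrite /power_mean_of mulr_suml; apply: eq_bigr => v _.
rewrite (bigD1 v) //= [X in _ + X]big1 => [|w wv].
  by rewrite addr0 haar_ortho eqxx mulr1 powR_mulrn // real_normK ?num_real // expr2.
rewrite haar_ortho (_ : (_ == _) = false) ?mulr0 //; apply/eqP => h; move/eqP: wv; apply.
by apply/ffunP => i; rewrite -!lift_seqE (node_inj h).
Qed.

Lemma one_sub_cos_ge : exists2 c : R, 0 < c & forall y : R, `|y| <= 1 -> c * y ^+ 2 <= 1 - cos y.
Proof.
have [|w w0 wP] := @wave_lower R 2^-1; first by lra.
pose c := w `^ 2 / 2; have c0 : 0 < c by rewrite divr_gt0 // powR_gt0.
exists c => // y y1; have [->|yn] := eqVneq y 0; first by rewrite expr0n /= mulr0 one_sub_cos_ge0.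
have dbl (z : R) : 1 - cos (2 * z) <= 4 * (1 - cos z).
  have -> : 2 * z = z + z by ring.
  rewrite cosD; have := cos2Dsin2 z; have := @cos_le1 R z; have := @cos_geN1 R z.
  rewrite !expr2; move: (cos z) (sin z) => a b; nra.
have dblj j (z : R) : 1 - cos (2 ^+ j * z) <= 4 ^+ j * (1 - cos z).
  elim: j => [|j IH]; first by rewrite !expr0 !mul1r.
  rewrite !exprS -!mulrA; apply: le_trans (dbl _) _; by rewrite ler_pM2l.
have y0 : 0 < `|y| by rewrite normr_gt0.
have ex : exists j, 2^-1 <= 2 ^+ j * `|y|.
  exists (Num.truncn (`|y|^-1)).+1; rewrite -ler_pdivrMr //.
  apply: (@le_trans _ _ (Num.truncn (`|y|^-1)).+1%:R).
    apply: (@le_trans _ _ `|y|^-1); last by apply/ltW; exact: truncnS_gt.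
    by rewrite ler_piMl ?invr_ge0 // invf_le1 ?ler1n.
  by rewrite -natrX ler_nat ltnW // ltn_expl.
have [j jP jmin] := ex_minnP ex.
have j1 : 2 ^+ j * `|y| <= 1.
  case: j jP jmin => [|j] jP jmin; first by rewrite expr0 mul1r.
  rewrite exprS -mulrA -ler_pdivlMl // mulr1 leNgt; apply/negP => h.
  by have := jmin j (ltW h); rewrite ltnn.
have [|t tP] := wP (2 ^+ j * `|y|) 0.
  by rewrite subr0 ger0_norm ?mulr_ge0 ?exprn_ge0 // jP (le_trans j1) // ler1n.
have cosn z : cos (`|z| : R) = cos z by case: (ger0P z) => _; rewrite ?cosN.
have h : c <= 1 - cos (2 ^+ j * y).
  rewrite -(cosn (_ * y)) normrM (ger0_norm (exprn_ge0 _ _)) //.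
  have := sum_wave_sqr (2 ^+ j * `|y|) 0; rewrite subr0 (bigD1 t) //= => e.
  rewrite /c ler_pdivrMr // mulrC -e; apply: ler_wpDr; first by apply: sumr_ge0 => i _; exact: powR_ge0.
  by apply: ge0_ler_powR; rewrite ?nnegrE ?(ltW w0).
have := le_trans h (dblj j y); rewrite mulrC -ler_pdivrMr ?exprn_gt0 //; apply: le_trans.
rewrite ler_pM2l // -real_normK ?num_real //.
have -> : 4 ^+ j = (2 ^+ j) ^+ 2 :> R by rewrite exprAC (_ : 4 = 2 ^+ 2) //; ring.
rewrite -exprVn lerXn2r ?nnegrE ?invr_ge0 ?exprn_ge0 //.
by rewrite -[leRHS]mul1r ler_pdivlMr ?exprn_gt0 // mulrC.
Qed.

Lemma stable_family_2 (r : R) (r1 : 1 <= r) : r = 2 -> stable_family r1.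
Proof.
move=> r2; pose Z M g : RM -> R := rad (fun n _ => haar_coef M g n) (2 ^ M).
have ZE m M g x : (m <= M)%N -> depends_on m g -> Z M g x = Z m g x.
  move=> mM gm; rewrite /Z /rad.
  rewrite -(big_mkord xpredT (fun n => (-1) ^+ (stream n x 0%N) * haar_coef M g n)).
  rewrite -(big_mkord xpredT (fun n => (-1) ^+ (stream n x 0%N) * haar_coef m g n)).
  rewrite (@big_cat_nat _ _ _ (2 ^ m)) //=; last by rewrite leq_exp2l.
  rewrite [X in _ + X]big_nat [X in _ + X]big1 ?addr0 => [|n /andP[mn _]].
    by apply: eq_bigr => n _; rewrite (haar_coef_le n mM gm).
  rewrite (haar_coef_le n mM gm) /haar_coef big1 ?mulr0 // => v _.
  by rewrite haar_support ?mulr0.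
have dep0 M g n : depends_on 0 (fun=> haar_coef M g n) by [].
have [c c0 cP] := one_sub_cos_ge.
have dE M g u : defect (Z M g) u = 1 - \prod_(n < 2 ^ M) (1 - (1 - cos (u * haar_coef M g n))).
  rewrite /Z (defect_rad _ _ (dep0 M g)); congr (1 - _); apply: eq_bigr => n _; congr (1 - _).
  by rewrite /cos_defect sumr_const card_ffun card_bool card_ord expn0 expr0 divr1.
exists (fun i => Z (tag i) (sfun i)), (1 - (1 + c * 4^-1)^-1), 1; split => //.
- by rewrite subr_gt0 invf_lt1 ?ltrDl ?addr_gt0 // divr_gt0.
- by move=> i; apply: measurable_rad.
move=> i j u u0; pose m := maxn (tag i) (tag j).
have di := @sfun_depends i m (leq_maxl _ _); have dj := @sfun_depends j m (leq_maxr _ _).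
pose g s : R := sfun i s - sfun j s.
have -> : (fun x => Z (tag i) (sfun i) x - Z (tag j) (sfun j) x) = Z m g.
  apply/funext => x; rewrite -(ZE _ m) ?leq_maxl //; last exact: sfun_depends.
  rewrite -(ZE (tag j) m) ?leq_maxr //; last exact: sfun_depends.
  by rewrite /Z rad_sub; apply: eq_bigr => n _; rewrite haar_coef_sub.
have NE : (u * `|step r1 i - step r1 j|) `^ r = \sum_(n < 2 ^ m) (u * haar_coef m g n) ^+ 2.
  rewrite powRM ?(ltW u0) // (step_distE r1 (m := m)) ?leq_maxl ?leq_maxr // r2 -haar_parseval.
  by rewrite powR_mulrn ?(ltW u0) // mulr_sumr; apply: eq_bigr => n _; rewrite exprMn.
rewrite NE dE; split.
- rewrite mul1r; apply: le_trans (@subr_prod_le R _ (fun n => 1 - cos (u * haar_coef m g n)) _) _.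
    by move=> n; rewrite one_sub_cos_ge0 one_sub_cos_le2.
  apply: ler_sum => n _; have := one_sub_cos_le (u * haar_coef m g n).
  by rewrite powR_mulrn // real_normK ?num_real.
- move=> /andP[h1 h2]; rewrite lerB //.
  have small n : (n < 2 ^ m)%N -> (u * haar_coef m g n) ^+ 2 <= 1.
    move=> nm; apply: le_trans h2; rewrite (bigD1 (Ordinal nm)) //= lerDl.
    by apply: sumr_ge0 => k _; exact: sqr_ge0.
  have big n : (2 ^ m <= n)%N -> haar_coef m g n = 0.
    by move=> nm; apply: big1 => v _; rewrite haar_support ?mulr0.
  have sm n : (u * haar_coef m g n) ^+ 2 <= 1.
    by have [/small //|/big ->] := ltnP n (2 ^ m); rewrite mulr0 expr0n ler01.
  have a1 n : 0 <= 1 - cos (u * haar_coef m g n) <= 1.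
    rewrite one_sub_cos_ge0 /=; apply: le_trans (sm n).
    by have := one_sub_cos_le (u * haar_coef m g n); rewrite powR_mulrn // real_normK ?num_real.
  have /andP[_ h] := prod_subr_le (2 ^ m) a1; apply: le_trans h _.
  have S : c * 4^-1 <= \sum_(n < 2 ^ m) (1 - cos (u * haar_coef m g n)).
    apply: (@le_trans _ _ (\sum_(n < 2 ^ m) c * (u * haar_coef m g n) ^+ 2)); first by rewrite -mulr_sumr ler_pM2l.
    apply: ler_sum => n _; apply: cP.
    by rewrite -(@ler_pXn2r R 2) ?nnegrE // expr1n real_normK ?num_real.
  have c1 : 0 < c * 4^-1 by rewrite divr_gt0.
  have S0 := lt_le_trans c1 S.
  by rewrite lef_pV2 ?posrE ?lerD2l ?addr_gt0.
Qed.

Lemma stable_family_ex (r : R) (r1 : 1 <= r) : r <= 2 -> stable_family r1.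
Proof.
by rewrite le_eqVlt => /orP[/eqP|]; [exact: stable_family_2|exact: stable_family_lt2].
Qed.

End stable.

(** * Sufficiency *)

Section positive.
Context {R : realType}.
Local Notation RM := (measurableTypeR R).

Lemma esum_bool (a : bool -> \bar R) : (forall h, (0 <= a h)%E) ->
  (\esum_(h in [set: bool]) a h = \sum_(h : bool) a h)%E.
Proof.
move=> a0; rewrite (esumID [set true]) // big_bool /=; congr (_ + _)%E.
  by rewrite setTI esum_set1.
rewrite setTI (_ : ~` [set true] = [set false]) ?esum_set1 //.
by apply/seteqP; split => [[] /= h|[] //]; [case: h|].
Qed.

Lemma esum_int_bool (a : int * bool -> \bar R) : (forall k, (0 <= a k)%E) ->
  (\esum_(k in [set: int * bool]) a k = \esum_(k in [set: int]) \sum_(h : bool) a (k, h))%E.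
Proof.
move=> a0; transitivity (\esum_(k in [set: int]) \esum_(h in [set: bool]) a (k, h))%E.
  rewrite (esum_esum (a := fun k h => a (k, h))) //; congr (esum _ _).
    by apply/seteqP; split => -[].
  by apply/funext => -[].
by apply: eq_esum => k _; rewrite esum_bool.
Qed.

Lemma esum_unit (a : \bar R) : (0 <= a)%E -> (\esum_(k in [set: unit]) a = a)%E.
Proof.
move=> a0; rewrite (_ : [set: unit] = [set tt]); first exact: (esum_set1 (a := fun=> a)).
by apply/seteqP; split => -[].
Qed.

Lemma code_borel_reducible (r p q : R) (r1 : 1 <= r) (Y : normedModType R) (I : countType)
    (T : scode -> I -> Y) (c C : R) : 1 <= p -> 1 <= q -> 0 < c ->
  (forall i j, ((c * `|step r1 i - step r1 j| `^ p)%:E <= \esum_(k in [set: I]) (`|T i k - T j k| `^ q)%:E)%E /\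
    (\esum_(k in [set: I]) (`|T i k - T j k| `^ q)%:E <= (C * `|step r1 i - step r1 j| `^ p)%:E)%E) ->
  borel_reducible (E_rel (L01 r1) p) (E_rel Y q).
Proof.
move=> p1 q1 c0 TP; pose z : scode := existT _ 0%N [ffun=> 0].
pose cd n : scode := odflt z (unpickle n).
apply: (@net_borel_reducible R (L01 r1) Y I p q (fun n => step r1 (cd n)) (fun n => T (cd n)) c C) => //.
- by move=> x e e0; have [i iP] := step_dense x e0; exists (pickle i); rewrite /cd pickleK.
- by move=> i j; have [] := TP (cd i) (cd j).
- by move=> i j; have [] := TP (cd i) (cd j).
Qed.

Lemma borel_reducible_refl (r p : R) (r1 : 1 <= r) : borel_reducible (E_rel (L01 r1) p) (E_rel (L01 r1) p).
Proof. by exists id => // B. Qed.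

Section stable_consequences.
Variables (r : R) (r1 : 1 <= r) (r2 : r <= 2) (X : scode -> RM -> R) (c C : R).
Hypotheses (c0 : 0 < c) (C0 : 0 < C) (mX : forall i, measurable_fun setT (X i)).
Hypothesis XP : forall i j u, 0 < u ->
  defect (fun x => X i x - X j x) u <= C * (u * `|step r1 i - step r1 j|) `^ r /\
  (4^-1 <= (u * `|step r1 i - step r1 j|) `^ r <= 1 -> c <= defect (fun x => X i x - X j x) u).

Let r0 : 0 < r. Proof. exact: lt_le_trans r1. Qed.

Let mD i j : measurable_fun setT (fun x => X i x - X j x). Proof. exact: measurable_funB. Qed.

Lemma stable_scale i j : 0 < `|step r1 i - step r1 j| -> exists k : int,
  `|step r1 i - step r1 j| <= 2 `^ k%:~R /\ c <= defect (fun x => X i x - X j x) (2 `^ k%:~R)^-1.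
Proof.
set s := `|_| => s0; have B1 : 1 < 2 :> R by rewrite ltr1n.
have [m /andP[m1 m2]] := scale_ex B1 s0; exists (m + 1); split; first exact: ltW.
have pk : 0 < 2 `^ (m + 1)%:~R :> R by rewrite powR_gt0.
have [_] := XP i j (u := (2 `^ (m + 1)%:~R)^-1) ltac:(by rewrite invr_gt0); apply.
rewrite -/s mulrC; have h1 : s / 2 `^ (m + 1)%:~R <= 1 by rewrite ler_pdivrMr // mul1r ltW.
have h2 : 2^-1 <= s / 2 `^ (m + 1)%:~R.
  rewrite ler_pdivlMr //; apply: le_trans m1.
  by rewrite intrD powRD ?pnatr_eq0 ?implybT // powRr1 // mulrCA mulVf // mulr1.
rewrite powR_le1 ?(ltW r0) ?h1 ?andbT //; last by rewrite divr_ge0 // ltW.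
apply: (@le_trans _ _ (2^-1 `^ r)); last by apply: ge0_ler_powR; rewrite ?nnegrE ?(ltW r0) ?divr_ge0 ?(ltW s0) ?(ltW pk).
have -> : 4^-1 = 2^-1 `^ 2 :> R by rewrite powR_mulrn // expr2 -invfM; congr (_^-1); ring.
by apply: ger_powR => //; rewrite invr_gt0 ltr0n /= invf_le1 ?ler1n.
Qed.

Lemma stable_moments (b : R) : 0 < b < r -> exists a A : R, [/\ 0 < a, 0 < A & forall i j,
  ((a * `|step r1 i - step r1 j| `^ b)%:E <= \int[lebesgue01 R]_x (`|X i x - X j x| `^ b)%:E)%E /\
  (\int[lebesgue01 R]_x (`|X i x - X j x| `^ b)%:E <= (A * `|step r1 i - step r1 j| `^ b)%:E)%E].
Proof.
move=> br; have /andP[b0 b1] := br; have b2 : b < 2 by exact: lt_le_trans r2.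
have [A A0 AP] := moment_le br b2.
have [|a a0 aP] := @moment_ge R b; first by rewrite b0.
exists (a * c), ((C + 2) * A); split; [exact: mulr_gt0|by rewrite mulr_gt0 ?addr_gt0|move=> i j].
split; last first.
  apply: (AP _ C _ (mD i j) (ltW C0) (normr_ge0 _)) => u u0.
  by have [] := XP i j u0.
have [->|sn] := eqVneq `|step r1 i - step r1 j| 0.
  by rewrite powR0 ?gt_eqF // mulr0; apply: integral_ge0 => x _; rewrite lee_fin powR_ge0.
have s0 : 0 < `|step r1 i - step r1 j| by rewrite lt_def sn normr_ge0.
have [k [k1 k2]] := stable_scale s0.
apply: le_trans (aP _ k (mD i j)); rewrite lee_fin mulrAC -!mulrA ler_pM2l //.
apply: ler_pM; rewrite ?powR_ge0 ?(ltW c0) //.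
by apply: ge0_ler_powR; rewrite ?nnegrE ?(ltW b0) ?powR_ge0.
Qed.

End stable_consequences.

Lemma powR_pow_le (a b x y s q : R) : 0 < s -> 0 <= q -> 0 <= b -> 0 <= y -> 0 <= x -> x `^ s <= b * y `^ a ->
  x `^ q <= b `^ (q / s) * y `^ (a * (q / s)).
Proof.
move=> s0 q0 b0 y0 x0 h.
have -> : x `^ q = (x `^ s) `^ (q / s) by rewrite -powRrM mulrCA divff ?mulr1 ?gt_eqF.
rewrite (powRrM y a) -powRM ?powR_ge0 //.
by apply: ge0_ler_powR; rewrite ?nnegrE ?divr_ge0 ?mulr_ge0 ?powR_ge0 ?(ltW s0).
Qed.

Lemma powR_pow_ge (a b x y s q : R) : 0 < s -> 0 <= q -> 0 <= b -> 0 <= y -> 0 <= x -> b * y `^ a <= x `^ s ->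
  b `^ (q / s) * y `^ (a * (q / s)) <= x `^ q.
Proof.
move=> s0 q0 b0 y0 x0 h.
have -> : x `^ q = (x `^ s) `^ (q / s) by rewrite -powRrM mulrCA divff ?mulr1 ?gt_eqF.
rewrite (powRrM y a) -powRM ?powR_ge0 //.
by apply: ge0_ler_powR; rewrite ?nnegrE ?divr_ge0 ?mulr_ge0 ?powR_ge0 ?(ltW s0).
Qed.

Lemma reducible_same_power (r s p : R) (r1 : 1 <= r) (s1 : 1 <= s) : r <= 2 -> 1 <= p -> s < r ->
  borel_reducible (E_rel (L01 r1) p) (E_rel (L01 s1) p).
Proof.
move=> r2 p1 sr; have s0 : 0 < s by exact: lt_le_trans s1.
have p0 : 0 < p by exact: lt_le_trans p1.
have [X [c [C [c0 C0 mX XP]]]] := stable_family_ex r1 r2.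
have [|a [A [a0 A0 aP]]] := @stable_moments r r1 r2 X c C c0 C0 mX XP s; first by rewrite s0.
pose z : scode := existT _ 0%N [ffun=> 0].
have mZ i : measurable_fun setT (fun x : RM => X i x - X z x) by exact: measurable_funB.
have ex i : exists f : L01 s1, {ae lebesgue01 R, forall x : RM, fn f x = X i x - X z x}.
  by apply: L01_mk => //; have [_ h] := aP i z; apply: le_lt_trans h _; rewrite ltry.
pose T i (_ : unit) := projT1 (cid (ex i)).
have TE i j : (`|T i tt - T j tt| `^ s)%:E = (\int[lebesgue01 R]_x (`|X i x - X j x| `^ s)%:E)%E.
  rewrite (L01_dist_aeE (mZ i) (mZ j) (projT2 (cid (ex i))) (projT2 (cid (ex j)))).
  by apply: eq_integral => x _; rewrite opprB addrA subrK.
have sp : s * (p / s) = p by rewrite mulrCA divff ?mulr1 ?gt_eqF.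
apply: (@code_borel_reducible r p p r1 (L01 s1) unit T (a `^ (p / s)) (A `^ (p / s))) => //.
  exact: powR_gt0.
move=> i j; have [h1 h2] := aP i j; rewrite -TE !lee_fin in h1 h2.
rewrite (eq_esum (b := fun=> (`|T i tt - T j tt| `^ p)%:E)) => [|[] //].
rewrite esum_unit ?lee_fin ?powR_ge0 //; split.
  by have := powR_pow_ge s0 (ltW p0) (ltW a0) (normr_ge0 _) (normr_ge0 _) h1; rewrite sp.
by have := powR_pow_le s0 (ltW p0) (ltW A0) (normr_ge0 _) (normr_ge0 _) h2; rewrite sp.
Qed.

Lemma reducible_snowflake (r s p q : R) (r1 : 1 <= r) (s1 : 1 <= s) : r <= 2 -> s <= 2 -> 1 <= p -> 1 <= q -> p < q ->
  s / q < r / p -> borel_reducible (E_rel (L01 r1) p) (E_rel (L01 s1) q).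
Proof.
move=> r2 s2 p1 q1 pq rs; have s0 : 0 < s by exact: lt_le_trans s1.
have p0 : 0 < p by exact: lt_le_trans p1.
have q0 : 0 < q by exact: lt_le_trans q1.
have r0 : 0 < r by exact: lt_le_trans r1.
have [X [c [C [c0 C0 mX XP]]]] := stable_family_ex r1 r2.
pose al := p / q; have al0 : 0 < al by rewrite divr_gt0.
have al1 : al < 1 by rewrite ltr_pdivrMr // mul1r.
have als : al * s < Num.min s r.
  rewrite lt_min; apply/andP; split; first by rewrite gtr_pMl.
  have -> : al * s = s / q * p by rewrite /al; ring.
  by rewrite -ltr_pdivlMr.
pose ka := (al * s + Num.min s r) / 2.
have ka1 : al * s < ka by rewrite /ka; lra.
have ka2 : ka < Num.min s r by rewrite /ka; lra.
move: ka2; rewrite lt_min => /andP[kas kar].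
have ka0 : 0 < ka by apply: lt_trans ka1; rewrite mulr_gt0.
have [|a [A [a0 A0 aP]]] := @stable_moments r r1 r2 X c C c0 C0 mX XP ka; first by rewrite ka0.
pose W (k : int) (h : bool) i (x : RM) : R := wave h (X i x / 2 `^ k%:~R).
have mW k h i : measurable_fun setT (W k h i).
  have mq : measurable_fun setT (fun x : RM => X i x / 2 `^ k%:~R) by apply: measurable_funM.
  case: h; [apply: (measurableT_comp (continuous_measurable_fun (@continuous_sin R))) mq
           |apply: (measurableT_comp (continuous_measurable_fun (@continuous_cos R))) mq].
have W1 k h i x : `|W k h i x| <= 1 by rewrite /W; case: h; rewrite /= ler_norml ?sin_geN1 ?sin_le1 ?cos_geN1 ?cos_le1.
have ex i (kh : int * bool) : exists f : L01 s1,
    {ae lebesgue01 R, forall x : RM, fn f x = 2 `^ (kh.1%:~R * al) * W kh.1 kh.2 i x}.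
  apply: L01_mk; first exact: measurable_funM.
  apply: (@finite_mu01 R _ (2 `^ (kh.1%:~R * al)) s (ltW s0)); first exact: measurable_funM.
  by move=> x; rewrite normrM ger0_norm ?powR_ge0 // ler_piMr ?powR_ge0.
pose T i kh := projT1 (cid (ex i kh)).
pose Phi k h i j : R := fine (\int[lebesgue01 R]_x (`|W k h i x - W k h j x| `^ s)%:E)%E.
have W2 k h i j x : `|W k h i x - W k h j x| <= 2 by exact: wave_bound.
have PhiE k h i j : ((Phi k h i j)%:E = \int[lebesgue01 R]_x (`|W k h i x - W k h j x| `^ s)%:E)%E.
  rewrite /Phi fineK // ge0_fin_numE; last by apply: integral_ge0 => x _; rewrite lee_fin powR_ge0.
  by apply: (@finite_mu01 R _ 2 s (ltW s0)) => //; exact: measurable_funB.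
have Phi0 k h i j : 0 <= Phi k h i j.
  by rewrite -lee_fin PhiE; apply: integral_ge0 => x _; rewrite lee_fin powR_ge0.
have mP k h i j : measurable_fun setT (fun x : RM => (`|W k h i x - W k h j x| `^ s)%:E).
  exact: measurable_powR_dist.
have TE i j k h : `|T i (k, h) - T j (k, h)| `^ q = 2 `^ (k%:~R * p) * Phi k h i j `^ (q / s).
  have E : `|T i (k, h) - T j (k, h)| `^ s = 2 `^ (k%:~R * al * s) * Phi k h i j.
    apply: EFin_inj; rewrite (L01_dist_aeE _ _ (projT2 (cid (ex i (k, h)))) (projT2 (cid (ex j (k, h))))) /=; try exact: measurable_funM.
    rewrite EFinM PhiE -ge0_integralZl_EFin ?powR_ge0 //.
    apply: eq_integral => x _; rewrite -EFinM -mulrBr normrM powRM // ger0_norm ?powR_ge0 //.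
    by rewrite -powRrM.
  have qE : s * (q / s) = q by rewrite mulrCA divff ?mulr1 ?gt_eqF.
  transitivity ((`|T i (k, h) - T j (k, h)| `^ s) `^ (q / s)); first by rewrite -powRrM qE.
  rewrite E powRM ?powR_ge0 // -powRrM.
  by congr (2 `^ _ * _); rewrite /al; field; rewrite !gt_eqF.
have Phi2 k h i j : Phi k h i j <= 2 `^ s.
  rewrite -lee_fin PhiE (_ : (2 `^ s)%:E = \int[lebesgue01 R]_x (cst (2 `^ s)%:E x))%E; last first.
    by rewrite integral_cst // mu01_setT mule1.
  apply: ge0_le_integral => // x _; rewrite lee_fin.
  by apply: ge0_ler_powR; rewrite ?nnegrE ?(ltW s0).
have PhiU k h i j : Phi k h i j <= 2 `^ (s - ka) * A * (`|step r1 i - step r1 j| / 2 `^ k%:~R) `^ ka.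
  have [_ hA] := aP i j.
  apply: (@le_trans _ _ (2 `^ (s - ka) * (2 `^ k%:~R)^-1 `^ ka * (A * `|step r1 i - step r1 j| `^ ka))); last first.
    rewrite powRM ?invr_ge0 ?powR_ge0 //.
    by rewrite le_eqVlt; apply/orP; left; apply/eqP; ring.
  rewrite -lee_fin PhiE EFinM.
  have K0 : (0 <= (2 `^ (s - ka) * (2 `^ k%:~R)^-1 `^ ka)%:E)%E by rewrite lee_fin mulr_ge0 ?powR_ge0.
  apply: le_trans (lee_wpmul2l K0 hA).
  have mX' : measurable_fun setT (fun x : RM => (`|X i x - X j x| `^ ka)%:E) by exact: measurable_powR_dist.
  rewrite -ge0_integralZl_EFin ?mulr_ge0 ?powR_ge0 //.
  apply: ge0_le_integral => //.
  - exact: measurable_funeM.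
  - move=> x _; rewrite -EFinM lee_fin.
    have -> : `|W k h i x - W k h j x| `^ s = `|W k h i x - W k h j x| `^ (s - ka) * `|W k h i x - W k h j x| `^ ka.
      by rewrite -powRD ?subrK // (gt_eqF s0).
    rewrite -mulrA; apply: ler_pM; rewrite ?powR_ge0 //.
      by apply: ge0_ler_powR; rewrite ?nnegrE ?subr_ge0 ?(ltW kas).
    rewrite -powRM ?invr_ge0 ?powR_ge0 //; apply: ge0_ler_powR; rewrite ?nnegrE ?(ltW ka0) ?mulr_ge0 ?invr_ge0 ?powR_ge0 //.
    apply: le_trans (wave_lip _ _ _) _.
    by rewrite -mulrBl normrM (ger0_norm (x := (_)^-1)) ?invr_ge0 ?powR_ge0 // mulrC.
have B1 : 1 < 2 :> R by rewrite ltr1n.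
have [|D D0 DP] := @scale_sum R 2 p 0 (ka * (q / s)) B1.
  rewrite p0 /= mulrA ltr_pdivlMr //; move: ka1; rewrite /al -(ltr_pM2r q0).
  by rewrite mulrAC divfK ?gt_eqF.
pose K := (2 `^ (s - ka) * A) `^ (q / s) + 2 `^ q.
have K0 : 0 <= K by rewrite addr_ge0 ?powR_ge0.
have qs0 : 0 <= q / s by rewrite divr_ge0 ?ltW.
pose e := (2 `^ (s - 2) * c) `^ (q / s).
have e0 : 0 < e by rewrite powR_gt0 // mulr_gt0 // powR_gt0.
apply: (@code_borel_reducible r p q r1 (L01 s1) (int * bool)%type T e (K * D + K * D)) => // i j.
have S0 k : (0 <= (`|T i k - T j k| `^ q)%:E)%E by rewrite lee_fin powR_ge0.
have [s00|sn] := eqVneq `|step r1 i - step r1 j| 0.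
  have P0 k h : Phi k h i j = 0.
    apply/eqP; rewrite eq_le Phi0 andbT; apply: le_trans (PhiU k h i j) _.
    by rewrite s00 mul0r powR0 ?gt_eqF // mulr0.
  rewrite s00 powR0 ?gt_eqF // !mulr0 esum1 // => -[k h] _.
  by rewrite TE P0 powR0 ?mulr0 // gt_eqF // divr_gt0.
have sg : 0 < `|step r1 i - step r1 j| by rewrite lt_def sn normr_ge0.
split; last first.
- rewrite esum_int_bool //.
  under eq_esum => k _ do rewrite big_bool /= !TE.
  rewrite esumD; [|by move=> k _; rewrite lee_fin mulr_ge0 ?powR_ge0|by move=> k _; rewrite lee_fin mulr_ge0 ?powR_ge0].
  rewrite mulrDl EFinD.
  have U h : (\esum_(k in [set: int]) (2 `^ (k%:~R * p) * Phi k h i j `^ (q / s))%:E <= (K * D * `|step r1 i - step r1 j| `^ p)%:E)%E.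
    apply: (DP _ K (fun k => Phi k h i j `^ (q / s))) => // k.
    - exact: powR_ge0.
    - rewrite (powRrM _ ka); apply: (@le_trans _ _ ((2 `^ (s - ka) * A) `^ (q / s) * ((`|step r1 i - step r1 j| / 2 `^ k%:~R) `^ ka) `^ (q / s))).
        rewrite -powRM ?mulr_ge0 ?powR_ge0 ?(ltW A0) //; apply: ge0_ler_powR; rewrite ?nnegrE ?Phi0 ?qs0 ?mulr_ge0 ?powR_ge0 ?(ltW A0) //.
      by apply: ler_wpM2r; rewrite ?powR_ge0 // lerDl powR_ge0.
    - rewrite powRr0 mulr1; apply: (@le_trans _ _ (2 `^ q)); last by rewrite lerDr powR_ge0.
      have -> : 2 `^ q = (2 `^ s) `^ (q / s) :> R by rewrite -powRrM mulrCA divff ?mulr1 ?gt_eqF.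
      by apply: ge0_ler_powR; rewrite ?nnegrE ?powR_ge0.
  by apply: leeD; exact: U.
- have [k [k1 k2]] := stable_scale r2 XP sg.
  have [h hP] : exists h, 2 `^ (s - 2) * c <= Phi k h i j.
    apply/not_existsP => H.
    have lt h : Phi k h i j < 2 `^ (s - 2) * c by rewrite ltNge; apply/negP; exact: H.
    have mDf : measurable_fun setT (fun x : RM => X i x - X j x) by exact: measurable_funB.
    have [dE _] := defectE (2 `^ k%:~R)^-1 mDf.
    have p2 : 0 < 2 `^ (2 - s) :> R by rewrite powR_gt0.
    have : 2 * defect (fun x => X i x - X j x) (2 `^ k%:~R)^-1 <= 2 `^ (2 - s) * (Phi k true i j + Phi k false i j).
      rewrite -lee_fin (EFinM 2) dE (EFinM (2 `^ (2 - s))) (EFinD (Phi k true i j)) !PhiE.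
      have m1 : measurable_fun setT (fun x : RM => (1 - cos ((2 `^ k%:~R)^-1 * (X i x - X j x)))%:E).
        by apply/measurable_EFinP; exact: measurable_defect.
      have m2 : measurable_fun setT (fun x : RM => ((`|W k true i x - W k true j x| `^ s)%:E + (`|W k false i x - W k false j x| `^ s)%:E)%E).
        exact: emeasurable_funD.
      have n1 (x : RM) : [set: RM] x -> (0 <= (1 - cos ((2 `^ k%:~R)^-1 * (X i x - X j x)))%:E)%E.
        by rewrite lee_fin one_sub_cos_ge0.
      have n2 (x : RM) : [set: RM] x -> (0 <= (`|W k true i x - W k true j x| `^ s)%:E + (`|W k false i x - W k false j x| `^ s)%:E)%E.
        by rewrite adde_ge0 // lee_fin powR_ge0.
      rewrite -ge0_integralD // -!ge0_integralZl_EFin ?(ltW p2) //.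
      have m3 := measurable_funeM 2%:E m1; have m4 := measurable_funeM (2 `^ (2 - s))%:E m2.
      have n3 (x : RM) : [set: RM] x -> (0 <= 2%:E * (1 - cos ((2 `^ k%:~R)^-1 * (X i x - X j x)))%:E)%E.
        by move=> _; rewrite mule_ge0 // n1.
      apply: ge0_le_integral => // x _; rewrite -EFinD -!EFinM lee_fin.
      have -> : (2 `^ k%:~R)^-1 * (X i x - X j x) = X i x / 2 `^ k%:~R - X j x / 2 `^ k%:~R by ring.
      rewrite -sum_wave_sqr big_bool /= mulrDr.
      have D2 b : `|W k b i x - W k b j x| `^ 2 <= 2 `^ (2 - s) * `|W k b i x - W k b j x| `^ s.
        have [->|dn] := eqVneq `|W k b i x - W k b j x| 0; first by rewrite !powR0 ?gt_eqF ?mulr0.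
        have -> : `|W k b i x - W k b j x| `^ 2 = `|W k b i x - W k b j x| `^ (2 - s) * `|W k b i x - W k b j x| `^ s.
          by rewrite -powRD ?subrK // dn implybT.
        by apply: ler_wpM2r; rewrite ?powR_ge0 //; apply: ge0_ler_powR; rewrite ?nnegrE ?subr_ge0.
      by apply: lerD; [exact: (D2 true)|exact: (D2 false)].
    have PQ : 2 `^ (2 - s) * 2 `^ (s - 2) = 1 :> R.
      by rewrite -powRD ?pnatr_eq0 ?implybT // addrA subrK subrr powRr0.
    have t3 : 2 `^ (2 - s) * (Phi k true i j + Phi k false i j) < 2 * c.
      move: (lt true) (lt false) p2 PQ.
      move: (Phi k true i j) (Phi k false i j) (2 `^ (2 - s)) (2 `^ (s - 2)) => x y P Q xQ yQ P0 PQ.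
      have -> : 2 * c = P * (Q * c + Q * c) by rewrite -mulrDl mulrA mulrDr PQ.
      by rewrite ltr_pM2l // ltrD.
    by move=> /le_lt_trans /(_ t3); rewrite ltr_pM2l // ltNge k2.
  apply: le_trans (esum_ge1 (k, h) S0); rewrite lee_fin TE mulrC; apply: ler_pM; rewrite ?powR_ge0 ?(ltW e0) //.
    by rewrite powRrM; apply: ge0_ler_powR; rewrite ?nnegrE ?(ltW p0) ?powR_ge0.
  by apply: ge0_ler_powR; rewrite ?nnegrE ?Phi0 ?qs0 ?mulr_ge0 ?powR_ge0 ?(ltW c0).
Qed.

End positive.

Section packing.
Context {R : realType}.
Local Notation RM := (measurableTypeR R).
Implicit Types (G : nat -> (nat -> bool) -> R).

(* [at_slot n] has probability [2 ^- n.+1] and the slots are disjoint: on slot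
   [n] the packed function is a rescaled copy of [G n], so that one function on
   [0, 1] carries the whole sequence. *)
Definition first_one n : {ffun 'I_n.+1 -> bool} := [ffun i : 'I_n.+1 => i == n :> nat].
Definition at_slot n (s : nat -> bool) : bool := pre n.+1 s == first_one n.

Lemma at_slot_inj n n' s : at_slot n s -> at_slot n' s -> n = n'.
Proof.
wlog h : n n' / (n < n')%N.
  move=> H a b; case: (ltngtP n n') => // h; first exact: H h a b.
  by apply/esym; exact: H h b a.
have e : (inord n : 'I_n'.+1) = n :> nat by rewrite inordK // ltnS ltnW.
move=> a b; move/eqP/ffunP/(_ ord_max): a; move/eqP/ffunP/(_ (inord n)): b.
by rewrite !ffunE e => -> /=; rewrite eqxx (ltn_eqF h).
Qed.

Lemma slot_prob n M : (n < M)%N ->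
  (\sum_(v : {ffun 'I_M -> bool}) (at_slot n (lift_seq v))%:R) / 2 ^+ M = (2 ^+ n.+1)^-1 :> R.
Proof.
move=> nM; have inj : injective (widen_ord nM) by move=> i j /(congr1 val) h; exact: val_inj.
have S1 : \sum_t (t == first_one n)%:R = 1 :> R.
  by rewrite (bigD1 (first_one n)) //= eqxx big1 ?addr0 // => t /negbTE ->.
have := @sum_restr _ M (widen_ord nM) inj R (fun t => (t == first_one n)%:R).
rewrite card_ord S1 mul1r => <-; congr (_ / _); apply: eq_bigr => v _; congr (_ == _)%:R.
by apply/ffunP => i; rewrite !ffunE (lift_seqE v (widen_ord nM i)).
Qed.

Definition slot_term (f : (nat -> bool) -> R) n (x : R) : R := (at_slot n (stream 0 x))%:R * f (stream 1 x).

Let slot_grid f n m x : depends_on m f -> let M := maxn n.+1 m in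
  slot_term f n x = (fun w : {ffun 'I_2 * 'I_M -> bool} =>
    (at_slot n (lift_seq (grow w ord0)))%:R * f (lift_seq (grow w ord_max))) (grid 2 M x).
Proof.
move=> fm M; have rowE (k : 'I_2) : grow (grid 2 M x) k = pre M (stream k x).
  by apply/ffunP => j; rewrite !ffunE.
rewrite /slot_term !rowE /at_slot pre_lift ?leq_maxl //; congr (_ * _).
by rewrite fm [RHS]fm pre_lift // leq_maxr.
Qed.

Lemma measurable_slot_term f n m : depends_on m f -> measurable_fun setT (slot_term f n : RM -> R).
Proof.
move=> fm; apply: eq_measurable_fun (@measurable_grid R 2 (maxn n.+1 m) (fun w =>
    (at_slot n (lift_seq (grow w ord0)))%:R * f (lift_seq (grow w ord_max)))) => x _.
by rewrite (slot_grid n x fm).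
Qed.

Lemma integral_slot_term f n m : depends_on m f -> (forall s, 0 <= f s) ->
  (\int[lebesgue01 R]_x (slot_term (fun s => 2 ^+ n.+1 * f s) n x)%:E = \int[lebesgue01 R]_x (f (digs x))%:E)%E.
Proof.
move=> fm f0; pose M := maxn n.+1 m.
have fm2 : depends_on m (fun s => 2 ^+ n.+1 * f s) by exact: depends_scale.
have fM : depends_on M f by move=> s; rewrite [LHS]fm [RHS]fm pre_lift // leq_maxr.
under eq_integral => x _ do rewrite (slot_grid n x fm2).
rewrite (@grid_law R 2 M (fun w => (at_slot n (lift_seq (grow w ord0)))%:R * (2 ^+ n.+1 * f (lift_seq (grow w ord_max))))); last first.
  by move=> w; rewrite !mulr_ge0 ?exprn_ge0.
under [RHS]eq_integral => x _ do rewrite fM.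
rewrite (@digs_law R M (fun v => f (lift_seq v))) //; congr EFin.
pose H (k : 'I_2) (v : {ffun 'I_M -> bool}) : R :=
  if k == ord0 then (at_slot n (lift_seq v))%:R else 2 ^+ n.+1 * f (lift_seq v).
have := grid_prod H; rewrite big_ord_recl big_ord1 /=.
under eq_bigr => w _ do rewrite big_ord_recl big_ord1 /=.
have -> : lift ord0 ord0 = ord_max :> 'I_2 by apply: val_inj.
rewrite /H /= => ->; rewrite -mulr_sumr mul2n -addnn exprD.
have nM : (n < M)%N by rewrite leq_maxl.
have := slot_prob nM; set P := \sum_v _; set S := \sum_v _ => h.
have p1 : 2 ^+ M != 0 :> R by rewrite expf_neq0 // pnatr_eq0.
have p2 : 2 ^+ n.+1 != 0 :> R by rewrite expf_neq0 // pnatr_eq0.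
rewrite invfM [LHS](_ : _ = P / 2 ^+ M * 2 ^+ n.+1 * (S / 2 ^+ M)); last by ring.
by rewrite h mulVf ?mul1r.
Qed.

Variable s : R.
Hypothesis s1 : 1 <= s.
Let s0 : 0 < s. Proof. exact: lt_le_trans s1. Qed.

Definition packed_sum G N (x : R) : R :=
  \sum_(0 <= n < N) slot_term (fun z => (2 ^+ n.+1) `^ s^-1 * G n z) n x.
Definition packed G (x : RM) : R := limn (fun N => packed_sum G N x).

Lemma packed_cvg G x : (fun N => packed_sum G N x) @ \oo --> packed G x /\
  (forall n, at_slot n (stream 0 x) -> packed G x = (2 ^+ n.+1) `^ s^-1 * G n (stream 1 x)) /\
  ((forall n, ~~ at_slot n (stream 0 x)) -> packed G x = 0).
Proof.
have [[n nP]|no] := pselect (exists n, at_slot n (stream 0 x)); last first.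
  have z N : packed_sum G N x = 0.
    apply: big1_seq => n _; rewrite /slot_term (_ : at_slot _ _ = false) ?mul0r //.
    by apply/negP => h; apply: no; exists n.
  have cv : (fun N => packed_sum G N x) @ \oo --> (0 : R).
    by rewrite (_ : (fun N => _) = fun=> 0); [exact: cvg_cst|apply/funext].
  have E : packed G x = 0 by apply: cvg_lim.
  by rewrite E; split => //; split => // n h; exfalso; apply: no; exists n.
pose v := (2 ^+ n.+1) `^ s^-1 * G n (stream 1 x).
have z N : (n < N)%N -> packed_sum G N x = v.
  move=> nN; rewrite /packed_sum (bigD1_seq n) ?mem_index_iota ?iota_uniq //= /slot_term nP mul1r.
  rewrite big1 ?addr0 // => k kn; rewrite (_ : at_slot _ _ = false) ?mul0r //.
  by apply/negP => h; move: kn; rewrite (at_slot_inj nP h) eqxx.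
have cv : (fun N => packed_sum G N x) @ \oo --> v.
  by apply: cvg_near_cst; exists n.+1 => // N /= nN; exact: z.
have E : packed G x = v by apply: cvg_lim.
rewrite E; split => //; split => [k kP|h]; first by rewrite -(at_slot_inj nP kP).
by have := h n; rewrite nP.
Qed.

Lemma measurable_packed G m : (forall n, depends_on m (G n)) -> measurable_fun setT (packed G).
Proof.
move=> Gm; apply: (@measurable_fun_cvg _ RM R setT (packed_sum G)) => [N|x _]; last by have [] := packed_cvg G x.
apply: measurable_sum => n; apply: (@measurable_slot_term _ n m); exact: depends_scale.
Qed.

Lemma nneseries_single (u : nat -> \bar R) n : (forall k, (0 <= u k)%E) -> (forall k, k != n -> u k = 0%E) ->
  (\sum_(0 <= k <oo) u k = u n)%E.
Proof.
move=> u0 un; rewrite nneseries_esumT // (esumID [set n]) // setTI esum_set1 // esum1 ?adde0 // => k [_ kn].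
by apply: un; apply/eqP.
Qed.

Lemma packed_dist G G' m : (forall n, depends_on m (G n)) -> (forall n, depends_on m (G' n)) ->
  (\int[lebesgue01 R]_x (`|packed G x - packed G' x| `^ s)%:E =
   \sum_(0 <= n <oo) \int[lebesgue01 R]_x (`|G n (digs x) - G' n (digs x)| `^ s)%:E)%E.
Proof.
move=> Gm Gm'; pose f n z : R := `|G n z - G' n z| `^ s.
have fm n : depends_on m (f n) by move=> z; rewrite /f [in LHS]Gm [in LHS]Gm'.
have f0 n z : 0 <= f n z by exact: powR_ge0.
have t0 n x : (0 <= (slot_term (fun z => 2 ^+ n.+1 * f n z) n x)%:E)%E.
  by rewrite lee_fin /slot_term !mulr_ge0 ?exprn_ge0.
rewrite (eq_integral (fun x : RM => \sum_(0 <= n <oo) (slot_term (fun z => 2 ^+ n.+1 * f n z) n x)%:E)%E).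
  rewrite integral_nneseries //.
    by apply: eq_eseriesr => n _; rewrite (integral_slot_term n (fm n)).
  move=> n; apply/measurable_EFinP; apply: (@measurable_slot_term _ n m); exact: depends_scale.
move=> x _; have [_ [h1 h2]] := packed_cvg G x; have [_ [h1' h2']] := packed_cvg G' x.
have [[n nP]|no] := pselect (exists n, at_slot n (stream 0 x)); last first.
  have nn n : ~~ at_slot n (stream 0 x) by apply/negP => h; apply: no; exists n.
  rewrite h2 // h2' // subrr normr0 powR0 ?gt_eqF // eseries0 // => n _ _.
  by rewrite /slot_term (negbTE (nn n)) mul0r.
rewrite (h1 n nP) (h1' n nP) -mulrBr normrM powRM // ger0_norm ?powR_ge0 // -powRrM mulVf ?gt_eqF // powRr1 ?exprn_ge0 //.
rewrite (@nneseries_single _ n) // /slot_term ?nP ?mul1r // => k kn.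
by rewrite (_ : at_slot _ _ = false) ?mul0r //; apply/negP => h; move: kn; rewrite (at_slot_inj nP h) eqxx.
Qed.

End packing.

Section critical.
Context {R : realType}.
Local Notation RM := (measurableTypeR R).

Lemma reducible_critical (r s p q : R) (r1 : 1 <= r) (s1 : 1 <= s) : 1 <= p -> 1 <= q -> r < s ->
  r / p = s / q -> borel_reducible (E_rel (L01 r1) p) (E_rel (L01 s1) q).
Proof.
move=> p1 q1 rs rpsq; have s0 : 0 < s by exact: lt_le_trans s1.
have p0 : 0 < p by exact: lt_le_trans p1.
have q0 : 0 < q by exact: lt_le_trans q1.
have r0 : 0 < r by exact: lt_le_trans r1.
have [|c [C [c0 C0 cC]]] := @wave_snowflake R r s; first by rewrite r0.
pose val (i : scode) (kh : int * bool) (z : nat -> bool) : R :=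
  2 `^ (kh.1%:~R * (r / s)) * (wave kh.2 (sfun i z / 2 `^ kh.1%:~R) - wave kh.2 0).
pose G i n z : R := if pickle_inv n is Some kh then val i kh z else 0.
have Gdep i m n : (tag i <= m)%N -> depends_on m (G i n).
  by move=> im z; rewrite /G; case: pickle_inv => // kh; rewrite /val [in LHS](sfun_depends im).
have mV i : measurable_fun setT (packed s (G i)).
  by apply: (@measurable_packed R s _ (tag i)) => n; exact: Gdep.
have dist i j : ((c * `|step r1 i - step r1 j| `^ r)%:E <= \int[lebesgue01 R]_x (`|packed s (G i) x - packed s (G j) x| `^ s)%:E)%E /\
    (\int[lebesgue01 R]_x (`|packed s (G i) x - packed s (G j) x| `^ s)%:E <= (C * `|step r1 i - step r1 j| `^ r)%:E)%E.
  pose m := maxn (tag i) (tag j).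
  have di n : depends_on m (G i n) by apply: Gdep; exact: leq_maxl.
  have dj n : depends_on m (G j n) by apply: Gdep; exact: leq_maxr.
  rewrite (packed_dist s1 di dj).
  have mt n : measurable_fun setT (fun x : RM => (`|G i n (digs x) - G j n (digs x)| `^ s)%:E).
    have dep : depends_on m (fun z => `|G i n z - G j n z| `^ s) by move=> z; rewrite [in LHS]di [in LHS]dj.
    apply/measurable_EFinP.
    apply: eq_measurable_fun (@measurable_cylinder R m (fun v => `|G i n (lift_seq v) - G j n (lift_seq v)| `^ s)) => x _.
    by rewrite /= -dep.
  rewrite -integral_nneseries //.
  have mS : measurable_fun setT (fun x : RM => \sum_(0 <= n <oo) (`|G i n (digs x) - G j n (digs x)| `^ s)%:E)%E.
    by apply: ge0_emeasurable_sum => // n x _ _; rewrite lee_fin powR_ge0.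
  have ptE (x : RM) : (\sum_(0 <= n <oo) (`|G i n (digs x) - G j n (digs x)| `^ s)%:E =
     \esum_(k in [set: int]) (2 `^ (k%:~R * r) * \sum_(h : bool) `|wave h (sfun i (digs x) / 2 `^ k%:~R) - wave h (sfun j (digs x) / 2 `^ k%:~R)| `^ s)%:E)%E.
    pose a (kh : int * bool) : \bar R := (`|val i kh (digs x) - val j kh (digs x)| `^ s)%:E.
    have a0 kh : (0 <= a kh)%E by rewrite lee_fin powR_ge0.
    rewrite nneseries_esumT; last by move=> n; rewrite lee_fin powR_ge0.
    transitivity (\esum_(n in [set: nat]) oapp a 0%E (@pickle_inv (int * bool)%type n)).
      apply: eq_esum => n _; rewrite /G; case: pickle_inv => //=.
      by rewrite subrr normr0 powR0 // gt_eqF.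
    rewrite esum_pickle // esum_int_bool //; apply: eq_esum => k _.
    rewrite sumEFin; congr EFin; rewrite mulr_sumr; apply: eq_bigr => h _.
    rewrite /val -mulrBr normrM powRM // ger0_norm ?powR_ge0 // -powRrM opprB addrA subrK.
    by congr (2 `^ _ * _); rewrite -mulrA divfK ?gt_eqF.
  have mF : measurable_fun setT (fun x : RM => (`|sfun i (digs x) - sfun j (digs x)| `^ r)%:E).
    by apply: measurable_powR_dist; exact: measurable_sfun.
  have F0 (x : RM) : [set: RM] x -> (0 <= (`|sfun i (digs x) - sfun j (digs x)| `^ r)%:E)%E by rewrite lee_fin powR_ge0.
  have S0 (x : RM) : [set: RM] x -> (0 <= \sum_(0 <= n <oo) (`|G i n (digs x) - G j n (digs x)| `^ s)%:E)%E.
    by move=> _; apply: nneseries_ge0 => n _ _; rewrite lee_fin powR_ge0.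
  rewrite !EFinM (L01_dist_aeE (measurable_sfun _) (measurable_sfun _) (stepE r1 i) (stepE r1 j)).
  rewrite -!ge0_integralZl_EFin ?(ltW c0) ?(ltW C0) //; split; apply: ge0_le_integral => //.
  - by move=> x _; rewrite mule_ge0 ?lee_fin ?powR_ge0 ?(ltW c0).
  - exact: measurable_funeM.
  - by move=> x _; rewrite ptE -EFinM; have [] := cC (sfun i (digs x)) (sfun j (digs x)).
  - exact: measurable_funeM.
  - by move=> x _; rewrite ptE -EFinM; have [] := cC (sfun i (digs x)) (sfun j (digs x)).
pose z : scode := existT _ 0%N [ffun=> 0].
have mZ i : measurable_fun setT (fun x => packed s (G i) x - packed s (G z) x) by exact: measurable_funB.
have ex i : exists f : L01 s1, {ae lebesgue01 R, forall x : RM, fn f x = packed s (G i) x - packed s (G z) x}.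
  by apply: L01_mk => //; have [_ h] := dist i z; apply: le_lt_trans h _; rewrite ltry.
pose T i (_ : unit) := projT1 (cid (ex i)).
have TE i j : (`|T i tt - T j tt| `^ s)%:E = (\int[lebesgue01 R]_x (`|packed s (G i) x - packed s (G j) x| `^ s)%:E)%E.
  rewrite (L01_dist_aeE (mZ i) (mZ j) (projT2 (cid (ex i))) (projT2 (cid (ex j)))).
  by apply: eq_integral => x _; rewrite opprB addrA subrK.
have rp : r * (q / s) = p.
  have -> : q / s = p / r by rewrite -[q / s]invf_div -rpsq invf_div.
  by rewrite mulrCA divff ?mulr1 ?gt_eqF.
apply: (@code_borel_reducible R r p q r1 (L01 s1) unit T (c `^ (q / s)) (C `^ (q / s))) => //.
  exact: powR_gt0.
move=> i j; have [h1 h2] := dist i j; rewrite -TE !lee_fin in h1 h2.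
rewrite (eq_esum (b := fun=> (`|T i tt - T j tt| `^ q)%:E)) => [|[] //].
rewrite esum_unit ?lee_fin ?powR_ge0 //; split.
  by have := powR_pow_ge s0 (ltW q0) (ltW c0) (normr_ge0 _) (normr_ge0 _) h1; rewrite rp.
by have := powR_pow_le s0 (ltW q0) (ltW C0) (normr_ge0 _) (normr_ge0 _) h2; rewrite rp.
Qed.

End critical.

Theorem theorem1p4 (R : realType) (r s p q : R)
    (r1 : 1 <= r) (r2 : r <= 2) (s1 : 1 <= s) (s2 : s <= 2)
    (p1 : 1 <= p) (q1 : 1 <= q) (sq : s <= q) :
  borel_reducible (E_rel (L01 r1) p) (E_rel (L01 s1) q)
  <-> (p <= q /\ r / p >= s / q).
Proof.
split=> [red|[pq rspq]].
  by split; [exact: reduction_le red|exact: reduction_type_le red s2 sq].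
have p0 : 0 < p by exact: lt_le_trans p1.
have s0 : 0 < s by exact: lt_le_trans s1.
move: pq rspq; rewrite le_eqVlt => /orP[/eqP pq|pq].
  subst q; rewrite ler_pM2r ?invr_gt0 // le_eqVlt => /orP[/eqP rs|sr].
    by subst s; rewrite (bool_irrelevance s1 r1); exact: borel_reducible_refl.
  exact: reducible_same_power.
rewrite le_eqVlt => /orP[/eqP rspq|rspq]; last exact: reducible_snowflake.
apply: reducible_critical => //.
have q0 : 0 < q by exact: lt_le_trans q1.
have -> : r = s / q * p by rewrite rspq divfK ?gt_eqF.
by rewrite mulrAC ltr_pdivrMr // ltr_pM2l.
Qed.
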